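(* Let $M=M^n$ be a Wintgen ideal submanifold of dimension $n\ge 4$ and codimension $m\ge 2$ in a real space form $\mathbb{R}^{n+m}(\widetilde{k})$. If $\widetilde{k}>0$, then the tensors $R\cdot C-C\cdot R$ and $Q(g,R)$ are linearly dependent if and only if $M$ is totally umbilical in $\mathbb{R}^{n+m}(\widetilde{k})$ (and hence $M$ is conformally flat).
   Context: Manifolds are connected, Riemannian and of class $C^\infty$. $\mathbb{R}^{n+m}(\widetilde{k})$ is a real space form: a Riemannian manifold of dimension $n+m$ and constant curvature $\widetilde{k}$, with metric $\widetilde{g}$. The submanifold $M$ carries the induced metric $g$ with Levi-Civita connection $\nabla$; $h$ is its second fundamental form and the shape operator $A_\xi$ for a normal field $\xi$ is given by $g(A_\xi X,Y)=\widetilde{g}(\xi,h(X,Y))$. $\{E_i\}_{i=1}^n$ is any local orthonormal tangent frame and $\{\xi_\alpha\}_{\alpha=1}^m$ any local orthonormal normal frame; $A_\alpha=A_{\xi_\alpha}$. The mean curvature vector is $\vec{H}=\frac1n\sum_i h(E_i,E_i)$ and $H=\|\vec{H}\|$. $M$ is totally umbilical if $h(X,Y)=g(X,Y)\vec{H}$. For a symmetric $(0,2)$-tensor $A$: $(X\wedge_A Y)Z=A(Y,Z)X-A(X,Z)Y$. $\mathcal{R}(X,Y)Z=\nabla_X\nabla_YZ-\nabla_Y\nabla_XZ-\nabla_{[X,Y]}Z$, $R(X,Y,Z,W)=g(\mathcal{R}(X,Y)Z,W)$, $\mathrm{Ricc}(X,Y)=\mathrm{tr}\{Z\mapsto\mathcal{R}(Z,X)Y\}$,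 $g(\mathcal{S}X,Y)=\mathrm{Ricc}(X,Y)$, $\kappa=\mathrm{tr}\,\mathcal{S}$, and the Weyl tensor is $C(X,Y,Z,W)=g(\mathcal{C}(X,Y)Z,W)$ with $\mathcal{C}(X,Y)=\mathcal{R}(X,Y)-\frac1{n-2}\left(X\wedge_g\mathcal{S}Y+\mathcal{S}X\wedge_gY-\frac{\kappa}{n-1}X\wedge_gY\right)$. For a skew family of endomorphisms $\mathcal{B}(X,Y)$ and a $(0,k)$-tensor $T$ put $(\mathcal{B}(X,Y)\cdot T)(X_1,\dots,X_k)=-\sum_{j=1}^k T(X_1,\dots,\mathcal{B}(X,Y)X_j,\dots,X_k)$. The $(0,k+2)$-tensors $R\cdot T$, $C\cdot T$, $Q(A,T)$ are defined by $(X_1,\dots,X_k;X,Y)\mapsto(\mathcal{B}(X,Y)\cdot T)(X_1,\dots,X_k)$ with $\mathcal{B}(X,Y)=\mathcal{R}(X,Y)$, $\mathcal{C}(X,Y)$, $X\wedge_AY$ respectively. Two tensors $T_1,T_2$ are called linearly dependent (on $M$) if they are linearly dependent at every point of $M$; on the set where $T_2\neq0$ this means $T_1=L\,T_2$ for some function $L$. Normalized scalar curvature: $\rho=\frac{2}{n(n-1)}\sum_{i<j}R(E_i,E_j,E_j,E_i)$. Normal curvature: $R^\perp(X,Y;\xi,\eta)=g([A_\xi,A_\eta]X,Y)$, and $\rho^\perp=\frac{2}{n(n-1)}\sqrt{\sum_{i<j}\sum_{\alpha<\beta}R^\perp(E_i,E_j;\xi_\alpha,\xi_\beta)^2}$.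 $M$ is a Wintgen ideal submanifold if $\rho=H^2-\rho^\perp+\widetilde{k}$ everywhere on $M$ (equality in the Wintgen inequality $\rho\le H^2-\rho^\perp+\widetilde{k}$). *)

(* Defs.v *)
(* MathComp-Analysis.  Manifolds are given by atlases; tensors at a point are
   written in the components of a chart around it (row vectors). *)
From mathcomp Require Import all_boot all_order all_algebra.
From mathcomp Require Import all_classical all_reals all_analysis.

Set Implicit Arguments.
Unset Strict Implicit.
Unset Printing Implicit Defensive.

Import Order.TTheory GRing.Theory Num.Theory numFieldNormedType.Exports.

Local Open Scope classical_set_scope.
Local Open Scope ring_scope.

(* Class C^k on an open set U, via Frechet derivatives: the differential exists
   and each of its values on a fixed vector is C^(k-1). *)
Fixpoint Ck_on (R : realType) (n : nat) (W : normedModType R) (k : nat)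
    (U : set 'rV[R]_n) (F : 'rV[R]_n -> W) : Prop :=
  match k with
  | 0%N => forall x, U x -> {for x, continuous F}
  | k'.+1 => (forall x, U x -> differentiable F x) /\
             (forall v : 'rV[R]_n, Ck_on k' U (fun x => 'D_v F x))
  end.

Definition smooth_on (R : realType) (n : nat) (W : normedModType R)
    (U : set 'rV[R]_n) (F : 'rV[R]_n -> W) : Prop :=
  forall k, Ck_on k U F.

(* chart_inv is a total function; only its values on the image of the domain
   are meaningful. *)
Record chart (R : realType) (n : nat) (M : topologicalType) := Chart {
  chart_dom : set M;
  chart_map : M -> 'rV[R]_n;
  chart_inv : 'rV[R]_n -> M;
  chart_dom_open : open chart_dom;
  chart_img_open : open (chart_map @` chart_dom);
  chart_mapK : forall p, chart_dom p -> chart_inv (chart_map p) = p;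
  chart_map_continuous :
    forall p, chart_dom p -> {for p, continuous chart_map};
  chart_inv_continuous :
    forall x, (chart_map @` chart_dom) x -> {for x, continuous chart_inv} }.

Record manifold (R : realType) (n : nat) := Manifold {
  mfd_space :> topologicalType;
  mfd_connected : connected [set: mfd_space];
  mfd_hausdorff : hausdorff_space mfd_space;
  mfd_second_countable : @second_countable mfd_space;
  atlas_index : Type;
  atlas : atlas_index -> chart R n mfd_space;
  atlas_cover : forall p : mfd_space, exists i, chart_dom (atlas i) p;
  atlas_smooth : forall i j,
    smooth_on (chart_map (atlas i) @` (chart_dom (atlas i) `&` chart_dom (atlas j)))
              (chart_map (atlas j) \o chart_inv (atlas i)) }.

Definition form (R : realType) (n : nat) (G : 'M[R]_n) (u v : 'rV[R]_n) : R :=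
  (u *m G *m v^T) 0 0.

(* gram i x is the Gram matrix of the metric at the point of coordinates x in
   the chart i, relative to the coordinate vectors of that chart. *)
Record riemannian (R : realType) (n : nat) := Riemannian {
  riem_mfd :> manifold R n;
  gram : atlas_index riem_mfd -> 'rV[R]_n -> 'M[R]_n;
  gram_smooth : forall i,
    smooth_on (chart_map (atlas i) @` chart_dom (atlas i)) (gram i);
  gram_sym : forall i p, chart_dom (atlas i) p ->
    (gram i (chart_map (atlas i) p))^T = gram i (chart_map (atlas i) p);
  gram_posdef : forall i p, chart_dom (atlas i) p ->
    forall u, u != 0 -> 0 < form (gram i (chart_map (atlas i) p)) u u;
  gram_compatible : forall i j p,
    chart_dom (atlas i) p -> chart_dom (atlas j) p ->
    forall u v,
      let tau := chart_map (atlas j) \o chart_inv (atlas i) in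
      let x := chart_map (atlas i) p in
      form (gram j (chart_map (atlas j) p)) ('D_u tau x) ('D_v tau x)
        = form (gram i x) u v }.

(* The vector a such that form G a w = l w for all w, when l is linear. *)
Definition sharp (R : realType) (n : nat) (G : 'M[R]_n)
    (l : 'rV[R]_n -> R) : 'rV[R]_n :=
  (\row_k l (delta_mx 0 k)) *m invmx G.

(* The Levi-Civita derivative of the constant field v along u, by the Koszul
   formula for constant (hence commuting) fields. *)
Definition christoffel (R : realType) (n : nat) (G : 'rV[R]_n -> 'M[R]_n)
    (x u v : 'rV[R]_n) : 'rV[R]_n :=
  sharp (G x) (fun w => 2^-1 *
    ('D_u (fun y => form (G y) v w) x + 'D_v (fun y => form (G y) u w) x
     - 'D_w (fun y => form (G y) u v) x)).

Definition nabla (R : realType) (n : nat) (G : 'rV[R]_n -> 'M[R]_n)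
    (X Y : 'rV[R]_n -> 'rV[R]_n) (x : 'rV[R]_n) : 'rV[R]_n :=
  'D_(X x) Y x + christoffel G x (X x) (Y x).

Definition lie_bracket (R : realType) (n : nat) (X Y : 'rV[R]_n -> 'rV[R]_n)
    (x : 'rV[R]_n) : 'rV[R]_n :=
  'D_(X x) Y x - 'D_(Y x) X x.

(* The curvature endomorphism at x, computed on constant extensions. *)
Definition curv (R : realType) (n : nat) (G : 'rV[R]_n -> 'M[R]_n)
    (x u v w : 'rV[R]_n) : 'rV[R]_n :=
  let X := fun=> u in let Y := fun=> v in let Z := fun=> w in
  nabla G X (nabla G Y Z) x - nabla G Y (nabla G X Z) x
    - nabla G (lie_bracket X Y) Z x.

Definition curv4 (R : realType) (n : nat) (G : 'rV[R]_n -> 'M[R]_n)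
    (x u v w z : 'rV[R]_n) : R :=
  form (G x) (curv G x u v w) z.

Definition ricci (R : realType) (n : nat) (G : 'rV[R]_n -> 'M[R]_n)
    (x u v : 'rV[R]_n) : R :=
  \tr (lin1_mx (fun z => curv G x z u v)).

Definition ricci_op (R : realType) (n : nat) (G : 'rV[R]_n -> 'M[R]_n)
    (x u : 'rV[R]_n) : 'rV[R]_n :=
  sharp (G x) (ricci G x u).

Definition scalar_curv (R : realType) (n : nat) (G : 'rV[R]_n -> 'M[R]_n)
    (x : 'rV[R]_n) : R :=
  \tr (lin1_mx (ricci_op G x)).

Definition wedge (R : realType) (n : nat) (A : 'rV[R]_n -> 'rV[R]_n -> R)
    (u v w : 'rV[R]_n) : 'rV[R]_n :=
  A v w *: u - A u w *: v.

Definition weyl (R : realType) (n : nat) (G : 'rV[R]_n -> 'M[R]_n)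
    (x u v w : 'rV[R]_n) : 'rV[R]_n :=
  curv G x u v w - (n%:R - 2)^-1 *:
    (wedge (form (G x)) u (ricci_op G x v) w
     + wedge (form (G x)) (ricci_op G x u) v w
     - (scalar_curv G x / (n%:R - 1)) *: wedge (form (G x)) u v w).

Definition weyl4 (R : realType) (n : nat) (G : 'rV[R]_n -> 'M[R]_n)
    (x u v w z : 'rV[R]_n) : R :=
  form (G x) (weyl G x u v w) z.

(* The (0,6)-tensor (X1,..,X4;X,Y) |-> (B(X,Y).T)(X1,..,X4), for a
   (0,4)-tensor T. *)
Definition act4 (R : realType) (V : lmodType R) (B : V -> V -> V -> V)
    (T : V -> V -> V -> V -> R) (X1 X2 X3 X4 X Y : V) : R :=
  - (T (B X Y X1) X2 X3 X4 + T X1 (B X Y X2) X3 X4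
     + T X1 X2 (B X Y X3) X4 + T X1 X2 X3 (B X Y X4)).

Definition lin_dep6 (R : realType) (V : lmodType R)
    (T1 T2 : V -> V -> V -> V -> V -> V -> R) : Prop :=
  exists a b : R, (a, b) != (0, 0) /\
    forall X1 X2 X3 X4 X Y,
      a * T1 X1 X2 X3 X4 X Y + b * T2 X1 X2 X3 X4 X Y = 0.

Definition orthonormal (R : realType) (n k : nat) (G : 'M[R]_n)
    (E : 'I_k -> 'rV[R]_n) : Prop :=
  forall i j, form G (E i) (E j) = (i == j)%:R.

(* G, Gt and F are the coordinate expressions of the metric of M, of the
   ambient metric and of the immersion.  This is the ambient derivative along F of the field dF(Y) in the direction X, minus
   dF of the Levi-Civita derivative of Y (the Gauss formula), for X and Y the
   constant extensions of u and v. *)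
Definition second_ff (R : realType) (n d : nat) (G : 'rV[R]_n -> 'M[R]_n)
    (Gt : 'rV[R]_d -> 'M[R]_d) (F : 'rV[R]_n -> 'rV[R]_d)
    (x u v : 'rV[R]_n) : 'rV[R]_d :=
  'D_u (fun y => 'D_v F y) x + christoffel Gt (F x) ('D_u F x) ('D_v F x)
  - 'D_(nabla G (fun=> u) (fun=> v) x) F x.

Definition shape_op (R : realType) (n d : nat) (G : 'rV[R]_n -> 'M[R]_n)
    (Gt : 'rV[R]_d -> 'M[R]_d) (F : 'rV[R]_n -> 'rV[R]_d)
    (x : 'rV[R]_n) (xi : 'rV[R]_d) (u : 'rV[R]_n) : 'rV[R]_n :=
  sharp (G x) (fun w => form (Gt (F x)) xi (second_ff G Gt F x u w)).

Definition tangent_frame (R : realType) (n : nat) (G : 'rV[R]_n -> 'M[R]_n)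
    (x : 'rV[R]_n) (E : 'I_n -> 'rV[R]_n) : Prop :=
  orthonormal (G x) E.

Definition normal_frame (R : realType) (n m : nat)
    (Gt : 'rV[R]_(n + m) -> 'M[R]_(n + m)) (F : 'rV[R]_n -> 'rV[R]_(n + m))
    (x : 'rV[R]_n) (xi : 'I_m -> 'rV[R]_(n + m)) : Prop :=
  orthonormal (Gt (F x)) xi /\
  forall a u, form (Gt (F x)) (xi a) ('D_u F x) = 0.

Definition mean_curv_vec (R : realType) (n d : nat) (G : 'rV[R]_n -> 'M[R]_n)
    (Gt : 'rV[R]_d -> 'M[R]_d) (F : 'rV[R]_n -> 'rV[R]_d)
    (x : 'rV[R]_n) (E : 'I_n -> 'rV[R]_n) : 'rV[R]_d :=
  n%:R^-1 *: \sum_(i < n) second_ff G Gt F x (E i) (E i).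

Definition mean_curv (R : realType) (n d : nat) (G : 'rV[R]_n -> 'M[R]_n)
    (Gt : 'rV[R]_d -> 'M[R]_d) (F : 'rV[R]_n -> 'rV[R]_d)
    (x : 'rV[R]_n) (E : 'I_n -> 'rV[R]_n) : R :=
  let H := mean_curv_vec G Gt F x E in Num.sqrt (form (Gt (F x)) H H).

Definition norm_scalar_curv (R : realType) (n : nat)
    (G : 'rV[R]_n -> 'M[R]_n) (x : 'rV[R]_n) (E : 'I_n -> 'rV[R]_n) : R :=
  2 / (n%:R * (n%:R - 1)) *
    \sum_(i < n) \sum_(j < n | (i < j)%N) curv4 G x (E i) (E j) (E j) (E i).

Definition normal_curv (R : realType) (n d : nat) (G : 'rV[R]_n -> 'M[R]_n)
    (Gt : 'rV[R]_d -> 'M[R]_d) (F : 'rV[R]_n -> 'rV[R]_d)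
    (x u v : 'rV[R]_n) (xi eta : 'rV[R]_d) : R :=
  let A := shape_op G Gt F x in
  form (G x) (A xi (A eta u) - A eta (A xi u)) v.

Definition norm_normal_curv (R : realType) (n d m : nat)
    (G : 'rV[R]_n -> 'M[R]_n) (Gt : 'rV[R]_d -> 'M[R]_d)
    (F : 'rV[R]_n -> 'rV[R]_d) (x : 'rV[R]_n)
    (E : 'I_n -> 'rV[R]_n) (xi : 'I_m -> 'rV[R]_d) : R :=
  2 / (n%:R * (n%:R - 1)) *
    Num.sqrt (\sum_(i < n) \sum_(j < n | (i < j)%N)
              \sum_(a < m) \sum_(b < m | (a < b)%N)
                normal_curv G Gt F x (E i) (E j) (xi a) (xi b) ^+ 2).

Definition constant_curvature (R : realType) (d : nat) (k : R)
    (N : riemannian R d) : Prop :=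
  forall (i : atlas_index N) (p : N), chart_dom (atlas i) p ->
    let G := gram i in
    let x := chart_map (atlas i) p in
    forall u v,
      form (G x) u u * form (G x) v v - form (G x) u v ^+ 2 != 0 ->
      curv4 G x u v v u
        / (form (G x) u u * form (G x) v v - form (G x) u v ^+ 2) = k.

Definition local_map (R : realType) (n d : nat) (M : manifold R n)
    (N : manifold R d) (f : M -> N) (i : atlas_index M) (j : atlas_index N) :
    'rV[R]_n -> 'rV[R]_d :=
  chart_map (atlas j) \o f \o chart_inv (atlas i).

(* A smooth map f for which the metric of M is the induced one; f is then
   automatically an immersion. *)
Definition isometric_immersion (R : realType) (n d : nat)
    (M : riemannian R n) (N : riemannian R d) (f : M -> N) : Prop :=
  [/\ continuous f,
      forall i j,
        smooth_on
          (chart_map (atlas i)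
             @` (chart_dom (atlas i) `&` f @^-1` chart_dom (atlas j)))
          (local_map f i j)
    & forall (i : atlas_index M) (j : atlas_index N) (p : M),
        chart_dom (atlas i) p -> chart_dom (atlas j) (f p) ->
        let x := chart_map (atlas i) p in
        let F := local_map f i j in
        forall u v,
          form (gram j (F x)) ('D_u F x) ('D_v F x) = form (gram i x) u v].

Definition wintgen_ideal (R : realType) (n m : nat) (k : R)
    (M : riemannian R n) (N : riemannian R (n + m)) (f : M -> N) : Prop :=
  forall (i : atlas_index M) (j : atlas_index N) (p : M),
    chart_dom (atlas i) p -> chart_dom (atlas j) (f p) ->
    let x := chart_map (atlas i) p in
    let F := local_map f i j in
    forall (E : 'I_n -> 'rV[R]_n) (xi : 'I_m -> 'rV[R]_(n + m)),
      tangent_frame (gram i) x E -> normal_frame (gram j) F x xi ->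
      norm_scalar_curv (gram i) x E
        = mean_curv (gram i) (gram j) F x E ^+ 2
          - norm_normal_curv (gram i) (gram j) F x E xi + k.

Definition totally_umbilical (R : realType) (n d : nat)
    (M : riemannian R n) (N : riemannian R d) (f : M -> N) : Prop :=
  forall (i : atlas_index M) (j : atlas_index N) (p : M),
    chart_dom (atlas i) p -> chart_dom (atlas j) (f p) ->
    let x := chart_map (atlas i) p in
    let F := local_map f i j in
    forall E : 'I_n -> 'rV[R]_n, tangent_frame (gram i) x E ->
    forall u v,
      second_ff (gram i) (gram j) F x u v
        = form (gram i x) u v *: mean_curv_vec (gram i) (gram j) F x E.

Definition RC_sub_CR_dep_QgR (R : realType) (n : nat) (M : riemannian R n) :
    Prop :=
  forall (i : atlas_index M) (p : M), chart_dom (atlas i) p ->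
    let G := gram i in
    let x := chart_map (atlas i) p in
    lin_dep6
      (fun X1 X2 X3 X4 X Y =>
         act4 (curv G x) (weyl4 G x) X1 X2 X3 X4 X Y
         - act4 (weyl G x) (curv4 G x) X1 X2 X3 X4 X Y)
      (act4 (wedge (form (G x))) (curv4 G x)).

(* Only meaningful in dimension at least 4; every manifold of dimension 3 has
   vanishing Weyl tensor. *)
Definition conformally_flat (R : realType) (n : nat) (M : riemannian R n) :
    Prop :=
  forall (i : atlas_index M) (p : M), chart_dom (atlas i) p ->
    forall u v w z, weyl4 (gram i) (chart_map (atlas i) p) u v w z = 0.

(* Main.v *)
From HB Require Import structures.
From mathcomp Require Import all_boot all_order all_algebra.
From mathcomp Require Import ring lra zify complex.
From mathcomp Require Import all_classical all_reals all_analysis.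
Require Import Defs.
Import Order.TTheory GRing.Theory Num.Theory numFieldNormedType.Exports.
Local Open Scope ring_scope.

(** The statement is pointwise. At a point let A_a be the shape operators for
    an orthonormal normal frame, lam_a = tr A_a / n and B_a = A_a - lam_a I. By
    the Gauss equation the Wintgen equality at the point says
      sum_(a, b) |[B_a, B_b]|^2 = (sum_a |B_a|^2)^2,
    that is, equality in the DDVV inequality, and equality forces all the B_a
    to live on one and the same tangent plane (ddvv_equality). The curvature
    tensor is then
      R = K g^g + g^T + c P^P,  K = k + H^2,  c = - 1/2 sum_a |B_a|^2,
    where P is the orthogonal projection onto that plane and T is a trace-free
    symmetric operator of the plane. The term g^T does not contribute to the
    Weyl tensor, which is therefore c times a fixed tensor (model_weyl).

    Assume now a linear dependence of R.C - C.R and Q(g, R), and evaluate it on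
    (e, Z, Z, W; e, W), where e runs through an orthonormal basis of the plane
    and Z, W are orthonormal vectors orthogonal to the plane: they exist since
    n >= 4. In the sum over e the trace of T disappears, and with it Q(g, R);
    what is left is 2 K c / (n - 2) times the coefficient of R.C - C.R
    (model_dependence). Since k > 0 implies K > 0, c = 0, so every B_a is zero
    and the point is umbilical. If the coefficient of R.C - C.R vanishes, then
    Q(g, R) = 0, which gives c = 0 as well. Conversely, at an umbilical point
    all the B_a are zero, so R is a multiple of g^g and C = 0.

    The equality case of the DDVV inequality is the algebraic core. Rotating
    the normal frame makes the B_a mutually orthogonal. For a family of unit
    vectors C_1, ..., C_p of that kind, diagonalising C_1 bounds
    sum_b |[C_1, C_b]|^2 by p: this is an estimate on the pairs of eigenvalues
    of C_1 that are more than 1 apart, which form a star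
    (large_gaps_form_star, commutator_sum_star). Decomposing the vector of the
    |B_a|^2 into layers turns these bounds, applied to all subfamilies, into
    the inequality (partial_sums_quadratic_ge0), and in the case of equality
    the bound for the family of all nonzero members is attained. Attained
    bounds determine the spectra, which are compatible only for a family of two
    members supported on one plane (commutator_sum_planar).

    The analytic part expresses the curvature by lowered Christoffel symbols
    (curv4_koszul), which behave well under pull-back (koszul_pullback);
    differentiating this relation once gives the Gauss equation
    (gauss_equation). It rests on the symmetry of second derivatives
    (schwarz). Constancy of the sectional curvature determines the ambient
    curvature tensor by polarisation (constant_curvature_tensor). *)

Set Implicit Arguments.
Unset Strict Implicit.
Unset Printing Implicit Defensive.

(** * Spectral theorem and orthonormal bases *)

Lemma sqmxE (R : realFieldType) n (v : 'rV[R]_n) :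
  (v *m v^T) 0 0 = \sum_i v 0 i ^+ 2.
Proof. by rewrite mxE; apply: eq_bigr => i _; rewrite mxE expr2. Qed.

Lemma sqmx_gt0 (R : realFieldType) n (v : 'rV[R]_n) :
  v != 0 -> 0 < (v *m v^T) 0 0.
Proof.
move=> v0; rewrite sqmxE lt_neqAle sumr_ge0 ?andbT => [|i _]; last exact: sqr_ge0.
apply: contraNneq v0 => /esym/eqP; rewrite psumr_eq0 => [/allP h|i _]; last exact: sqr_ge0.
apply/eqP/rowP => i; rewrite mxE; apply/eqP.
by have := h i (mem_index_enum i); rewrite /= sqrf_eq0.
Qed.

(** Over the complex extension a symmetric real matrix is Hermitian, so it has
    an eigenvalue and this eigenvalue is real; a real eigenvalue of a real
    matrix has a real eigenvector. *)
Lemma symmetric_real_eigenvector (R : rcfType) n (A : 'M[R]_n.+1) :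
  A^T = A -> exists a (v : 'rV_n.+1), v *m v^T = 1 /\ v *m A = a *: v.
Proof.
move=> As.
pose AC := map_mx (real_complex R) A.
have AH : AC \is hermsymmx.
  apply: realsym_hermsym; last first.
    by apply/mxOverP => i j; rewrite mxE; apply/complex_realP; exists (A i j).
  apply/is_hermitianmxP; rewrite expr0 scale1r.
  by apply/matrixP => i j; rewrite !mxE -[in LHS]As mxE.
have /(orthomx_spectralP) AE := hermitian_normalmx AH.
have /mxOverP/(_ 0 0)/complex_realP[a aE] := hermitian_spectral_diag_real AH.
have ev : eigenvalue AC (a%:C)%C.
  apply/eigenvalueP; exists (delta_mx 0 0 *m spectralmx AC); last first.
    apply/eqP => e0; have u := spectral_unit AC.
    have := congr1 (mulmx^~ (invmx (spectralmx AC))) e0.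
    rewrite mul0mx mulmxK // => /matrixP/(_ 0 0).
    by rewrite !mxE !eqxx => /eqP; rewrite oner_eq0.
  rewrite {2}AE !mulmxA mulmxK ?spectral_unit // scalemxAl; congr (_ *m _).
  apply/rowP => j; rewrite !mxE (bigD1 0) //= big1 ?addr0 => [|i /negPf i0]; last first.
    by rewrite !mxE i0 andbF mul0r.
  by rewrite !mxE !eqxx mul1r -aE /= [j == 0]eq_sym mulr_natr.
move: ev; rewrite eigenvalue_root_char -map_char_poly fmorph_root -eigenvalue_root_char.
move=> /eigenvalueP[v vA v0].
exists a, ((Num.sqrt ((v *m v^T) 0 0))^-1 *: v); split; last first.
  by rewrite -scalemxAl vA scalerA mulrC -scalerA.
have p := sqmx_gt0 v0.
rewrite linearZ /= -scalemxAl -scalemxAr scalerA.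
apply/matrixP => i j; rewrite !ord1 mxE -invfM -expr2 sqr_sqrtr ?ltW //.
by rewrite mulVf ?gt_eqF // mxE.
Qed.

(** The reflection in the hyperplane orthogonal to v - e_0 exchanges e_0 and v. *)
Lemma householder_row (R : realFieldType) n (v : 'rV[R]_n.+1) :
  v *m v^T = 1 -> exists (H : 'M[R]_n.+1), H *m H^T = 1%:M /\ row 0 H = v.
Proof.
move=> v1; pose e : 'rV[R]_n.+1 := delta_mx 0 0.
have [->|ve] := eqVneq v e.
  by exists 1%:M; rewrite trmx1 mulmx1 row1.
pose w := v - e; have w0 : w != 0 by rewrite subr_eq0.
have p := sqmx_gt0 w0; set q := (w *m w^T) 0 0 in p.
have wwE : w *m w^T = q%:M by rewrite [LHS]mx11_scalar.
have eeE : e *m e^T = 1.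
  by rewrite /e trmx_delta mul_delta_mx; apply/matrixP => i j; rewrite !ord1 !mxE.
have evE : (e *m v^T) 0 0 = v 0 0.
  by rewrite /e -rowE !mxE.
have ewE : e *m w^T = (v 0 0 - 1)%:M.
  by rewrite [LHS]mx11_scalar /w linearB mulmxBr eeE !mxE eqxx -evE mxE.
have veE : v *m e^T = (v 0 0)%:M.
  rewrite [LHS]mx11_scalar; congr (_%:M).
  have -> : v *m e^T = (e *m v^T)^T by rewrite trmx_mul trmxK.
  by rewrite mxE evE.
have qE : q = 2 - 2 * v 0 0.
  rewrite /q /w linearB mulmxBr !mulmxBl v1 eeE veE !mxE !eqxx /=.
  by move: evE; rewrite mxE mulr1n => ->; ring.
pose H : 'M[R]_n.+1 := 1%:M - (2 / q) *: (w^T *m w).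
have HT : H^T = H.
  by rewrite /H linearB /= linearZ /= trmx_mul trmxK trmx1.
exists H; split.
  rewrite HT /H mulmxBr !mulmxBl !mulmx1 mul1mx -!scalemxAl -!scalemxAr.
  rewrite -mulmxA [w *m _]mulmxA wwE mul_scalar_mx -!scalemxAr !scalerA.
  apply/matrixP => i j; rewrite !mxE; set s := \sum_k _.
  by field; rewrite gt_eqF.
rewrite rowE -/e /H mulmxBr mulmx1 -scalemxAr mulmxA ewE mul_scalar_mx scalerA.
have -> : 2 / q * (v 0 0 - 1) = -1.
  by move: p; rewrite qE => p; field; rewrite gt_eqF.
by rewrite scaleN1r opprK /w addrC subrK.
Qed.

(** Induction on the size: a reflection moves a unit eigenvector to the first
    axis, and by symmetry a block of size 1 splits off. *)
Theorem symmetric_diagonalizable (R : rcfType) n (A : 'M[R]_n) : A^T = A ->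
  exists (P : 'M[R]_n) (d : 'rV_n), P *m P^T = 1%:M /\ P *m A *m P^T = diag_mx d.
Proof.
elim: n A => [|n IHn] A As.
  by exists 1%:M, 0; split; apply/matrixP => -[].
have [a [v [v1 va]]] := symmetric_real_eigenvector As.
case: (householder_row v1) => H [HH Hv].
have [B BE] : exists (B : 'M[R]_(1 + n)), B = H *m A *m H^T by eexists.
have Bs : B^T = B by rewrite BE !trmx_mul trmxK As mulmxA.
have Brow j : B 0 j = a *+ (0 == j).
  have -> : B 0 j = (row 0 B) 0 j by rewrite [RHS]mxE.
  rewrite BE !row_mul Hv va -scalemxAl -Hv -row_mul HH row1 !mxE eqxx /=.
  by rewrite eq_sym mulr_natr.
have [|P [d [PP Pd]]] := IHn (drsubmx B).
  by rewrite -[in RHS]Bs; apply/matrixP => i j; rewrite !mxE.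
pose P1 : 'M[R]_(1 + n) := block_mx 1%:M 0 0 P.
have P1P1 : P1 *m P1^T = 1%:M.
  rewrite /P1 tr_block_mx mulmx_block !trmx0 !trmx1 !mulmx0 !mul0mx !addr0 !add0r.
  by rewrite mulmx1 PP -scalar_mx_block.
have l0 (i : 'I_1) : lshift n i = 0 :> 'I_n.+1 by rewrite ord1; exact: val_inj.
have {}BE : H *m A *m H^T = block_mx (a%:M : 'M[R]_1) 0 0 (drsubmx B).
  rewrite -BE -[LHS](@submxK R 1 n 1 n); congr (@block_mx R 1 n 1 n _ _ _ _);
    apply/matrixP => i j; rewrite !mxE.
  - by rewrite !l0 Brow !ord1 !eqxx.
  - by rewrite !l0 Brow; case: eqP => // /(congr1 val).
  - by rewrite -[B]Bs mxE !l0 Brow; case: eqP => // /(congr1 val).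
have P1B : P1 *m block_mx (a%:M : 'M[R]_1) 0 0 (drsubmx B) *m P1^T
    = diag_mx (row_mx a%:M d).
  rewrite /P1 tr_block_mx !mulmx_block !trmx0 !trmx1.
  rewrite !(mulmx0, mul0mx, addr0, add0r, mulmx1, mul1mx) Pd diag_mx_row.
  by congr block_mx; apply/matrixP => i j; rewrite !ord1 !mxE.
exists (P1 *m H), (row_mx a%:M d); split.
  by rewrite trmx_mul mulmxA -[P1 *m H *m _]mulmxA HH mulmx1 P1P1.
rewrite trmx_mul !mulmxA -[P1 *m H *m A]mulmxA -[P1 *m (H *m A) *m _]mulmxA BE.
exact: P1B.
Qed.

(** The eigenvectors of G, divided by the square roots of the eigenvalues. *)
Lemma posdef_orthonormal_basis (R : rcfType) n (G : 'M[R]_n) : G^T = G ->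
  (forall u : 'rV_n, u != 0 -> 0 < (u *m G *m u^T) 0 0) ->
  exists (E : 'M[R]_n), E *m G *m E^T = 1%:M.
Proof.
move=> Gs Gp; have [P [d [PP Pd]]] := symmetric_diagonalizable Gs.
have d0 i : 0 < d 0 i.
  have -> : d 0 i = (row i P *m G *m (row i P)^T) 0 0.
    transitivity ((P *m G *m P^T) i i); first by rewrite Pd !mxE eqxx.
    rewrite -row_mul tr_row mxE [RHS]mxE; apply: eq_bigr => k _.
    by rewrite [row _ _ _ _]mxE [col _ _ _ _]mxE.
  apply: Gp; apply: contra_eq_neq PP => Pi0.
  apply/eqP => /matrixP/(_ i i)/eqP; rewrite !mxE eqxx big1 1?eq_sym ?oner_eq0 // => k _.
  by move/rowP: Pi0 => /(_ k); rewrite !mxE => ->; rewrite mul0r.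
pose D : 'rV_n := \row_i (Num.sqrt (d 0 i))^-1.
exists (diag_mx D *m P).
transitivity (diag_mx D *m (P *m G *m P^T) *m diag_mx D).
  by rewrite trmx_mul tr_diag_mx !mulmxA.
rewrite Pd.
apply/matrixP => i j; rewrite -mulmxA mul_diag_mx mul_mx_diag !mxE.
have [<-|_] := eqVneq i j; last by rewrite !mulr0n mul0r mulr0.
rewrite !mulr1n; have := sqr_sqrtr (ltW (d0 i)); rewrite expr2 => {2}<-.
by field; rewrite sqrtr_eq0 -ltNge.
Qed.

(** The n linear conditions X G J^T = 0 leave a space of dimension at least m;
    m independent solutions are orthonormalised by posdef_orthonormal_basis
    applied to their Gram matrix. *)
Lemma orthonormal_complement (R : rcfType) n m (G : 'M[R]_(n + m))
    (J : 'M[R]_(n, n + m)) : G^T = G ->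
  (forall u : 'rV_(n + m), u != 0 -> 0 < (u *m G *m u^T) 0 0) ->
  exists (X : 'M[R]_(m, n + m)), X *m G *m X^T = 1%:M /\ X *m G *m J^T = 0.
Proof.
move=> Gs Gp; pose K := kermx (G *m J^T).
have rK : (m <= \rank K)%N.
  by rewrite mxrank_ker leq_subRL ?rank_leq_row // leq_add2r rank_leq_col.
have [X0 [X0f X0K]] :
    exists (X0 : 'M[R]_(m, n + m)), row_free X0 /\ X0 *m (G *m J^T) = 0.
  exists ((pid_mx m : 'M[R]_(m, \rank K)) *m row_base K); split.
    by rewrite /row_free mxrankMfree ?row_base_free // rank_pid_mx.
  apply/sub_kermxP; rewrite (submx_trans (submxMl _ _)) //.
  by rewrite eq_row_base.
have [||E EE] := @posdef_orthonormal_basis R m (X0 *m G *m X0^T).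
- by rewrite !trmx_mul trmxK Gs mulmxA.
- move=> u u0; have := Gp (u *m X0); rewrite mulmx_free_eq0 // => /(_ u0).
  by rewrite trmx_mul !mulmxA.
exists (E *m X0); split; first by rewrite trmx_mul !mulmxA -EE !mulmxA.
by rewrite -!mulmxA X0K mulmx0.
Qed.

(** * Large gaps in a unit vector *)

(** Join i and j by an edge when eta i and eta j are more than 1 apart. Two
    disjoint edges would force the sum of squares above 1, and so would a
    triangle; a graph without either of them is a star. *)
Lemma large_gaps_form_star (R : realFieldType) n (eta : 'I_n -> R) (i0 : 'I_n) :
  \sum_i eta i ^+ 2 <= 1 ->
  exists a, forall i j, 1 < (eta i - eta j) ^+ 2 -> (i == a) || (j == a).
Proof.
move=> eta1.
have sub (s : seq 'I_n) : uniq s -> \sum_(i <- s) eta i ^+ 2 <= 1.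
  move=> us; apply: le_trans eta1; rewrite big_uniq //= [leRHS](bigID (mem s)) /=.
  by rewrite lerDl sumr_ge0 // => i _; exact: sqr_ge0.
have disj i j k l : 1 < (eta i - eta j) ^+ 2 -> 1 < (eta k - eta l) ^+ 2 ->
    uniq [:: i; j; k; l] -> False.
  move=> ij kl /sub; rewrite !big_cons big_nil.
  have := sqr_ge0 (eta i + eta j); have := sqr_ge0 (eta k + eta l).
  by move: ij kl; rewrite !expr2; lra.
have triangle i j k : 1 < (eta i - eta j) ^+ 2 -> 1 < (eta j - eta k) ^+ 2 ->
    1 < (eta i - eta k) ^+ 2 -> uniq [:: i; j; k] -> False.
  move=> ij jk ik /sub; rewrite !big_cons big_nil.
  have := sqr_ge0 (eta i + eta j + eta k).
  by move: ij jk ik; rewrite !expr2; lra.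
have irr i j : 1 < (eta i - eta j) ^+ 2 -> i != j.
  by apply: contraTneq => ->; rewrite subrr expr0n ltr10.
have sym i j : 1 < (eta i - eta j) ^+ 2 -> 1 < (eta j - eta i) ^+ 2.
  by rewrite -(opprB (eta i)) sqrrN.
have [/existsP[p /existsP[q pq]]|] :=
    boolP [exists p, exists q, 1 < (eta p - eta q) ^+ 2]; last first.
  move=> /existsPn h; exists i0 => i j ij.
  by have /existsPn/(_ j) := h i; rewrite ij.
have meet i j : 1 < (eta i - eta j) ^+ 2 ->
    [|| i == p, i == q, j == p | j == q].
  move=> ij; apply/negPn/negP; rewrite !negb_or => /and4P[ip iq jp jq].
  apply: (disj _ _ _ _ pq ij); rewrite /= !inE !negb_or (irr _ _ pq) (irr _ _ ij).
  by rewrite ![p == _]eq_sym ![q == _]eq_sym ip iq jp jq.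
have [/existsP[i /existsP[j /and3P[ij ip jp]]]|] :=
    boolP [exists i, exists j, [&& 1 < (eta i - eta j) ^+ 2, i != p & j != p]];
    last first.
  move=> /existsPn h; exists p => i j ij.
  by have /existsPn/(_ j) := h i; rewrite ij /= -negb_or negbK.
have [j' [qj' j'p]] : exists j', 1 < (eta q - eta j') ^+ 2 /\ j' != p.
  have := meet _ _ ij; rewrite (negPf ip) (negPf jp) /=.
  by case/orP=> /eqP iq; [exists j; rewrite -iq | exists i; rewrite -iq; split=> //; exact: sym].
exists q => k l kl; apply/negPn/negP; rewrite negb_or => /andP[kq lq].
have [l' [pl' l'q]] : exists l', 1 < (eta p - eta l') ^+ 2 /\ l' != q.
  have := meet _ _ kl; rewrite (negPf kq) (negPf lq) /= orbF.
  by case/orP=> /eqP ip'; [exists l; rewrite -ip' | exists k; rewrite -ip'; split=> //; exact: sym].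
have [e|ne] := eqVneq l' j'.
  apply: (triangle p q j') => //; first by rewrite -e.
  by rewrite /= !inE !negb_or (irr _ _ pq) (irr _ _ qj') eq_sym j'p.
apply: (disj _ _ _ _ qj' pl'); rewrite /= !inE !negb_or (irr _ _ qj') (irr _ _ pl').
by rewrite [q == p]eq_sym (irr _ _ pq) [q == l']eq_sym l'q j'p [j' == _]eq_sym ne.
Qed.

(** The Laplacian of a star with p edges has largest eigenvalue p + 1, whence a
    nonnegative right-hand side; its form as a sum of squares gives the case
    of equality. *)
Lemma star_gap_identity (R : realFieldType) n (eta : 'I_n -> R) a (J : {set 'I_n}) :
  a \notin J -> \sum_i eta i ^+ 2 = 1 ->
  1 - \sum_(j in J) ((eta a - eta j) ^+ 2 - 1)
    = (#|J|%:R + 1) * (\sum_(i | (i \notin J) && (i != a)) eta i ^+ 2)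
      + (eta a + \sum_(j in J) eta j) ^+ 2
      + 2^-1 * \sum_(j in J) \sum_(k in J) (eta j - eta k) ^+ 2.
Proof.
move=> aJ eta1.
have -> : \sum_(i | (i \notin J) && (i != a)) eta i ^+ 2
    = 1 - eta a ^+ 2 - \sum_(j in J) eta j ^+ 2.
  by rewrite -eta1 [in RHS](bigID (mem J)) /= [X in _ + X - _ - _](bigD1 a) //=; ring.
set S := \sum_(j in J) eta j; set S2 := \sum_(j in J) eta j ^+ 2.
have -> : \sum_(j in J) ((eta a - eta j) ^+ 2 - 1)
    = #|J|%:R * (eta a ^+ 2 - 1) - 2 * eta a * S + S2.
  have [c cE] : exists c, c = eta a ^+ 2 - 1 by eexists.
  rewrite (eq_bigr (fun j => c - 2 * eta a * eta j + eta j ^+ 2)); last first.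
    by move=> j _; rewrite cE; ring.
  by rewrite !big_split /= sumr_const -(mulr_natl _ #|J|) sumrN -mulr_sumr -/S -/S2 cE.
have -> : \sum_(j in J) \sum_(k in J) (eta j - eta k) ^+ 2
    = 2 * (#|J|%:R * S2) - 2 * S ^+ 2.
  rewrite (eq_bigr (fun j => #|J|%:R * eta j ^+ 2 - 2 * S * eta j + S2)).
    rewrite !big_split /= sumr_const -(mulr_natl _ #|J|) sumrN -!mulr_sumr -/S -/S2.
    by rewrite mulr2n; ring.
  move=> j _; rewrite (eq_bigr (fun k => eta j ^+ 2 - 2 * eta j * eta k + eta k ^+ 2)).
    rewrite !big_split /= sumr_const -(mulr_natl _ #|J|) sumrN -mulr_sumr -/S -/S2; ring.
  by move=> k _; ring.
by field.
Qed.

Section GapWeights.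
Variables (R : realFieldType) (n : nat) (eta : 'I_n -> R) (r : 'I_n -> 'I_n -> R).
Hypothesis eta1 : \sum_i eta i ^+ 2 = 1.
Hypothesis r_ge0 : forall i j, 0 <= r i j.
Hypothesis r_le : forall i j, i != j -> r i j <= 2^-1.

Let w i j := (eta i - eta j) ^+ 2 - 1.

Let wC i j : w i j = w j i.
Proof. by rewrite /w -(opprB (eta i)) sqrrN. Qed.

Variable a : 'I_n.
Hypothesis star : forall i j, 1 < (eta i - eta j) ^+ 2 -> (i == a) || (j == a).

Let J : {set 'I_n} := [set j | 1 < (eta a - eta j) ^+ 2].

Let aJ : a \notin J.
Proof. by rewrite inE subrr expr0n ltr10. Qed.

Let bound i j :=
  (if (i == a) && (j \in J) then w a j / 2 else 0)
  + (if (j == a) && (i \in J) then w a i / 2 else 0).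

Let wJ j : j \in J -> 0 < w a j.
Proof. by rewrite inE /w subr_gt0. Qed.

Let w_le_bound i j : w i j * r i j <= bound i j.
Proof.
rewrite /bound; have [wp|wn] := ltP 0 (w i j); last first.
  apply: (@le_trans _ _ 0); first by rewrite mulr_le0_ge0.
  by apply: addr_ge0; case: ifP => // /andP[_ /wJ/ltW] h; rewrite divr_ge0.
have ij : i != j by apply: contraTneq wp => ->; rewrite /w subrr expr0n -leNgt /= sub0r lerN10.
have wr : w i j * r i j <= w i j / 2 by rewrite ler_wpM2l ?r_le // ltW.
have := wp; rewrite {1}/w subr_gt0 => /[dup] big /star/orP[]/eqP e; subst.
  have jJ : j \in J by rewrite inE.
  by rewrite eqxx jJ /= (negPf aJ) andbF addr0.
have iJ : i \in J by rewrite inE -(opprB (eta i)) sqrrN.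
by rewrite eqxx iJ /= (negPf aJ) andbF add0r wC in wr *.
Qed.

Let sum_bound : \sum_i \sum_j bound i j = \sum_(j in J) w a j.
Proof.
under eq_bigr do rewrite big_split /=; rewrite big_split /=.
rewrite [X in X + _](bigD1 a) //= [X in _ + X + _]big1 ?addr0; last first.
  by move=> i /negPf ia; rewrite big1 // => j _; rewrite ia.
rewrite [X in _ + X]exchange_big /= [X in _ + X](bigD1 a) //=.
rewrite [X in _ + (_ + X)]big1 ?addr0; last first.
  by move=> i /negPf ia; rewrite big1 // => j _; rewrite ia.
rewrite eqxx /= -!big_mkcond /= -big_split /=; apply: eq_bigr => j _.
by field.
Qed.

Let sum_star : \sum_(j in J) w a j <= 1.
Proof.
rewrite -subr_ge0 /w star_gap_identity //.
apply: addr_ge0; first (apply: addr_ge0; last exact: sqr_ge0).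
  by rewrite mulr_ge0 ?addr_ge0 ?ler0n // sumr_ge0 // => i _; exact: sqr_ge0.
rewrite mulr_ge0 ?invr_ge0 ?ler0n // sumr_ge0 // => i _.
by apply: sumr_ge0 => j _; exact: sqr_ge0.
Qed.

(** Only the edges of the star have a positive coefficient. Each of them occurs
    in two orders with a weight of at most 1/2, which leaves the sum of
    star_gap_identity. *)
Lemma star_gap_weight_le : \sum_i \sum_j ((eta i - eta j) ^+ 2 - 1) * r i j <= 1.
Proof.
apply: le_trans sum_star; rewrite -sum_bound.
by apply: ler_sum => i _; apply: ler_sum => j _; exact: w_le_bound.
Qed.

(** In the case of equality all the squares in star_gap_identity vanish: eta is
    -pc at the centre, c at the p ends and 0 elsewhere. All gaps outside of the
    star are then smaller than 1, so that weight placed there would be a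
    loss. *)
Lemma star_gap_weight_eq :
    \sum_i \sum_j ((eta i - eta j) ^+ 2 - 1) * r i j = 1 ->
  exists (K : {set 'I_n}) (c : R),
    [/\ a \notin K, c ^+ 2 * (#|K|%:R * (#|K|%:R + 1)) = 1,
        eta a = - (#|K|%:R * c), (forall j, j \in K -> eta j = c) &
        (forall j, j != a -> j \notin K -> eta j = 0) ] /\
    (forall i j, r i j != 0 -> (i == a) && (j \in K) || (j == a) && (i \in K)).
Proof.
move=> tot; have sJ1 : \sum_(j in J) w a j = 1.
  apply/eqP; rewrite eq_le sum_star /= -tot -sum_bound.
  by apply: ler_sum => i _; apply: ler_sum => j _; exact: w_le_bound.
have eq_bound i j : w i j * r i j = bound i j.
  have : \sum_i \sum_j (bound i j - w i j * r i j) = 0.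
    under eq_bigr do rewrite sumrB; rewrite sumrB sum_bound sJ1.
    by move: tot => ->; rewrite subrr.
  move/eqP; rewrite psumr_eq0 => [/allP/(_ i (mem_index_enum i))/=|k _]; last first.
    by apply: sumr_ge0 => l _; rewrite subr_ge0 w_le_bound.
  rewrite psumr_eq0 => [/allP/(_ j (mem_index_enum j))/=|k _].
    by rewrite subr_eq0 => /eqP ->.
  by rewrite subr_ge0 w_le_bound.
have := star_gap_identity aJ eta1; rewrite [X in 1 - X]sJ1 subrr => /esym/eqP.
have out_ge0 : 0 <= \sum_(i | (i \notin J) && (i != a)) eta i ^+ 2.
  by apply: sumr_ge0 => i _; exact: sqr_ge0.
have pair_ge0 : 0 <= \sum_(j in J) \sum_(k in J) (eta j - eta k) ^+ 2.
  by apply: sumr_ge0 => i _; apply: sumr_ge0 => j _; exact: sqr_ge0.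
have card_gt0 : 0 < #|J|%:R + 1 :> R by rewrite ltr_wpDl ?ler0n.
have half_ge0 : 0 <= 2^-1 :> R by rewrite invr_ge0 ler0n.
have t1 := mulr_ge0 (ltW card_gt0) out_ge0.
rewrite (paddr_eq0 (addr_ge0 t1 (sqr_ge0 _)) (mulr_ge0 half_ge0 pair_ge0)).
rewrite (paddr_eq0 t1 (sqr_ge0 _)).
rewrite sqrf_eq0 !mulf_eq0 (gt_eqF card_gt0) invr_eq0 pnatr_eq0 /=.
move=> /andP[/andP[/eqP out0 /eqP etaa] /eqP pair0].
have out i : i != a -> i \notin J -> eta i = 0.
  move=> ia iJ; move/eqP: out0; rewrite psumr_eq0 => [/allP/(_ i (mem_index_enum i))|k _].
    by rewrite /= iJ ia sqrf_eq0 => /eqP.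
  exact: sqr_ge0.
have eqJ i j : i \in J -> j \in J -> eta i = eta j.
  move=> iJ jJ; move/eqP: pair0; rewrite psumr_eq0 => [/allP/(_ i (mem_index_enum i))|k _].
    rewrite /= iJ /= psumr_eq0 => [/allP/(_ j (mem_index_enum j))|k _]; last exact: sqr_ge0.
    by rewrite /= jJ /= sqrf_eq0 subr_eq0 => /eqP.
  by apply: sumr_ge0 => l _; exact: sqr_ge0.
have [j0 j0J] : exists j, j \in J.
  apply/set0Pn; apply: contra_eq_neq sJ1 => J0.
  by rewrite J0 big_set0 eq_sym oner_eq0.
have sumJ : \sum_(j in J) eta j = #|J|%:R * eta j0.
  by rewrite (eq_bigr (fun=> eta j0)) ?sumr_const ?mulr_natl // => j jJ; exact: eqJ.
have etaaE : eta a = - (#|J|%:R * eta j0).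
  by move: etaa; rewrite sumJ => /eqP; rewrite addr_eq0 => /eqP.
have norm : eta j0 ^+ 2 * (#|J|%:R * (#|J|%:R + 1)) = 1.
  rewrite -[RHS]eta1 (bigID (mem J)) /= [X in _ = _ + X](bigD1 a) //= out0 addr0.
  rewrite [X in _ = X + _](eq_bigr (fun=> eta j0 ^+ 2)); last first.
    by move=> j jJ; rewrite (eqJ _ _ jJ j0J).
  by rewrite sumr_const -mulr_natl etaaE; ring.
have p1 : 1 <= #|J|%:R :> R by rewrite ler1n; apply/card_gt0P; exists j0.
exists J, (eta j0); split; first by split=> // j jJ; exact: eqJ.
move=> i j; apply: contraNT; rewrite negb_or => /andP[n1 n2].
have := eq_bound i j; rewrite /bound (negPf n1) (negPf n2) addr0 => /eqP.
rewrite mulf_eq0 => /orP[|//]; rewrite subr_eq0 => /eqP w0; exfalso.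
have val k : [\/ k = a, k \in J | k != a /\ k \notin J].
  have [->|ka] := eqVneq k a; first by constructor.
  by have [kJ|kJ] := boolP (k \in J); [constructor 2|constructor 3].
have c2 : 0 <= eta j0 ^+ 2 by exact: sqr_ge0.
(* outside of the star the gap is 0, c or pc, and c^2 p (p + 1) = 1 *)
move: w0 n1 n2; case: (val i) => [->|iJ|[ia iJ]]; case: (val j) => [->|jJ|[ja jJ]].
- by rewrite subrr expr0n => /eqP; rewrite eq_sym oner_eq0.
- by rewrite eqxx jJ.
- rewrite (out _ ja jJ) subr0 etaaE sqrrN exprMn => w0 _ _; nra.
- by rewrite eqxx iJ.
- by rewrite (eqJ _ _ iJ jJ) subrr expr0n => /eqP; rewrite eq_sym oner_eq0.
- rewrite (out _ ja jJ) (eqJ _ _ iJ j0J) subr0 => w0 _ _; nra.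
- rewrite (out _ ia iJ) sub0r etaaE opprK exprMn => w0 _ _; nra.
- rewrite (out _ ia iJ) (eqJ _ _ jJ j0J) sub0r sqrrN => w0 _ _; nra.
- by rewrite (out _ ia iJ) (out _ ja jJ) subrr expr0n => /eqP; rewrite eq_sym oner_eq0.
Qed.

End GapWeights.

(** * Commutators of orthonormal families of symmetric matrices *)

Definition frob (R : realFieldType) n (A B : 'M[R]_n) : R := \tr (A *m B^T).

Definition commmx (R : realFieldType) n (A B : 'M[R]_n) : 'M[R]_n :=
  A *m B - B *m A.

Lemma frobE (R : realFieldType) n (A B : 'M[R]_n) :
  frob A B = \sum_i \sum_j A i j * B i j.
Proof.
apply: eq_bigr => i _; rewrite mxE; apply: eq_bigr => j _.
by rewrite [B^T _ _]mxE.
Qed.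

Lemma frobC (R : realFieldType) n (A B : 'M[R]_n) : frob A B = frob B A.
Proof. by rewrite /frob -mxtrace_tr trmx_mul trmxK. Qed.

Lemma frobBl (R : realFieldType) n (A B C : 'M[R]_n) :
  frob (A - B) C = frob A C - frob B C.
Proof. by rewrite /frob mulmxBl linearB. Qed.

Lemma frobZl (R : realFieldType) n a (A C : 'M[R]_n) :
  frob (a *: A) C = a * frob A C.
Proof. by rewrite /frob -scalemxAl linearZ. Qed.

Lemma frobZr (R : realFieldType) n a (A C : 'M[R]_n) :
  frob A (a *: C) = a * frob A C.
Proof. by rewrite frobC frobZl frobC. Qed.

Lemma frob_suml (R : realFieldType) n I (s : seq I) (P : pred I)
    (A : I -> 'M[R]_n) C :
  frob (\sum_(i <- s | P i) A i) C = \sum_(i <- s | P i) frob (A i) C.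
Proof. by rewrite /frob mulmx_suml linear_sum. Qed.

Lemma frobDl (R : realFieldType) n (A B C : 'M[R]_n) :
  frob (A + B) C = frob A C + frob B C.
Proof. by rewrite /frob mulmxDl linearD. Qed.

Lemma frob_delta (R : realFieldType) n (A : 'M[R]_n) i j :
  frob (delta_mx i j) A = A i j.
Proof.
rewrite frobE (bigD1 i) //= [X in _ + X]big1 ?addr0 => [|k ki]; last first.
  by apply: big1 => l _; rewrite mxE (negPf ki) mul0r.
rewrite (bigD1 j) //= big1 ?addr0 => [|l lj].
  by rewrite mxE !eqxx mul1r.
by rewrite mxE (negPf lj) andbF mul0r.
Qed.

Lemma frob_ge0 (R : realFieldType) n (A : 'M[R]_n) : 0 <= frob A A.
Proof.
rewrite frobE; apply: sumr_ge0 => i _; apply: sumr_ge0 => j _.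
by rewrite -expr2 sqr_ge0.
Qed.

Lemma frob_eq0 (R : realFieldType) n (A : 'M[R]_n) : frob A A = 0 -> A = 0.
Proof.
move/eqP; rewrite frobE psumr_eq0 => [/allP h|i _]; last first.
  by apply: sumr_ge0 => j _; rewrite -expr2 sqr_ge0.
apply/matrixP => i j; rewrite mxE; have := h i (mem_index_enum i).
rewrite /= psumr_eq0 => [/allP/(_ j (mem_index_enum j))/=|k _].
  by rewrite mulf_eq0 orbb => /eqP.
by rewrite -expr2 sqr_ge0.
Qed.

Lemma frob_conj (R : realFieldType) n (Q A B : 'M[R]_n) : Q *m Q^T = 1%:M ->
  frob (Q *m A *m Q^T) (Q *m B *m Q^T) = frob A B.
Proof.
move=> QQ; have QtQ : Q^T *m Q = 1%:M by rewrite (mulmx1C QQ).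
rewrite /frob !trmx_mul trmxK !mulmxA -[_ *m Q^T *m Q]mulmxA QtQ mulmx1.
by rewrite -mxtrace_mulC !mulmxA QtQ mul1mx.
Qed.

Lemma commmx_conj (R : realFieldType) n (Q A B : 'M[R]_n) : Q *m Q^T = 1%:M ->
  commmx (Q *m A *m Q^T) (Q *m B *m Q^T) = Q *m commmx A B *m Q^T.
Proof.
move=> QQ; have QtQ : Q^T *m Q = 1%:M by rewrite (mulmx1C QQ).
rewrite /commmx mulmxBr mulmxBl; congr (_ - _).
  by rewrite !mulmxA -[_ *m Q^T *m Q]mulmxA QtQ mulmx1.
by rewrite !mulmxA -[_ *m Q^T *m Q]mulmxA QtQ mulmx1.
Qed.

Lemma bessel (R : realFieldType) n (I : finType) (S : {set I})
    (X : I -> 'M[R]_n) (E : 'M[R]_n) :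
  {in S &, forall b c, frob (X b) (X c) = (b == c)%:R} ->
  \sum_(b in S) frob (X b) E ^+ 2 <= frob E E.
Proof.
move=> orth; pose P := \sum_(b in S) frob (X b) E *: X b.
have PE : frob P E = \sum_(b in S) frob (X b) E ^+ 2.
  by rewrite frob_suml; apply: eq_bigr => b _; rewrite frobZl expr2.
have PP : frob P P = \sum_(b in S) frob (X b) E ^+ 2.
  rewrite {1}/P frob_suml; apply: eq_bigr => b bS.
  rewrite frobZl [frob (X b) P]frobC /P frob_suml (bigD1 b) //= big1 => [|c /andP[cS cb]].
    by rewrite frobZl orth // eqxx mulr1 addr0 expr2.
  by rewrite frobZl orth // (negPf cb) mulr0.
have := frob_ge0 (E - P).
rewrite frobBl [frob E _]frobC [frob P _]frobC !frobBl [frob E P]frobC PE PP.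
by lra.
Qed.

Lemma frob_commmx_diag (R : realFieldType) n (d : 'rV[R]_n) (X : 'M[R]_n) :
  frob (commmx (diag_mx d) X) (commmx (diag_mx d) X)
  = \sum_i \sum_j (d 0 i - d 0 j) ^+ 2 * X i j ^+ 2.
Proof.
rewrite frobE; apply: eq_bigr => i _; apply: eq_bigr => j _.
by rewrite /commmx mul_diag_mx mul_mx_diag !mxE; ring.
Qed.

Section OrthonormalFamily.
Variables (R : rcfType) (n m : nat) (C : 'I_m -> 'M[R]_n) (U : {set 'I_m}).
Hypothesis C_sym : forall b, (C b)^T = C b.
Hypothesis C_orth : {in U &, forall b c, frob (C b) (C c) = (b == c)%:R}.

(** In an eigenbasis of C b0 the commutator with X has squared norm
    sum_ij (d_i - d_j)^2 X_ij^2. Hence the weights r_ij = sum_b X_b,ij^2 over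
    b <> b0 enter. Their total is #|U| - 1, the members being unit vectors, and
    r_ij <= 1/2 off the diagonal, by the Bessel inequality for e_ij + e_ji: the
    estimate on gaps applies. *)
Lemma commutator_sum_star (b0 : 'I_m) : b0 \in U ->
  \sum_(b in U) frob (commmx (C b0) (C b)) (commmx (C b0) (C b)) <= #|U|%:R /\
  (\sum_(b in U) frob (commmx (C b0) (C b)) (commmx (C b0) (C b)) = #|U|%:R ->
   exists (Q : 'M[R]_n) (d : 'rV[R]_n) (a : 'I_n) (K : {set 'I_n}) (c : R),
   [/\ Q *m Q^T = 1%:M, Q *m C b0 *m Q^T = diag_mx d, a \notin K &
       #|U| = #|K|.+1] /\
   [/\ c ^+ 2 * (#|K|%:R * (#|K|%:R + 1)) = 1,
        d 0 a = - (#|K|%:R * c), (forall j, j \in K -> d 0 j = c) &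
        (forall j, j != a -> j \notin K -> d 0 j = 0) ] /\
   (forall b, b \in U -> b != b0 -> forall i j, (Q *m C b *m Q^T) i j != 0 ->
      (i == a) && (j \in K) || (j == a) && (i \in K))).
Proof.
move=> b0U; have [Q [d [QQ Qd]]] := symmetric_diagonalizable (C_sym b0).
pose X b := Q *m C b *m Q^T.
have Xs b : (X b)^T = X b by rewrite /X !trmx_mul trmxK C_sym mulmxA.
have X_orth : {in U &, forall b c, frob (X b) (X c) = (b == c)%:R}.
  by move=> b c bU cU; rewrite frob_conj // C_orth.
pose eta i := d 0 i; pose S := U :\ b0.
pose r i j := \sum_(b in S) X b i j ^+ 2.
have eta1 : \sum_i eta i ^+ 2 = 1.
  transitivity (frob (X b0) (X b0)); last by rewrite X_orth // eqxx.
  rewrite /X Qd frobE.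
  apply: eq_bigr => i _; rewrite (bigD1 i) //= big1 ?addr0 => [|j ji].
    by rewrite !mxE eqxx mulr1n expr2.
  by rewrite !mxE eq_sym (negPf ji) mulr0n mul0r.
have r_ge0 i j : 0 <= r i j by apply: sumr_ge0 => b _; exact: sqr_ge0.
have SU : {subset S <= U} by move=> b; rewrite !inE => /andP[].
have r_le i j : i != j -> r i j <= 2^-1.
  move=> ij; pose E : 'M[R]_n := delta_mx i j + delta_mx j i.
  have EE : frob E E = 2.
    rewrite /E frobDl !frob_delta !mxE !eqxx (negPf ij) eq_sym (negPf ij) /=.
    by rewrite addr0 add0r.
  have XE b : frob (X b) E = 2 * X b i j.
    by rewrite frobC /E frobDl !frob_delta -[X b in X in _ + X]Xs [_^T _ _]mxE; ring.
  have := @bessel R n _ S X E.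
  rewrite EE (eq_bigr (fun b => 4 * X b i j ^+ 2)) => [|b _]; last first.
    by rewrite XE; ring.
  rewrite -mulr_sumr -/(r i j) => h.
  have {}h : 4 * r i j <= 2 by apply: h => b c bS cS; rewrite X_orth ?SU.
  by lra.
have sum_r : \sum_i \sum_j r i j = (#|U| - 1)%:R.
  have -> : (#|U| - 1)%N = #|S| by rewrite (cardsD1 b0 U) b0U addKn.
  transitivity (\sum_(b in S) \sum_i \sum_j X b i j ^+ 2).
    by rewrite [RHS]exchange_big /=; apply: eq_bigr => i _; rewrite [RHS]exchange_big.
  rewrite -sumr_const; apply: eq_bigr => b bS.
  transitivity (frob (X b) (X b)); last by rewrite X_orth ?SU // eqxx.
  rewrite frobE.
  by apply: eq_bigr => i _; apply: eq_bigr => j _; rewrite expr2.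
have sum_comm : \sum_(b in U) frob (commmx (C b0) (C b)) (commmx (C b0) (C b))
    = \sum_i \sum_j ((eta i - eta j) ^+ 2 - 1) * r i j + (#|U|%:R - 1).
  have -> : #|U|%:R - 1 = \sum_i \sum_j r i j.
    by rewrite sum_r natrB // (cardsD1 b0) b0U.
  rewrite -big_split /= (bigD1 b0) //= {1}/commmx subrr /frob mul0mx linear0 add0r -/frob.
  rewrite (eq_bigr (fun b => \sum_i \sum_j (eta i - eta j) ^+ 2 * X b i j ^+ 2)).
    rewrite [LHS]exchange_big /=; apply: eq_bigr => i _.
    rewrite [X in X = _]exchange_big /= -big_split /=; apply: eq_bigr => j _.
    rewrite -mulr_sumr mulrBl mul1r addrNK; congr (_ * _).
    by apply: eq_bigl => b; rewrite !inE andbC.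
  move=> b _; rewrite -/(frob _ _) -[LHS](frob_conj _ _ QQ) -commmx_conj //.
  by rewrite Qd frob_commmx_diag.
have [i0 _] : exists i0 : 'I_n, true.
  have : \sum_i eta i ^+ 2 != 0 by rewrite eta1 oner_eq0.
  case: (pickP (fun i : 'I_n => true)) => [i _ _|h]; first by exists i.
  by rewrite big1 ?eqxx // => i; have := h i.
have [a star] : exists a, forall i j, 1 < (eta i - eta j) ^+ 2 -> (i == a) || (j == a).
  by apply: (large_gaps_form_star i0); rewrite eta1.
rewrite sum_comm; split.
  by have := star_gap_weight_le eta1 r_ge0 r_le star; lra.
move=> e; have {}e : \sum_i \sum_j ((eta i - eta j) ^+ 2 - 1) * r i j = 1 by lra.
have [K [c [[aK c1 da dK d0] supp]]] := star_gap_weight_eq eta1 r_ge0 r_le star e.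
exists Q, d, a, K, c; split; first split=> //.
  (* on the star, #|K| ((d_a - d_j)^2 - 1) = 1: hence e gives the total weight *)
  have : \sum_i \sum_j r i j = #|K|%:R.
    rewrite -[RHS]mulr1 -[X in _ = _ * X]e mulr_sumr; apply: eq_bigr => i _.
    rewrite mulr_sumr; apply: eq_bigr => j _.
    have [->|/supp rij] := eqVneq (r i j) 0; first by rewrite !mulr0.
    rewrite mulrA -[LHS]mul1r; congr (_ * _).
    have dK' k : k \in K -> #|K|%:R * ((eta a - eta k) ^+ 2 - 1) = 1.
      move=> kK; rewrite da (dK _ kK); set p := #|K|%:R in c1 *.
      transitivity ((c ^+ 2 * (p * (p + 1))) * (p + 1) - p); first by ring.
      by rewrite c1; ring.
    case/orP: rij => /andP[/eqP-> /dK' h]; first by rewrite h.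
    by rewrite -(opprB (eta a)) sqrrN h.
  rewrite sum_r => /eqP; rewrite eqr_nat (cardsD1 b0 U) b0U addKn => /eqP ->.
  by rewrite add1n.
split=> // b bU bb0 i j Xij; apply: supp.
apply: contraNneq Xij => /eqP.
rewrite psumr_eq0 => [/allP/(_ b (mem_index_enum b))|k _]; last exact: sqr_ge0.
by rewrite /= !inE bb0 bU /= sqrf_eq0.
Qed.

End OrthonormalFamily.

(** A nonzero term X_ij X_jk X_ki would be a triangle in the star. *)
Lemma trace_cube_star (R : realFieldType) n (X : 'M[R]_n) (a : 'I_n) (K : {set 'I_n}) :
  a \notin K ->
  (forall i j, X i j != 0 -> (i == a) && (j \in K) || (j == a) && (i \in K)) ->
  \tr (X *m X *m X) = 0.
Proof.
move=> aK supp; apply: big1 => i _; rewrite mxE; apply: big1 => k _.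
rewrite mxE mulr_suml; apply: big1 => j _; apply/eqP.
rewrite mulf_eq0; apply/negPn/negP; rewrite !negb_or mulf_eq0 negb_or.
move=> /andP[/andP[/supp ij /supp jk] /supp ki].
move: ij jk ki; case: (eqVneq i a) => [->|ia] /=.
  by rewrite (negPf aK) andbF orbF => jK; case: (eqVneq j a) => [je|]; [rewrite je (negPf aK) in jK|
    move=> _ /= => /andP[/eqP-> _]; rewrite eqxx (negPf aK)].
by move=> /andP[/eqP-> iK]; rewrite eqxx (negPf aK) /= andbF orbF => kK;
  rewrite iK andbT orbF => /eqP ka; rewrite ka (negPf aK) in kK.
Qed.

Lemma trace_cube_conj (R : realFieldType) n (Q A : 'M[R]_n) : Q *m Q^T = 1%:M ->
  \tr ((Q *m A *m Q^T) *m (Q *m A *m Q^T) *m (Q *m A *m Q^T)) = \tr (A *m A *m A).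
Proof.
move=> QQ; have QtQ : Q^T *m Q = 1%:M by rewrite (mulmx1C QQ).
have e (B C : 'M[R]_n) : (Q *m B *m Q^T) *m (Q *m C *m Q^T) = Q *m (B *m C) *m Q^T.
  by rewrite !mulmxA -[_ *m Q^T *m Q]mulmxA QtQ mulmx1.
by rewrite !e mxtrace_mulC !mulmxA QtQ mul1mx.
Qed.

(** With p = #|U| - 1, each member has the spectrum -pc, c (p times), 0, hence a
    cube of trace p c^3 (1 - p^2); but in the eigenbasis of another member it
    is supported on a star, so that this trace is 0. Thus p = 1, and the star
    is a single edge. *)
Lemma commutator_sum_planar (R : rcfType) n m (C : 'I_m -> 'M[R]_n) (U : {set 'I_m}) :
  (forall b, (C b)^T = C b) ->
  {in U &, forall b c, frob (C b) (C c) = (b == c)%:R} ->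
  U != finset.set0 ->
  {in U, forall b0, \sum_(b in U) frob (commmx (C b0) (C b)) (commmx (C b0) (C b))
     = #|U|%:R} ->
  exists (Q : 'M[R]_n) (p q : 'I_n), [/\ Q *m Q^T = 1%:M, p != q &
    forall b, b \in U -> forall i j, (Q *m C b *m Q^T) i j != 0 ->
      ((i == p) || (i == q)) && ((j == p) || (j == q))].
Proof.
move=> Cs Co /set0Pn[b0 b0U] Ce.
have [_ /(_ (Ce _ b0U))] := commutator_sum_star Cs Co b0U.
case=> [Q [d [a [K [c [[QQ Qd aK UK] [[c1 da dK d0] supp]]]]]]].
have K0 : (0 < #|K|)%N.
  by rewrite lt0n; apply: contra_eq_neq c1 => ->; rewrite mul0r mulr0 eq_sym oner_eq0.
have [b1 /andP[b1U b10]] : exists b1, (b1 \in U) && (b1 != b0).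
  have : (0 < #|U :\ b0|)%N by move: UK; rewrite (cardsD1 b0 U) b0U add1n => -[->].
  by case/card_gt0P => b1; rewrite !inE andbC => h; exists b1.
have K1 : #|K| = 1%N.
  have [_ /(_ (Ce _ b1U))] := commutator_sum_star Cs Co b1U.
  case=> [Q' [d' [a' [K' [c' [[QQ' Qd' aK' UK'] [[c1' da' dK' d0'] _]]]]]]].
  have KK : #|K'| = #|K| by move: UK'; rewrite UK => -[].
  have tr0 : \tr (C b1 *m C b1 *m C b1) = 0.
    by rewrite -(trace_cube_conj _ QQ); apply: (trace_cube_star aK); exact: supp.
  have : \tr (C b1 *m C b1 *m C b1) = #|K|%:R * c' ^+ 3 * (1 - #|K|%:R ^+ 2).
    rewrite -(trace_cube_conj _ QQ') Qd' !mulmx_diag mxtrace_diag.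
    rewrite (eq_bigr (fun i => d' 0 i ^+ 3)) => [|i _]; last by rewrite !mxE; ring.
    rewrite (bigID (mem K')) /= [X in _ + X](bigD1 a') //= da'.
    rewrite [X in _ + (_ + X)]big1 => [|i /andP[iK ia]]; last by rewrite d0' // expr0n.
    rewrite (eq_bigr (fun=> c' ^+ 3)) => [|i iK]; last by rewrite dK'.
    by rewrite sumr_const -(mulr_natl _ #|K'|) KK; ring.
  rewrite tr0 => /esym/eqP; rewrite !mulf_eq0 pnatr_eq0 -leqn0 leqNgt K0 /=.
  rewrite orbb orbb; have /negPf-> : c' != 0.
    by apply: contra_eq_neq c1' => ->; rewrite expr0n mul0r eq_sym oner_eq0.
  rewrite /= subr_eq0 eq_sym -natrX pnatr_eq1.
  by rewrite -[1%N](exp1n 2) eqn_exp2r // => /eqP.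
have [b Kb] : exists b, K = [set b] by apply/cards1P; rewrite K1.
have ab : a != b by move: aK; rewrite Kb inE.
exists Q, a, b; split=> // b2 b2U i j.
have [->|b20] := eqVneq b2 b0.
  rewrite Qd mxE; have [<-|_] := eqVneq i j; last by rewrite eqxx.
  rewrite mulr1n andbb; case: (eqVneq i a) => //= ia; apply: contra_neqT => ib.
  by rewrite d0 // Kb inE.
by move/(supp _ b2U b20); rewrite Kb !inE => /orP[]/andP[->->]; rewrite ?orbT.
Qed.

(** With t the least value of s on U, write s = t + s', where s' has a smaller
    support in U. The part of the form of degree 1 or 2 in t is a combination
    of row sums of e over U with nonnegative coefficients, and the rest is the
    same form at s'. *)
Lemma partial_sums_quadratic_ge0 (R : realFieldType) (I : finType)
    (e : I -> I -> R) (s : I -> R) (U : {set I}) :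
  (forall a b, e a b = e b a) -> {in U, forall a, 0 < s a} ->
  (forall V : {set I}, V \subset U -> {in V, forall a, 0 <= \sum_(b in V) e a b}) ->
  0 <= \sum_(a in U) \sum_(b in U) s a * s b * e a b /\
  (\sum_(a in U) \sum_(b in U) s a * s b * e a b = 0 ->
     {in U, forall a, \sum_(b in U) e a b = 0}).
Proof.
move=> eC; have [k] := ubnP #|U|; elim: k U s => // k IHk U s; rewrite ltnS => Uk s_gt0 h.
have [->|/set0Pn[a1 a1U]] := eqVneq U finset.set0.
  by rewrite big_set0; split=> // _ a; rewrite inE.
have [a0 a0U a0_min] : exists2 a0, a0 \in U & {in U, forall a, s a0 <= s a}.
  by case: (arg_minP s a1U) => a0 a0U h0; exists a0 => // a aU; exact: h0.
pose t := s a0; pose s' a := s a - t; pose U' := [set a in U | t < s a].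
have U'U : U' \subset U by apply/fintype.subsetP => a; rewrite inE => /andP[].
have [|||IH _] := IHk U' s'.
- apply: leq_trans Uk; apply: proper_card; rewrite properE U'U /=.
  by apply/fintype.subsetPn; exists a0; rewrite // inE ltxx andbF.
- by move=> a; rewrite inE subr_gt0 => /andP[].
- by move=> V VU'; apply: h; exact: fintype.subset_trans U'U.
have s'0 a : a \in U -> a \notin U' -> s' a = 0.
  move=> aU; rewrite inE aU /= -leNgt => sa; apply/eqP.
  by rewrite subr_eq0 eq_le sa a0_min.
have s'_ge0 a : a \in U -> 0 <= s' a by move=> aU; rewrite subr_ge0 a0_min.
have hU := h U (subxx _).
have layers : \sum_(a in U) \sum_(b in U) s a * s b * e a b =
    \sum_(a in U) (t ^+ 2 * \sum_(b in U) e a b)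
    + \sum_(a in U) (2 * t * s' a * \sum_(b in U) e a b)
    + \sum_(a in U') \sum_(b in U') s' a * s' b * e a b.
  have -> : \sum_(a in U') \sum_(b in U') s' a * s' b * e a b
     = \sum_(a in U) \sum_(b in U) s' a * s' b * e a b.
    have res (F : I -> R) : (forall a, a \in U -> a \notin U' -> F a = 0) ->
        \sum_(a in U') F a = \sum_(a in U) F a.
      move=> F0; rewrite [RHS](big_setID U') /= (finset.setIidPr U'U).
      by rewrite [X in _ + X]big1 ?addr0 // => a; rewrite inE => /andP[aU' aU]; exact: F0.
    rewrite res => [|a aU aU']; last by rewrite big1 // => b _; rewrite s'0 // !mul0r.
    by apply: eq_bigr => a _; apply: res => b bU bU'; rewrite (s'0 b) // mulr0 mul0r.
  have -> : \sum_(a in U) (2 * t * s' a * \sum_(b in U) e a b)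
      = \sum_(a in U) \sum_(b in U) t * s' a * e a b
        + \sum_(a in U) \sum_(b in U) t * s' b * e a b.
    rewrite [X in _ = _ + X]exchange_big /= -big_split /=; apply: eq_bigr => a _.
    rewrite mulr_sumr -big_split /=; apply: eq_bigr => b _.
    by rewrite (eC b a); ring.
  rewrite -!big_split /=; apply: eq_bigr => a _.
  rewrite mulr_sumr -!big_split /=; apply: eq_bigr => b _.
  by rewrite /s'; ring.
have t_gt0 : 0 < t by exact: s_gt0.
have p1 : 0 <= \sum_(a in U) (t ^+ 2 * \sum_(b in U) e a b).
  by apply: sumr_ge0 => a aU; rewrite mulr_ge0 ?sqr_ge0 ?hU.
have p2 : 0 <= \sum_(a in U) (2 * t * s' a * \sum_(b in U) e a b).
  by apply: sumr_ge0 => a aU; rewrite !mulr_ge0 ?s'_ge0 ?hU // ltW.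
rewrite layers; split; first by rewrite !addr_ge0.
move=> z a aU.
have : \sum_(a in U) (t ^+ 2 * \sum_(b in U) e a b) = 0 by lra.
move/eqP; rewrite psumr_eq0 => [/allP/(_ a (mem_index_enum a))|b bU]; last first.
  by rewrite mulr_ge0 ?sqr_ge0 ?hU.
by rewrite aU /= mulf_eq0 sqrf_eq0 (gt_eqF t_gt0) => /eqP.
Qed.

(** * Equality in the DDVV inequality *)

(** The family B in another basis of the index space. *)
Definition mixmx (R : realFieldType) n m (O : 'M[R]_m) (B : 'I_m -> 'M[R]_n)
    (a : 'I_m) : 'M[R]_n := \sum_b O a b *: B b.

Lemma sum_sqr_orthogonal (R : realFieldType) m (O : 'M[R]_m) (x : 'I_m -> R) :
  O *m O^T = 1%:M -> \sum_a (\sum_b O a b * x b) ^+ 2 = \sum_b x b ^+ 2.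
Proof.
move=> OO; have OtO : O^T *m O = 1%:M by rewrite (mulmx1C OO).
pose v : 'rV_m := \row_b x b.
transitivity ((v *m O^T *m (v *m O^T)^T) 0 0).
  rewrite sqmxE; apply: eq_bigr => a _; rewrite mxE; congr (_ ^+ 2).
  by apply: eq_bigr => b _; rewrite !mxE mulrC.
rewrite trmx_mul trmxK -mulmxA (mulmxA O^T) OtO mul1mx sqmxE.
by apply: eq_bigr => b _; rewrite mxE.
Qed.

Lemma sum_frob_mixmx (R : realFieldType) n m (O : 'M[R]_m) (B : 'I_m -> 'M[R]_n) :
  O *m O^T = 1%:M ->
  \sum_a frob (mixmx O B a) (mixmx O B a) = \sum_a frob (B a) (B a).
Proof.
move=> OO; under eq_bigr do rewrite frobE; under [RHS]eq_bigr do rewrite frobE.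
rewrite exchange_big [RHS]exchange_big; apply: eq_bigr => i _.
rewrite exchange_big [RHS]exchange_big; apply: eq_bigr => j _ /=.
transitivity (\sum_b B b i j ^+ 2); last by apply: eq_bigr => b _; rewrite expr2.
rewrite -(sum_sqr_orthogonal _ OO); apply: eq_bigr => a _.
rewrite -expr2 summxE; congr (_ ^+ 2).
by apply: eq_bigr => b _; rewrite mxE.
Qed.

Lemma commmx_mixmx (R : realFieldType) n m (O : 'M[R]_m) (B : 'I_m -> 'M[R]_n) A a :
  commmx A (mixmx O B a) = mixmx O (fun b => commmx A (B b)) a.
Proof.
rewrite /commmx /mixmx mulmx_sumr mulmx_suml -sumrB; apply: eq_bigr => b _.
by rewrite -scalemxAr -scalemxAl scalerBr.
Qed.

Lemma frob_commmxC (R : realFieldType) n (A B : 'M[R]_n) :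
  frob (commmx A B) (commmx A B) = frob (commmx B A) (commmx B A).
Proof. by rewrite -[commmx A B]opprB /frob linearN mulNmx mulmxN opprK. Qed.

Lemma sum_frob_commmx_mixmx (R : realFieldType) n m (O : 'M[R]_m)
    (B : 'I_m -> 'M[R]_n) : O *m O^T = 1%:M ->
  \sum_a \sum_b frob (commmx (mixmx O B a) (mixmx O B b))
                     (commmx (mixmx O B a) (mixmx O B b))
  = \sum_a \sum_b frob (commmx (B a) (B b)) (commmx (B a) (B b)).
Proof.
move=> OO.
have half A : \sum_b frob (commmx A (mixmx O B b)) (commmx A (mixmx O B b))
    = \sum_b frob (commmx A (B b)) (commmx A (B b)).
  under eq_bigr do rewrite commmx_mixmx.
  exact: sum_frob_mixmx.
under eq_bigr do rewrite half.
rewrite exchange_big [RHS]exchange_big; apply: eq_bigr => b _ /=.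
under eq_bigr do rewrite frob_commmxC; under [RHS]eq_bigr do rewrite frob_commmxC.
exact: half.
Qed.

(** Diagonalise the Gram matrix of the family. *)
Lemma orthogonal_mixture (R : rcfType) n m (B : 'I_m -> 'M[R]_n) :
  exists (O : 'M[R]_m), O *m O^T = 1%:M /\
    forall a b, a != b -> frob (mixmx O B a) (mixmx O B b) = 0.
Proof.
pose G : 'M[R]_m := \matrix_(a, b) frob (B a) (B b).
have Gs : G^T = G by apply/matrixP => a b; rewrite !mxE frobC.
have [ O [d [OO Od]]] := symmetric_diagonalizable Gs.
exists O; split=> // a b ab.
transitivity ((O *m G *m O^T) a b); last by rewrite Od mxE (negPf ab).
rewrite /mixmx frob_suml mxE.
under eq_bigr do rewrite frobZl frobC frob_suml mulr_sumr.
rewrite exchange_big; apply: eq_bigr => c _ /=.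
rewrite !mxE mulr_suml; apply: eq_bigr => e _.
by rewrite frobZl !mxE frobC; ring.
Qed.

(** An orthogonal mixture makes the members orthogonal. If they are sqrt(s_a)
    times unit vectors C_a, the defect of the inequality is the quadratic form
    with coefficients 1 - |[C_a, C_b]|^2 at s, to which
    partial_sums_quadratic_ge0 applies by commutator_sum_star. *)
Theorem ddvv_equality (R : rcfType) n m (B : 'I_m -> 'M[R]_n) : (1 < n)%N ->
  (forall a, (B a)^T = B a) ->
  \sum_a \sum_b frob (commmx (B a) (B b)) (commmx (B a) (B b))
    = (\sum_a frob (B a) (B a)) ^+ 2 ->
  exists (Q : 'M[R]_n) (p q : 'I_n), [/\ Q *m Q^T = 1%:M, p != q &
    forall a i j, (Q *m B a *m Q^T) i j != 0 ->
      ((i == p) || (i == q)) && ((j == p) || (j == q))].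
Proof.
move=> n1 Bs; have [ O [OO Oorth]] := orthogonal_mixture B.
rewrite -(sum_frob_commmx_mixmx _ OO) -(sum_frob_mixmx _ OO).
set A := mixmx O B in Oorth *; pose s a := frob (A a) (A a).
have As a : (A a)^T = A a.
  by rewrite /A /mixmx linear_sum; apply: eq_bigr => b _; rewrite linearZ /= Bs.
have BA b : B b = \sum_a O a b *: A a.
  rewrite /A /mixmx; under eq_bigr do rewrite scaler_sumr.
  rewrite exchange_big /= (bigD1 b) //= [X in _ + X]big1 => [|c cb].
    under eq_bigr do rewrite scalerA.
    rewrite -scaler_suml addr0.
    have := mulmx1C OO => /matrixP/(_ b b); rewrite !mxE eqxx.
    by under eq_bigr do rewrite mxE; move=> ->; rewrite scale1r.
  under eq_bigr do rewrite scalerA; rewrite -scaler_suml.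
  have := mulmx1C OO => /matrixP/(_ b c); rewrite !mxE eq_sym (negPf cb).
  by under eq_bigr do rewrite mxE; move=> ->; rewrite scale0r.
pose U := [set a | 0 < s a].
have AU a : a \notin U -> A a = 0.
  rewrite inE -leNgt => sa; apply: frob_eq0; apply/eqP.
  by rewrite eq_le sa frob_ge0.
pose C a := (Num.sqrt (s a))^-1 *: A a.
have sE a : a \in U -> Num.sqrt (s a) ^+ 2 = s a.
  by rewrite inE => /ltW; exact: sqr_sqrtr.
have AC a : a \in U -> A a = Num.sqrt (s a) *: C a.
  by rewrite inE => sa; rewrite scalerA divff ?scale1r // gt_eqF // sqrtr_gt0.
have Cs b : (C b)^T = C b by rewrite /C linearZ /= As.
have Co : {in U &, forall b c, frob (C b) (C c) = (b == c)%:R}.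
  move=> b c bU cU; rewrite frobZl frobZr; case: eqVneq => [<-|bc]; last first.
    by rewrite Oorth // !mulr0.
  rewrite -/(s b) -[X in _ * (_ * X)]sE // mulr1n; field.
  by move: bU; rewrite inE -sqrtr_gt0 => /gt_eqF ->.
clearbody C.
pose e a b := 1 - frob (commmx (C a) (C b)) (commmx (C a) (C b)).
have eC a b : e a b = e b a by rewrite /e frob_commmxC.
have sub_sum (V : {set _}) : V \subset U -> {in V, forall a, \sum_(b in V) e a b
    = #|V|%:R - \sum_(b in V) frob (commmx (C a) (C b)) (commmx (C a) (C b))}.
  by move=> VU a aV; rewrite sumrB sumr_const.
have h (V : {set _}) : V \subset U -> {in V, forall a, 0 <= \sum_(b in V) e a b}.
  move=> VU a aV; rewrite sub_sum // subr_ge0.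
  have VU' := fintype.subsetP VU.
  have Co' : {in V &, forall b c, frob (C b) (C c) = (b == c)%:R}.
    by move=> b c bV cV; rewrite Co ?VU'.
  by have [] := commutator_sum_star Cs Co' aV.
move=> eqDDVV.
have s_gt0 : {in U, forall a, 0 < s a} by move=> a; rewrite inE.
have [_ tight] := partial_sums_quadratic_ge0 eC s_gt0 h.
have resU (F : 'I_m -> R) : (forall a, a \notin U -> F a = 0) ->
    \sum_a F a = \sum_(a in U) F a.
  move=> F0; rewrite (bigID (mem U)) /= [X in _ + X]big1 ?addr0 //.
have {}tight : {in U, forall a, \sum_(b in U) e a b = 0}.
  apply: tight.
  transitivity ((\sum_a frob (A a) (A a)) ^+ 2 - \sum_a \sum_b
      frob (commmx (A a) (A b)) (commmx (A a) (A b))); last by rewrite eqDDVV subrr.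
  rewrite resU => [|a /AU ->]; last by rewrite /frob mul0mx linear0.
  rewrite [X in _ - X]resU => [|a /AU ->]; last first.
    by apply: big1 => b _; rewrite /commmx mul0mx mulmx0 subrr /frob mul0mx linear0.
  rewrite expr2 mulr_suml -sumrB; apply: eq_bigr => a aU.
  rewrite mulr_sumr [X in _ - X]resU => [|b /AU ->]; last first.
    by rewrite /commmx mul0mx mulmx0 subrr /frob mul0mx linear0.
  rewrite -sumrB; apply: eq_bigr => b bU.
  rewrite /e mulrBr mulr1; congr (_ - _).
  have -> : commmx (A a) (A b) = (Num.sqrt (s a) * Num.sqrt (s b)) *: commmx (C a) (C b).
    rewrite (AC a aU) (AC b bU) /commmx -!scalemxAl -!scalemxAr !scalerA scalerBr.
    by rewrite [Num.sqrt (s b) * _]mulrC.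
  by rewrite frobZl frobZr mulrA -expr2 exprMn !sE.
have [U0|U0] := eqVneq U finset.set0.
  exists 1%:M, (Ordinal (ltnW n1)), (Ordinal n1); split=> [||b i j].
  - by rewrite trmx1 mulmx1.
  - by [].
  - rewrite BA big1 => [|a _]; last by rewrite AU ?scaler0 // U0 inE.
    by rewrite mulmx0 mul0mx mxE eqxx.
have [|Q [p [q [QQ pq supp]]]] := commutator_sum_planar Cs Co U0.
  by move=> a aU; apply/eqP; rewrite eq_sym -subr_eq0 -sub_sum ?tight ?subxx.
exists Q, p, q; split=> // b i j; apply: contraNT => out.
rewrite BA mulmx_sumr mulmx_suml summxE big1 // => a _.
rewrite -scalemxAr -scalemxAl mxE; have [aU|aU] := boolP (a \in U); last first.
  by rewrite AU // mulmx0 mul0mx mxE mulr0.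
rewrite AC // -scalemxAr -scalemxAl mxE.
by have [->|/(supp _ aU)] := eqVneq ((Q *m C a *m Q^T) i j) 0; rewrite ?mulr0 // (negPf out).
Qed.

(** * Symmetry of second derivatives *)

Local Open Scope classical_set_scope.
Local Open Scope ring_scope.

Lemma is_derive_line (R : realType) (V W : normedModType R) (f : V -> W) (y u : V) (s : R) :
  derivable f (y + s *: u) u ->
  is_derive s 1 (fun t : R => f (y + t *: u)) ('D_u f (y + s *: u)).
Proof.
move=> df; have e : (fun h : R => h^-1 *: (((fun t : R => f (y + t *: u)) \o shift s) (h *: 1)
       - f (y + s *: u)))
    = (fun h : R => h^-1 *: ((f \o shift (y + s *: u)) (h *: u) - f (y + s *: u))).
  apply/funext => h /=; congr (_ *: (f _ - _)).
  by rewrite [_%:A]mulr1 scalerDl addrCA.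
by apply: DeriveDef; rewrite /derivable /derive e.
Qed.

Lemma differentiable_expansion (R : realType) (V W : normedModType R) (f : V -> W) (x : V) :
  differentiable f x -> forall e, 0 < e -> exists2 d, 0 < d &
    forall z, `|z| < d -> `|f (x + z) - f x - 'D_z f x| <= e * `|z|.
Proof.
move=> df e e0; have := diff_locally df; move=> /eqaddoP/(_ e e0).
move=> /nbhs_ballP[d /= d0 dP]; exists d => // z zd.
have := dP z; rewrite -ball_normE /= sub0r normrN => /(_ zd).
  by rewrite deriveE // [x + z]addrC -addrA -opprD.
Qed.

(** The mean value theorem in the direction u, applied to the difference of f
    along two parallel segments, and the first-order expansion of 'D_u f. *)
Lemma second_difference (R : realType) (V : normedModType R) (f : V -> R) (x u v : V) :
  (\forall y \near x, differentiable f y) ->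
  differentiable ('D_u f) x -> forall e, 0 < e -> exists2 d, 0 < d &
    forall t, 0 < t < d ->
     `|f (x + t *: u + t *: v) - f (x + t *: u) - f (x + t *: v) + f x
       - t ^+ 2 * 'D_v ('D_u f) x| <= e * t ^+ 2.
Proof.
move=> fd gd e e0.
(* the displacements below have norm at most t (|u| + |v|), and two errors occur *)
pose c := 2 * (`|u| + `|v|) + 1.
have c0 : 0 < c by rewrite /c; have := normr_ge0 u; have := normr_ge0 v; lra.
have ec0 : 0 < e / c by exact: divr_gt0.
have [d1 d10 gx] := differentiable_expansion gd ec0.
have [d2 /= d20 fx] := (nbhs_ballP _ _).1 fd.
pose d := Num.min d1 d2.
have d0 : 0 < d by rewrite lt_min d10 d20.
exists (d / c); first exact: divr_gt0.
move=> t /andP[t0 td].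
have tc : t * c < d by rewrite -ltr_pdivlMr.
have small s z : 0 <= s <= t -> 0 <= z <= t -> `|s *: u + z *: v| <= t * (`|u| + `|v|).
  move=> /andP[s0 st] /andP[z0 zt].
  apply: le_trans (ler_normD _ _) _; rewrite !normrZ !ger0_norm // mulrDr.
  by apply: lerD; rewrite ler_wpM2r.
have smalld s z : 0 <= s <= t -> 0 <= z <= t -> `|s *: u + z *: v| < d.
  move=> sh zh; apply: le_lt_trans (small _ _ sh zh) _; apply: le_lt_trans tc.
  by rewrite ler_pM2l // /c; have := normr_ge0 u; have := normr_ge0 v; lra.
have fdiff s z : 0 <= s <= t -> 0 <= z <= t -> differentiable f (x + z *: v + s *: u).
  move=> sh zh; apply: fx; rewrite -ball_normE /=.
  rewrite -addrA opprD addNKr normrN addrC.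
  by apply: lt_le_trans (smalld _ _ sh zh) _; rewrite ge_min lexx orbT.
pose phi := (fun s : R => f (x + t *: v + s *: u)) - (fun s : R => f (x + 0 *: v + s *: u)).
pose dphi s := 'D_u f (x + t *: v + s *: u) - 'D_u f (x + 0 *: v + s *: u).
have tt : 0 <= t <= t by rewrite (ltW t0) lexx.
have t00 : 0 <= (0 : R) <= t by rewrite lexx (ltW t0).
have phid s : 0 <= s <= t -> is_derive s 1 phi (dphi s).
  by move=> sh; apply: is_deriveB; apply: is_derive_line;
    apply: diff_derivable; apply: fdiff.
have [||s] := @MVT R phi dphi 0 t t0.
- by move=> s; rewrite in_itv /= => /andP[s0 st]; apply: phid; rewrite !ltW.
- apply: derivable_within_continuous => s; rewrite in_itv /= => sh.
  by have [] := phid _ sh.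
rewrite in_itv /= => /andP[s0 st].
have sh : 0 <= s <= t by rewrite !ltW.
rewrite /phi /dphi !fctE !scale0r !addr0 subr0 => e1.
have -> : f (x + t *: u + t *: v) - f (x + t *: u) - f (x + t *: v) + f x
   = f (x + t *: v + t *: u) - f (x + t *: u) - (f (x + t *: v) - f x).
  by rewrite [x + t *: u + t *: v]addrAC; ring.
rewrite e1.
have lin : 'D_(s *: u + t *: v) ('D_u f) x = 'D_(s *: u) ('D_u f) x + t * 'D_v ('D_u f) x.
  by rewrite !deriveE // linearD; congr (_ + _); rewrite linearZ.
have dd1 : d <= d1 by rewrite ge_min lexx.
have := gx (s *: u + t *: v) (lt_le_trans (smalld _ _ sh tt) dd1).
have := gx (s *: u + 0 *: v) (lt_le_trans (smalld _ _ sh t00) dd1).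
rewrite lin scale0r addr0 ['D_(s *: u) _ _]lock.
have -> : x + (s *: u + t *: v) = x + t *: v + s *: u by rewrite [s *: u + _]addrC addrA.
have b1 := small _ _ sh tt; have b2 := small _ _ sh t00.
rewrite scale0r addr0 in b2.
set A2 := _ - _ - _; move=> a2; set A1 := _ - _ - _ => a1.
have -> : ('D_u f (x + t *: v + s *: u) - 'D_u f (x + s *: u)) * t -
   t ^+ 2 * 'D_v ('D_u f) x = t * (A1 - A2) by rewrite /A1 /A2; ring.
rewrite normrM gtr0_norm // expr2 mulrCA ler_pM2l //.
apply: le_trans (ler_normB _ _) _.
apply: (@le_trans _ _ (e / c * (2 * (t * (`|u| + `|v|))))).
  have h (z : V) : `|z| <= t * (`|u| + `|v|) -> e / c * `|z| <= e / c * (t * (`|u| + `|v|)).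
    by move=> hz; rewrite ler_pM2l.
  rewrite mulr_natl mulr2n mulrDr.
  by apply: lerD; [exact: le_trans a1 (h _ b1) | exact: le_trans a2 (h _ b2)].
rewrite -mulrA ler_pM2l // mulrC ler_pdivrMr // /c.
by rewrite mulrCA ler_pM2l // lerDl ler01.
Qed.

(** Both sides are limits of the same second difference quotient, which is
    symmetric in u and v. *)
Lemma schwarz (R : realType) (V : normedModType R) (f : V -> R) (x u v : V) :
  (\forall y \near x, differentiable f y) ->
  differentiable ('D_u f) x -> differentiable ('D_v f) x ->
  'D_u ('D_v f) x = 'D_v ('D_u f) x.
Proof.
move=> fd ud vd.
have h1 := second_difference v fd ud; have h2 := second_difference u fd vd.
move: ('D_v ('D_u f) x) ('D_u ('D_v f) x) h1 h2 => A B h1 h2.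
apply/eqP; rewrite -subr_eq0 -normr_eq0 eq_le normr_ge0 andbT.
apply/ler_addgt0Pr => e e0; rewrite add0r.
have e20 : 0 < e / 2 by rewrite divr_gt0.
have [d1 d10 {}h1] := h1 _ e20; have [d2 d20 {}h2] := h2 _ e20.
pose t := Num.min d1 d2 / 2.
have t0 : 0 < t by rewrite divr_gt0 // lt_min d10 d20.
have td : t < Num.min d1 d2 by rewrite /t ltr_pdivrMr // ltr_pMr ?lt_min ?d10 ?d20 // ltr1n.
have := td; rewrite lt_min => /andP[td1 td2].
have := h1 t; rewrite t0 td1 => /(_ isT) {}h1.
have := h2 t; rewrite t0 td2 => /(_ isT) {}h2.
rewrite [x + t *: v + t *: u]addrAC in h2.
have t20 : 0 < t ^+ 2 by rewrite exprn_gt0.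
rewrite -(ler_pM2l t20) -[X in X * `|_|](gtr0_norm t20) -normrM.
move: (f (x + t *: u + t *: v)) (f (x + t *: u)) (f (x + t *: v)) (f x) h1 h2.
move=> D fu fv fx h1 h2.
have -> : t ^+ 2 * (B - A)
   = (D - fu - fv + fx - t ^+ 2 * A) - (D - fv - fu + fx - t ^+ 2 * B) by ring.
apply: le_trans (ler_normB _ _) _; apply: le_trans (lerD h1 h2) _.
by rewrite -mulrDl -splitr mulrC.
Qed.

(** * Calculus of matrix-valued maps *)

Lemma differentiable_entry (R : realType) (V : normedModType R) p q
    (A : V -> 'M[R]_(p, q)) x i j :
  differentiable A x -> differentiable (fun y => A y i j) x.
Proof.
move=> dA; apply: (@differentiable_comp _ _ _ _ A (fun B : 'M[R]_(p, q) => B i j)) => //.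
exact: differentiable_coord.
Qed.

Lemma derive_entry (R : realType) (V : normedModType R) p q
    (A : V -> 'M[R]_(p, q)) x v i j :
  differentiable A x -> 'D_v A x i j = 'D_v (fun y => A y i j) x.
Proof. by move=> dA; rewrite derive_mx ?mxE //; exact: diff_derivable. Qed.

Lemma differentiable_mx (R : realType) (V : normedModType R) p q
    (A : V -> 'M[R]_(p, q)) x :
  (forall i j, differentiable (fun y => A y i j) x) -> differentiable A x.
Proof.
move=> dA; have -> : A = \sum_i \sum_j (fun y => A y i j *: delta_mx i j).
  apply/funext => y; rewrite fct_sumE [LHS]matrix_sum_delta.
  by apply: eq_bigr => i _; rewrite fct_sumE.
apply: differentiable_sum => i; apply: differentiable_sum => j.
exact: differentiableZl.
Qed.

Lemma differentiable_sum_fun (R : realType) (V W : normedModType R) n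
    (f : 'I_n -> V -> W) x :
  (forall k, differentiable (f k) x) -> differentiable (fun y => \sum_k f k y) x.
Proof.
move=> df; have -> : (fun y => \sum_k f k y) = \sum_k f k.
  by apply/funext => y; rewrite fct_sumE.
exact: differentiable_sum.
Qed.

Lemma derive_sum_fun (R : realType) (V W : normedModType R) n
    (f : 'I_n -> V -> W) x v :
  (forall k, differentiable (f k) x) ->
  'D_v (fun y => \sum_k f k y) x = \sum_k 'D_v (f k) x.
Proof.
move=> df; have -> : (fun y => \sum_k f k y) = \sum_k f k.
  by apply/funext => y; rewrite fct_sumE.
by rewrite derive_sum // => k; exact: diff_derivable.
Qed.

Lemma derive_mul_fun (R : realType) (V : normedModType R) (f g : V -> R) x v :
  differentiable f x -> differentiable g x ->
  'D_v (fun y => f y * g y) x = 'D_v f x * g x + f x * 'D_v g x.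
Proof.
move=> df dg; rewrite [LHS](deriveM (diff_derivable df) (diff_derivable dg)).
by rewrite addrC /GRing.scale /= mulrC.
Qed.

Lemma differentiable_mulmx (R : realType) (V : normedModType R) p q r
    (A : V -> 'M[R]_(p, q)) (B : V -> 'M[R]_(q, r)) x :
  differentiable A x -> differentiable B x ->
  differentiable (fun y => A y *m B y) x.
Proof.
move=> dA dB; apply: differentiable_mx => i j.
under eq_fun do rewrite mxE.
apply: differentiable_sum_fun => k.
by apply: differentiableM; exact: differentiable_entry.
Qed.

Lemma derive_mulmx (R : realType) (V : normedModType R) p q r
    (A : V -> 'M[R]_(p, q)) (B : V -> 'M[R]_(q, r)) x v :
  differentiable A x -> differentiable B x ->
  'D_v (fun y => A y *m B y) x = 'D_v A x *m B x + A x *m 'D_v B x.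
Proof.
move=> dA dB; apply/matrixP => i j.
rewrite derive_entry; last exact: differentiable_mulmx.
under eq_fun do rewrite mxE.
rewrite derive_sum_fun => [|k]; last first.
  by apply: differentiableM; exact: differentiable_entry.
rewrite !mxE -big_split; apply: eq_bigr => k _ /=.
by rewrite derive_mul_fun ?derive_entry //; exact: differentiable_entry.
Qed.

Lemma differentiable_trmx (R : realType) (V : normedModType R) p q
    (A : V -> 'M[R]_(p, q)) x :
  differentiable A x -> differentiable (fun y => (A y)^T) x.
Proof.
move=> dA; apply: differentiable_mx => i j; under eq_fun do rewrite mxE.
exact: differentiable_entry.
Qed.

Lemma derive_trmx (R : realType) (V : normedModType R) p q
    (A : V -> 'M[R]_(p, q)) x v :
  differentiable A x -> 'D_v (fun y => (A y)^T) x = ('D_v A x)^T.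
Proof.
move=> dA; apply/matrixP => i j; rewrite derive_entry; last exact: differentiable_trmx.
by under eq_fun do rewrite mxE; rewrite mxE derive_entry.
Qed.

Lemma differentiable_form (R : realType) (V : normedModType R) n
    (A : V -> 'M[R]_n) (u w : V -> 'rV[R]_n) x :
  differentiable A x -> differentiable u x -> differentiable w x ->
  differentiable (fun y => form (A y) (u y) (w y)) x.
Proof.
move=> dA du dw; apply: differentiable_entry.
apply: differentiable_mulmx; last exact: differentiable_trmx.
exact: differentiable_mulmx.
Qed.

Lemma derive_form (R : realType) (V : normedModType R) n
    (A : V -> 'M[R]_n) (u w : V -> 'rV[R]_n) x v :
  differentiable A x -> differentiable u x -> differentiable w x ->
  'D_v (fun y => form (A y) (u y) (w y)) x
  = form ('D_v A x) (u x) (w x) + form (A x) ('D_v u x) (w x)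
    + form (A x) (u x) ('D_v w x).
Proof.
move=> dA du dw; have duA := differentiable_mulmx du dA.
have dwT := differentiable_trmx dw.
rewrite -derive_entry; last exact: differentiable_mulmx.
rewrite derive_mulmx // derive_mulmx // derive_trmx // mulmxDl /form !mxE.
by congr (_ + _); rewrite addrC.
Qed.

Lemma derive_comp_fun (R : realType) (V V' W : normedModType R)
    (f : V -> V') (g : V' -> W) x v :
  differentiable f x -> differentiable g (f x) ->
  'D_v (fun y => g (f y)) x = 'D_('D_v f x) g (f x).
Proof.
move=> df dg; rewrite !deriveE //; last exact: differentiable_comp.
by rewrite [X in 'd X _](_ : _ = g \o f) // diff_comp.
Qed.

Lemma derive_linear_dir (R : realType) (V W : normedModType R) (f : V -> W) x :
  differentiable f x -> forall a u v, 'D_(a *: u + v) f x = a *: 'D_u f x + 'D_v f x.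
Proof. by move=> df a u v; rewrite !deriveE // linearP. Qed.

Lemma near_eq_differentiable (R : realType) (V W : normedModType R) (f g : V -> W) x :
  (\near x, f x = g x) -> differentiable f x -> differentiable g x.
Proof.
move=> fg df; have fgx := nbhs_singleton fg.
have exp : g \o shift x = cst (g x) + 'd f x +o_ 0 id.
  apply/eqaddoP => e e0; have /eqaddoP/(_ e e0) := diff_locally df.
  have : \forall z \near (0 : V), f (z + x) = g (z + x).
    have := fg; rewrite (near_shift 0) /=; apply: filterS => z.
    by rewrite /= subr0.
  apply: filterS2 => z fgz h.
  have : `|f (z + x) - (f x + 'd f x z)| <= e * `|z| := h.
  by rewrite fgz fgx.
apply/diff_locallyP; rewrite (diff_unique (diff_continuous df) exp); split=> //.
exact: diff_continuous.
Unshelve. all: by end_near. Qed.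

Lemma schwarz_mx (R : realType) (V : normedModType R) p q
    (A : V -> 'M[R]_(p, q)) (x u v : V) :
  (\forall y \near x, differentiable A y) ->
  differentiable ('D_u A) x -> differentiable ('D_v A) x ->
  'D_u ('D_v A) x = 'D_v ('D_u A) x.
Proof.
move=> dA du dv; pose f i j y := A y i j.
have e w i j : \near x, 'D_w A x i j = 'D_w (f i j) x.
  by apply: filterS dA => y dy; exact: derive_entry.
have E w i j : differentiable ('D_w A) x -> differentiable ('D_w (f i j)) x.
  by move=> dw; apply: near_eq_differentiable (e w i j) _; exact: differentiable_entry.
have second w z i j : differentiable ('D_z A) x ->
    'D_w ('D_z A) x i j = 'D_w ('D_z (f i j)) x.
  move=> dz; transitivity ('D_w (fun y => 'D_z A y i j) x); first exact: derive_entry.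
  exact: near_eq_derive.
apply/matrixP => i j; transitivity ('D_u ('D_v (f i j)) x); first exact: second.
transitivity ('D_v ('D_u (f i j)) x); last by apply/esym; exact: second.
apply: schwarz; [|exact: E|exact: E].
by apply: filterS dA => y dy; exact: differentiable_entry.
Qed.

Lemma differentiable_det (R : realType) (V : normedModType R) n
    (A : V -> 'M[R]_n) x :
  differentiable A x -> differentiable (fun y => \det (A y)) x.
Proof.
elim: n A => [|n IHn] A dA.
  under eq_fun do rewrite det_mx00.
  exact: differentiable_cst.
under eq_fun do rewrite (expand_det_row _ 0).
apply: differentiable_sum_fun => j; apply: differentiableM.
  exact: differentiable_entry.
rewrite /cofactor; apply: differentiableM; first exact: differentiable_cst.
apply: IHn; apply: differentiable_mx => i k.
under eq_fun do rewrite !mxE.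
exact: differentiable_entry.
Qed.

(** Cramer's rule. *)
Lemma differentiable_invmx (R : realType) (V : normedModType R) n
    (A : V -> 'M[R]_n) x :
  (\forall y \near x, A y \in unitmx) -> differentiable A x ->
  differentiable (fun y => invmx (A y)) x.
Proof.
move=> uA dA; have ux := nbhs_singleton uA.
apply: (@near_eq_differentiable _ _ _ (fun y => (\det (A y))^-1 *: \adj (A y))).
  by apply: filterS uA => y uy; rewrite /invmx uy.
apply: differentiable_mx => i j; under eq_fun do rewrite !mxE.
apply: differentiableM.
  apply: differentiableV; first exact: differentiable_det.
  by rewrite -unitfE -unitmxE.
rewrite /cofactor; apply: differentiableM; first exact: differentiable_cst.
apply: differentiable_det; apply: differentiable_mx => k l.
under eq_fun do rewrite !mxE.
exact: differentiable_entry.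
Qed.

(** * Scalar products given by Gram matrices *)

Section Form.
Variables (R : realType) (n : nat).
Implicit Types (G H : 'M[R]_n) (u v w : 'rV[R]_n).

Lemma formDl G u v w : form G (u + v) w = form G u w + form G v w.
Proof. by rewrite /form !mulmxDl mxE. Qed.

Lemma formZl G a u w : form G (a *: u) w = a * form G u w.
Proof. by rewrite /form -!scalemxAl mxE. Qed.

Lemma formDr G u v w : form G u (v + w) = form G u v + form G u w.
Proof. by rewrite /form linearD mulmxDr mxE. Qed.

Lemma formZr G a u w : form G u (a *: w) = a * form G u w.
Proof. by rewrite /form linearZ -scalemxAr mxE. Qed.

Lemma form0l G w : form G 0 w = 0.
Proof. by rewrite -(scale0r 0) formZl mul0r. Qed.

Lemma form0r G w : form G w 0 = 0.
Proof. by rewrite -(scale0r 0) formZr mul0r. Qed.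

Lemma formNl G u w : form G (- u) w = - form G u w.
Proof. by rewrite -scaleN1r formZl mulN1r. Qed.

Lemma formNr G u w : form G u (- w) = - form G u w.
Proof. by rewrite -scaleN1r formZr mulN1r. Qed.

Lemma form_mxD G H u w : form (G + H) u w = form G u w + form H u w.
Proof. by rewrite /form mulmxDr mulmxDl mxE. Qed.

Lemma form_mxZ a G u w : form (a *: G) u w = a * form G u w.
Proof. by rewrite /form -scalemxAr -scalemxAl mxE. Qed.

Lemma form_suml (I : Type) (r : seq I) (P : pred I) G (u : I -> 'rV[R]_n) w :
  form G (\sum_(i <- r | P i) u i) w = \sum_(i <- r | P i) form G (u i) w.
Proof. by rewrite /form !mulmx_suml summxE. Qed.

Lemma form_sumr (I : Type) (r : seq I) (P : pred I) G (u : I -> 'rV[R]_n) w :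
  form G w (\sum_(i <- r | P i) u i) = \sum_(i <- r | P i) form G w (u i).
Proof. by rewrite /form linear_sum mulmx_sumr summxE. Qed.

Lemma formC G u w : G^T = G -> form G u w = form G w u.
Proof.
move=> Gs; rewrite /form -[in LHS]Gs.
transitivity ((w *m G *m u^T)^T 0 0); last by rewrite mxE.
by rewrite !trmx_mul trmxK mulmxA.
Qed.

Definition posdef G := G^T = G /\ forall u, u != 0 -> 0 < form G u u.

Lemma posdef_unitmx G : posdef G -> G \in unitmx.
Proof.
move=> [_ Gp]; rewrite -row_free_unit -kermx_eq0; apply/negPn/negP => /rowV0Pn[u uG u0].
have := Gp _ u0; rewrite /form.
by move/sub_kermxP: uG => ->; rewrite mul0mx mxE ltxx.
Qed.

Lemma form_inj G u v : posdef G -> (forall w, form G u w = form G v w) -> u = v.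
Proof.
move=> [_ Gp] h; apply/eqP; rewrite -subr_eq0; apply/negPn/negP => /Gp.
by rewrite formDl formNl h subrr ltxx.
Qed.

Lemma form_sharp G (l : 'rV[R]_n -> R) w : posdef G ->
  (forall a u v, l (a *: u + v) = a * l u + l v) -> form G (sharp G l) w = l w.
Proof.
move=> /posdef_unitmx Gu lin.
have l0 : l 0 = 0 by rewrite -(addr0 0) -{1}(scaler0 _ (-1)) lin mulN1r addNr.
have lD u v : l (u + v) = l u + l v by rewrite -{1}[u]scale1r lin mul1r.
have lZ a u : l (a *: u) = a * l u by rewrite -{1}[_ *: _]addr0 lin l0 addr0.
rewrite /form /sharp mulmxKV // mxE {2}[w]row_sum_delta (big_morph l lD l0).
by apply: eq_bigr => k _; rewrite !mxE lZ mulrC.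
Qed.

End Form.

(** * The Levi-Civita connection and its curvature *)

Definition smooth_at (R : realType) n (W : normedModType R) (F : 'rV[R]_n -> W) x :=
  exists U, [/\ open U, U x & smooth_on U F].

Lemma smooth_at_near (R : realType) n (W : normedModType R) (F : 'rV[R]_n -> W) x :
  smooth_at F x -> \near x, smooth_at F x.
Proof.
move=> [U [oU Ux sF]]; apply: filterS (open_nbhs_nbhs (conj oU Ux)) => y Uy.
by exists U.
Qed.

Lemma smooth_at_derive (R : realType) n (W : normedModType R) (F : 'rV[R]_n -> W) x v :
  smooth_at F x -> smooth_at ('D_v F) x.
Proof.
move=> [U [oU Ux sF]]; exists U; split=> // k.
by have [_ /(_ v)] := sF k.+1.
Qed.

Lemma smooth_at_differentiable (R : realType) n (W : normedModType R)
    (F : 'rV[R]_n -> W) x : smooth_at F x -> differentiable F x.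
Proof. by move=> [U [oU Ux sF]]; have [/(_ _ Ux)] := sF 1. Qed.

Lemma smooth_at_differentiable_near (R : realType) n (W : normedModType R)
    (F : 'rV[R]_n -> W) x : smooth_at F x -> \near x, differentiable F x.
Proof.
move/smooth_at_near; apply: filterS => y; exact: smooth_at_differentiable.
Qed.

Lemma smooth_at_derive2 (R : realType) n p q (A : 'rV[R]_n -> 'M[R]_(p, q)) x u v :
  smooth_at A x -> 'D_u ('D_v A) x = 'D_v ('D_u A) x.
Proof.
move=> sA; apply: schwarz_mx; first exact: smooth_at_differentiable_near.
  by apply: smooth_at_differentiable; exact: smooth_at_derive.
by apply: smooth_at_differentiable; exact: smooth_at_derive.
Qed.

Definition metric_at (R : realType) n (G : 'rV[R]_n -> 'M[R]_n) x :=
  smooth_at G x /\ \near x, posdef (G x).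

Lemma metric_at_near (R : realType) n (G : 'rV[R]_n -> 'M[R]_n) x :
  metric_at G x -> \near x, metric_at G x.
Proof.
move=> [/smooth_at_near sG pG]; have := near_join pG.
by apply: filterS2 sG => y sy py; split.
Qed.

Lemma metric_at_posdef (R : realType) n (G : 'rV[R]_n -> 'M[R]_n) x :
  metric_at G x -> posdef (G x).
Proof. by move=> [_ /nbhs_singleton]. Qed.

(** The derivatives of the metric and the connection are opaque: a comparison
    of two of them up to conversion would unfold limits. *)
HB.lock Definition dmetric (R : realType) n (G : 'rV[R]_n -> 'M[R]_n) x
  (u v w : 'rV[R]_n) : R := form ('D_u G x) v w.

HB.lock Definition d2metric (R : realType) n (G : 'rV[R]_n -> 'M[R]_n) x
  (a u v w : 'rV[R]_n) : R := form ('D_a ('D_u G) x) v w.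

HB.lock Definition levi_civita (R : realType) n (G : 'rV[R]_n -> 'M[R]_n) x
  (u v : 'rV[R]_n) : 'rV[R]_n := christoffel G x u v.

(** The Christoffel symbols of the first kind. *)
Definition koszul (R : realType) n (G : 'rV[R]_n -> 'M[R]_n) x (u v w : 'rV[R]_n) : R :=
  2^-1 * (dmetric G x u v w + dmetric G x v u w - dmetric G x w u v).

Lemma derive_form_cst (R : realType) (V : normedModType R) n
    (A : V -> 'M[R]_n) x v (u w : 'rV[R]_n) :
  differentiable A x -> 'D_v (fun y => form (A y) u w) x = form ('D_v A x) u w.
Proof.
move=> dA; rewrite (derive_form v dA (differentiable_cst u x) (differentiable_cst w x)).
by rewrite !derive_cst form0l form0r !addr0.
Qed.

Lemma derive_sym (R : realType) (V : normedModType R) n (G : V -> 'M[R]_n) x u :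
  (\near x, (G x)^T = G x) -> differentiable G x -> ('D_u G x)^T = 'D_u G x.
Proof. by move=> Gs dG; rewrite -derive_trmx //; exact: near_eq_derive. Qed.

Section LeviCivita.
Variables (R : realType) (n : nat) (G : 'rV[R]_n -> 'M[R]_n) (x : 'rV[R]_n).
Hypothesis Gx : metric_at G x.
Implicit Types u v w z : 'rV[R]_n.

Lemma metric_at_differentiable : differentiable G x.
Proof. by apply: smooth_at_differentiable; case: Gx. Qed.

Lemma metric_at_differentiable2 u : differentiable ('D_u G) x.
Proof.
by apply: smooth_at_differentiable; apply: smooth_at_derive; case: Gx.
Qed.

Lemma form_metricC u v : form (G x) u v = form (G x) v u.
Proof. by apply: formC; case: (metric_at_posdef Gx). Qed.

Lemma dmetric_sym u v w : dmetric G x u v w = dmetric G x u w v.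
Proof.
rewrite dmetric.unlock; apply: formC; apply: derive_sym metric_at_differentiable.
by case: Gx => _; apply: filterS => y [].
Qed.

Lemma dmetricP1 a u u' v w :
  dmetric G x (a *: u + u') v w = a * dmetric G x u v w + dmetric G x u' v w.
Proof.
rewrite dmetric.unlock (derive_linear_dir metric_at_differentiable).
by rewrite form_mxD form_mxZ.
Qed.

Lemma dmetricP2 a u v v' w :
  dmetric G x u (a *: v + v') w = a * dmetric G x u v w + dmetric G x u v' w.
Proof. by rewrite dmetric.unlock formDl formZl. Qed.

Lemma dmetricP3 a u v w w' :
  dmetric G x u v (a *: w + w') = a * dmetric G x u v w + dmetric G x u v w'.
Proof. by rewrite dmetric.unlock formDr formZr. Qed.

Lemma koszul_sym u v w : koszul G x u v w = koszul G x v u w.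
Proof. by rewrite /koszul (dmetric_sym w u v) [dmetric G x u v w + _]addrC. Qed.

(** The Levi-Civita connection is metric. *)
Lemma koszul_add u v w :
  koszul G x u v w + koszul G x u w v = dmetric G x u v w.
Proof. by rewrite /koszul (dmetric_sym u w v); field. Qed.

Lemma koszulP a u v w w' :
  koszul G x u v (a *: w + w') = a * koszul G x u v w + koszul G x u v w'.
Proof. by rewrite /koszul dmetricP1 !dmetricP3; field. Qed.

Lemma christoffel_koszul u v : christoffel G x u v = sharp (G x) (koszul G x u v).
Proof.
have dG := metric_at_differentiable; congr sharp; apply/funext => w.
rewrite /koszul dmetric.unlock; congr (_ * (_ + _ - _)); exact: derive_form_cst.
Qed.

Lemma form_levi_civita u v w :
  form (G x) (levi_civita G x u v) w = koszul G x u v w.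
Proof.
rewrite levi_civita.unlock christoffel_koszul.
by rewrite (form_sharp _ (metric_at_posdef Gx)) // => a z z'; exact: koszulP.
Qed.

Lemma levi_civitaC u v : levi_civita G x u v = levi_civita G x v u.
Proof.
apply: (form_inj (metric_at_posdef Gx)) => w.
by rewrite !form_levi_civita koszul_sym.
Qed.

Lemma levi_civitaP a u v v' : levi_civita G x u (a *: v + v')
  = a *: levi_civita G x u v + levi_civita G x u v'.
Proof.
apply: (form_inj (metric_at_posdef Gx)) => w.
rewrite formDl formZl !form_levi_civita /koszul dmetricP1 dmetricP2 dmetricP3.
by field.
Qed.

Lemma levi_civita0r u : levi_civita G x u 0 = 0.
Proof.
have := levi_civitaP (-1) u 0 0; rewrite scaler0 addr0.
by rewrite scaleN1r addNr.
Qed.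

Lemma derive_metric u v w : dmetric G x u v w
  = form (G x) (levi_civita G x u v) w + form (G x) v (levi_civita G x u w).
Proof.
by rewrite [form _ v _]form_metricC !form_levi_civita koszul_add.
Qed.

Lemma derive_dmetric a u v w :
  'D_a (fun y => dmetric G y u v w) x = d2metric G x a u v w.
Proof.
rewrite dmetric.unlock d2metric.unlock; apply: derive_form_cst.
exact: metric_at_differentiable2.
Qed.

Lemma differentiable_dmetric u v w : differentiable (fun y => dmetric G y u v w) x.
Proof.
rewrite dmetric.unlock; apply: differentiable_form; [|exact: differentiable_cst..].
exact: metric_at_differentiable2.
Qed.

Lemma differentiable_koszul u v w : differentiable (fun y => koszul G y u v w) x.
Proof.
apply: differentiableM; first exact: differentiable_cst.
by apply: differentiableB; [apply: differentiableD|]; exact: differentiable_dmetric.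
Qed.

End LeviCivita.

Section Curvature.
Variables (R : realType) (n : nat) (G : 'rV[R]_n -> 'M[R]_n) (x : 'rV[R]_n).
Hypothesis Gx : metric_at G x.
Implicit Types u v w z : 'rV[R]_n.

Lemma differentiable_levi_civita u v :
  differentiable (fun y => levi_civita G y u v) x.
Proof.
have [_ pG] := Gx.
apply: (@near_eq_differentiable _ _ _
  (fun y => (\row_k koszul G y u v (delta_mx 0 k)) *m invmx (G y))).
  apply: filterS (metric_at_near Gx) => y Gy.
  by rewrite levi_civita.unlock (christoffel_koszul Gy).
apply: differentiable_mulmx.
  apply: differentiable_mx => i k; under eq_fun do rewrite mxE.
  exact: differentiable_koszul.
apply: differentiable_invmx (metric_at_differentiable Gx).
by apply: filterS pG => y; exact: posdef_unitmx.
Qed.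

Lemma curv_levi_civita u v w : curv G x u v w =
  'D_u (fun y => levi_civita G y v w) x + levi_civita G x u (levi_civita G x v w)
  - ('D_v (fun y => levi_civita G y u w) x
     + levi_civita G x v (levi_civita G x u w)).
Proof.
have D0 (a b : 'rV[R]_n) y : 'D_a (fun=> b) y = 0 by exact: derive_cst.
have nabE (a b : 'rV[R]_n) :
    nabla G (fun=> a) (fun=> b) = fun y => levi_civita G y a b.
  by apply/funext => y; rewrite levi_civita.unlock /nabla D0 add0r.
have lie0 : lie_bracket (fun=> u) (fun=> v) x = 0.
  by rewrite /lie_bracket D0 D0 subrr.
have last0 : nabla G (lie_bracket (fun=> u) (fun=> v)) (fun=> w) x = 0.
  rewrite /nabla lie0 D0 add0r; have := levi_civita0r Gx w.
  by rewrite (levi_civitaC Gx) levi_civita.unlock.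
have step (a b c : 'rV[R]_n) : nabla G (fun=> a) (nabla G (fun=> b) (fun=> c)) x
    = 'D_a (fun y => levi_civita G y b c) x
      + levi_civita G x a (levi_civita G x b c).
  by rewrite nabE /nabla levi_civita.unlock.
by rewrite /curv last0 subr0 step step.
Qed.

(** As the connection is metric, the derivative of g(nabla_v w, z) in the
    direction u replaces that of nabla_v w, at the expense of a term
    g(nabla_v w, nabla_u z): derivatives of the inverse metric do not occur. *)
Lemma curv4_koszul u v w z : curv4 G x u v w z =
  'D_u (fun y => koszul G y v w z) x - 'D_v (fun y => koszul G y u w z) x
  - form (G x) (levi_civita G x v w) (levi_civita G x u z)
  + form (G x) (levi_civita G x u w) (levi_civita G x v z).
Proof.
have half a b c : form (G x) ('D_a (fun y => levi_civita G y b c) x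
    + levi_civita G x a (levi_civita G x b c)) z
    = 'D_a (fun y => koszul G y b c z) x
      - form (G x) (levi_civita G x b c) (levi_civita G x a z).
  transitivity ('D_a (fun y => form (G y) (levi_civita G y b c) z) x
      - form (G x) (levi_civita G x b c) (levi_civita G x a z)); last first.
    congr (_ - _); apply: near_eq_derive.
    by apply: filterS (metric_at_near Gx) => y Gy; exact: form_levi_civita.
  rewrite (derive_form a (metric_at_differentiable Gx)
     (differentiable_levi_civita b c) (differentiable_cst z x)).
  rewrite derive_cst form0r addr0 formDl.
  have := derive_metric Gx a (levi_civita G x b c) z; rewrite dmetric.unlock => ->.
  by ring.
rewrite /curv4 curv_levi_civita formDl formNl !half.
by ring.
Qed.

Lemma derive_koszul a u v w : 'D_a (fun y => koszul G y u v w) x =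
  2^-1 * (d2metric G x a u v w + d2metric G x a v u w - d2metric G x a w u v).
Proof.
have d b c e := differentiable_dmetric Gx b c e.
have dd b c e : derivable (fun y => dmetric G y b c e) x a.
  by apply: diff_derivable; exact: d.
rewrite [LHS](@derive_mul_fun _ _ (fun=> 2^-1)
  (fun y => dmetric G y u v w + dmetric G y v u w - dmetric G y w u v)).
- rewrite derive_cst mul0r add0r -!(derive_dmetric Gx); congr (_ * _).
  by rewrite [LHS](deriveB (derivableD (dd _ _ _) (dd _ _ _)) (dd _ _ _))
    (deriveD (dd _ _ _) (dd _ _ _)).
- exact: differentiable_cst.
- by apply: differentiableB; first exact: differentiableD.
Qed.

Lemma d2metricC a u v w : d2metric G x a u v w = d2metric G x u a v w.
Proof. by rewrite d2metric.unlock smooth_at_derive2 //; case: Gx. Qed.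

Lemma d2metric_sym a u v w : d2metric G x a u v w = d2metric G x a u w v.
Proof.
rewrite -!(derive_dmetric Gx); apply: near_eq_derive.
by apply: filterS (metric_at_near Gx) => y Gy; exact: dmetric_sym.
Qed.

(** The symmetries of the curvature tensor can be read off from this
    expression. *)
Lemma curv4E u v w z : curv4 G x u v w z =
  2^-1 * (d2metric G x u w v z - d2metric G x u z v w
          - d2metric G x v w u z + d2metric G x v z u w)
  - form (G x) (levi_civita G x v w) (levi_civita G x u z)
  + form (G x) (levi_civita G x u w) (levi_civita G x v z).
Proof.
rewrite curv4_koszul !derive_koszul (d2metricC v u).
by ring.
Qed.

Lemma curv4_skew12 u v w z : curv4 G x u v w z = - curv4 G x v u w z.
Proof. by rewrite !curv4E; ring. Qed.

Lemma curv4_skew34 u v w z : curv4 G x u v w z = - curv4 G x u v z w.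
Proof.
rewrite !curv4E (form_metricC Gx (levi_civita G x u w)).
rewrite (form_metricC Gx (levi_civita G x u z)).
by ring.
Qed.

Lemma curv4_pair u v w z : curv4 G x u v w z = curv4 G x w z u v.
Proof.
rewrite !curv4E (d2metricC w u) (d2metricC w v) (d2metricC z u) (d2metricC z v).
rewrite (d2metric_sym u w z v) (d2metric_sym v w z u) (d2metric_sym u z w v).
rewrite (d2metric_sym v z w u).
rewrite (levi_civitaC Gx z u) (levi_civitaC Gx w v) (levi_civitaC Gx w u).
rewrite (levi_civitaC Gx z v) (form_metricC Gx (levi_civita G x u z)).
by ring.
Qed.

Lemma curv4_bianchi u v w z :
  curv4 G x u v w z + curv4 G x v w u z + curv4 G x w u v z = 0.
Proof.
rewrite !curv4E (d2metricC w u) (d2metricC w v) (d2metricC v u).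
rewrite (d2metric_sym u z w v) (d2metric_sym v z u w) (d2metric_sym w z v u).
rewrite (levi_civitaC Gx w v) (levi_civitaC Gx u w) (levi_civitaC Gx v u).
by ring.
Qed.


End Curvature.

(** * The Gauss equation *)

Lemma derive_dir_sum (R : realType) n (W : normedModType R) (f : 'rV[R]_n -> W) x v :
  differentiable f x -> 'D_v f x = \sum_k v 0 k *: 'D_(delta_mx 0 k) f x.
Proof.
move=> df; rewrite deriveE // {1}[v]row_sum_delta linear_sum; apply: eq_bigr => k _.
by rewrite linearZ deriveE.
Qed.

(** The derivative along dir y depends on y through the point and through the
    direction; on the canonical basis the direction becomes a family of
    coefficients. *)
Section MovingDirection.
Variables (R : realType) (n d p q : nat).
Variables (A : 'rV[R]_d -> 'M[R]_(p, q)) (F dir : 'rV[R]_n -> 'rV[R]_d) (x : 'rV[R]_n).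
Hypotheses (sA : smooth_at A (F x)) (dF : differentiable F x)
  (dp : differentiable dir x).

Let B y := \sum_k dir y 0 k *: 'D_(delta_mx 0 k) A (F y).

Let nearB : \near x, B x = 'D_(dir x) A (F x).
Proof.
have cF : {for x, continuous F} by exact: differentiable_continuous.
have near_dA : \forall y \near x, differentiable A (F y).
  exact: cF _ (smooth_at_differentiable_near sA).
apply: filterS near_dA => y dA.
by rewrite [RHS]derive_dir_sum.
Qed.

Let sAk k : differentiable ('D_(delta_mx 0 k) A) (F x).
Proof. by apply: smooth_at_differentiable; exact: smooth_at_derive. Qed.

Let dAF k : differentiable (fun y => 'D_(delta_mx 0 k) A (F y)) x.
Proof. exact: (@differentiable_comp _ _ _ _ F ('D_(delta_mx 0 k) A) x dF (sAk k)). Qed.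

Let dB k : differentiable (fun y => dir y 0 k *: 'D_(delta_mx 0 k) A (F y)) x.
Proof.
apply: differentiable_mx => i j; under eq_fun do rewrite mxE.
by apply: differentiableM; exact: differentiable_entry.
Qed.

Lemma differentiable_moving : differentiable (fun y => 'D_(dir y) A (F y)) x.
Proof. by apply: near_eq_differentiable nearB _; exact: differentiable_sum_fun. Qed.

Lemma derive_moving a : 'D_a (fun y => 'D_(dir y) A (F y)) x
  = 'D_('D_a F x) ('D_(dir x) A) (F x) + 'D_('D_a dir x) A (F x).
Proof.
transitivity ('D_a B x); first by apply: near_eq_derive; apply: filterS nearB => y ->.
rewrite [LHS]derive_sum_fun //.
rewrite (smooth_at_derive2 _ _ sA).
have sAa : differentiable ('D_('D_a F x) A) (F x).
  by apply: smooth_at_differentiable; exact: smooth_at_derive.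
rewrite (derive_dir_sum (dir x) sAa) (derive_dir_sum ('D_a dir x) (smooth_at_differentiable sA)).
rewrite -big_split; apply: eq_bigr => k _ /=.
rewrite (smooth_at_derive2 _ _ sA).
apply/matrixP => i j.
transitivity ('D_a (fun y => dir y 0 k * 'D_(delta_mx 0 k) A (F y) i j) x).
  rewrite (derive_entry a i j (dB k)); congr ('D_a _ x).
  by apply/funext => y; rewrite mxE.
rewrite derive_mul_fun; [|exact: differentiable_entry..].
have e1 : 'D_a (fun y => dir y 0 k) x = ('D_a dir x) 0 k.
  by apply/esym; exact: derive_entry.
have e2 : 'D_a (fun y => 'D_(delta_mx 0 k) A (F y) i j) x
    = 'D_('D_a F x) ('D_(delta_mx 0 k) A) (F x) i j.
  by rewrite -(derive_entry a i j (dAF k)) (derive_comp_fun a dF (sAk k)).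
by rewrite e1 e2 addrC [RHS]mxE [X in _ = X + _]mxE [X in _ = _ + X]mxE.
Qed.

End MovingDirection.

Definition isometric_at (R : realType) n d (G : 'rV[R]_n -> 'M[R]_n)
    (Gt : 'rV[R]_d -> 'M[R]_d) (F : 'rV[R]_n -> 'rV[R]_d) x :=
  [/\ smooth_at F x, metric_at G x, metric_at Gt (F x) &
      \forall y \near x, forall u v,
        form (Gt (F y)) ('D_u F y) ('D_v F y) = form (G y) u v].

Lemma isometric_at_near (R : realType) n d (G : 'rV[R]_n -> 'M[R]_n)
    (Gt : 'rV[R]_d -> 'M[R]_d) (F : 'rV[R]_n -> 'rV[R]_d) x :
  isometric_at G Gt F x -> \forall y \near x, isometric_at G Gt F y.
Proof.
move=> [sF mG mGt iso].
have cF : {for x, continuous F}.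
  by apply: differentiable_continuous; exact: smooth_at_differentiable.
have nGt : \forall y \near x, metric_at Gt (F y) by exact: cF _ (metric_at_near mGt).
have niso := near_join iso.
apply: filterS2 (filterI (smooth_at_near sF) (metric_at_near mG)) (filterI nGt niso).
by move=> y [sFy mGy] [mGty isoy]; split.
Qed.

(** Opaque, like the derivatives of the metric. *)
HB.lock Definition push (R : realType) n d (F : 'rV[R]_n -> 'rV[R]_d) x
  (u : 'rV[R]_n) : 'rV[R]_d := 'D_u F x.

HB.lock Definition hess (R : realType) n d (F : 'rV[R]_n -> 'rV[R]_d) x
  (u v : 'rV[R]_n) : 'rV[R]_d := 'D_u ('D_v F) x.

HB.lock Definition hess3 (R : realType) n d (F : 'rV[R]_n -> 'rV[R]_d) x
  (a u v : 'rV[R]_n) : 'rV[R]_d := 'D_a ('D_u ('D_v F)) x.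

Section Gauss.
Variables (R : realType) (n d : nat) (G : 'rV[R]_n -> 'M[R]_n)
  (Gt : 'rV[R]_d -> 'M[R]_d) (F : 'rV[R]_n -> 'rV[R]_d) (x : 'rV[R]_n).
Hypothesis Fx : isometric_at G Gt F x.
Implicit Types u v w z : 'rV[R]_n.

Let sF : smooth_at F x. Proof. by case: Fx. Qed.
Let Gx : metric_at G x. Proof. by case: Fx. Qed.
Let Tx : metric_at Gt (F x). Proof. by case: Fx. Qed.
Let dF : differentiable F x. Proof. exact: smooth_at_differentiable. Qed.

Let sDF v : smooth_at ('D_v F) x. Proof. exact: smooth_at_derive. Qed.
Let dDF v : differentiable ('D_v F) x. Proof. exact: smooth_at_differentiable. Qed.

Lemma hessC u v : hess F x u v = hess F x v u.
Proof. by rewrite hess.unlock; exact: smooth_at_derive2. Qed.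

Lemma derive_form_along (u : 'rV[R]_n) (p q : 'rV[R]_n -> 'rV[R]_d) :
  differentiable p x -> differentiable q x ->
  'D_u (fun y => form (Gt (F y)) (p y) (q y)) x =
  dmetric Gt (F x) ('D_u F x) (p x) (q x)
  + form (Gt (F x)) ('D_u p x) (q x) + form (Gt (F x)) (p x) ('D_u q x).
Proof.
move=> dp dq; have dGt := metric_at_differentiable Tx.
have dGF : differentiable (fun y => Gt (F y)) x.
  exact: (@differentiable_comp _ _ _ _ F Gt x dF dGt).
by rewrite (derive_form u dGF dp dq) (derive_comp_fun u dF dGt) dmetric.unlock.
Qed.

Lemma dmetric_pullback u v w : dmetric G x u v w =
  dmetric Gt (F x) (push F x u) (push F x v) (push F x w)
  + form (Gt (F x)) (hess F x u v) (push F x w)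
  + form (Gt (F x)) (push F x v) (hess F x u w).
Proof.
rewrite hess.unlock push.unlock -(derive_form_along u (dDF v) (dDF w)) dmetric.unlock.
rewrite -(derive_form_cst u v w (metric_at_differentiable Gx)).
apply: near_eq_derive; case: Fx => _ _ _; apply: filterS => y h.
by rewrite h.
Qed.

(** Differentiate the identity between G and the pull-back of Gt; in the
    combination of the Koszul formula only one second derivative of F is
    left. *)
Lemma koszul_pullback u v w : koszul G x u v w =
  koszul Gt (F x) (push F x u) (push F x v) (push F x w)
  + form (Gt (F x)) (hess F x u v) (push F x w).
Proof.
rewrite /koszul !dmetric_pullback (hessC v u) (hessC w u) (hessC w v).
rewrite (form_metricC Tx (push F x v) (hess F x u w)).
rewrite (form_metricC Tx (push F x u) (hess F x v w)).
by field.
Qed.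

Lemma derive_dmetric_along a (p q r : 'rV[R]_n -> 'rV[R]_d) :
  differentiable p x -> differentiable q x -> differentiable r x ->
  differentiable (fun y => dmetric Gt (F y) (p y) (q y) (r y)) x /\
  'D_a (fun y => dmetric Gt (F y) (p y) (q y) (r y)) x =
  d2metric Gt (F x) ('D_a F x) (p x) (q x) (r x)
  + dmetric Gt (F x) ('D_a p x) (q x) (r x)
  + dmetric Gt (F x) (p x) ('D_a q x) (r x)
  + dmetric Gt (F x) (p x) (q x) ('D_a r x).
Proof.
move=> dp dq dr; have [sGt _] := Tx.
have dB := differentiable_moving sGt dF dp.
rewrite dmetric.unlock d2metric.unlock; split; first exact: differentiable_form.
rewrite (derive_form a dB dq dr) (derive_moving sGt dF dp a) form_mxD.
by [].
Qed.

Lemma derive_koszul_along a (p q r : 'rV[R]_n -> 'rV[R]_d) :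
  differentiable p x -> differentiable q x -> differentiable r x ->
  differentiable (fun y => koszul Gt (F y) (p y) (q y) (r y)) x /\
  'D_a (fun y => koszul Gt (F y) (p y) (q y) (r y)) x =
  'D_('D_a F x) (fun c : 'rV[R]_d => koszul Gt c (p x) (q x) (r x)) (F x)
  + koszul Gt (F x) ('D_a p x) (q x) (r x)
  + koszul Gt (F x) (p x) ('D_a q x) (r x)
  + koszul Gt (F x) (p x) (q x) ('D_a r x).
Proof.
move=> dp dq dr.
have [d1 e1] := derive_dmetric_along a dp dq dr.
have [d2 e2] := derive_dmetric_along a dq dp dr.
have [d3 e3] := derive_dmetric_along a dr dp dq.
have dd := differentiableB (differentiableD d1 d2) d3.
split; first by apply: differentiableM; [exact: differentiable_cst|exact: dd].
have d0 : differentiable (fun _ : 'rV[R]_n => 2^-1 : R) x.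
  by exact: differentiable_cst.
rewrite [LHS](derive_mul_fun a d0 dd) derive_cst mul0r add0r.
rewrite [X in 2^-1 * X](_ : _ = 'D_a (fun y => dmetric Gt (F y) (p y) (q y) (r y)) x
   + 'D_a (fun y => dmetric Gt (F y) (q y) (p y) (r y)) x
   - 'D_a (fun y => dmetric Gt (F y) (r y) (p y) (q y)) x); last first.
  have E1 := @diff_derivable _ _ _ _ _ a d1.
  have E2 := @diff_derivable _ _ _ _ _ a d2.
  have E3 := @diff_derivable _ _ _ _ _ a d3.
  by rewrite [LHS](deriveB (derivableD E1 E2) E3) (deriveD E1 E2).
by rewrite e1 e2 e3 (derive_koszul Tx) /koszul; field.
Qed.

End Gauss.

Section GaussEquation.
Variables (R : realType) (n d : nat) (G : 'rV[R]_n -> 'M[R]_n)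
  (Gt : 'rV[R]_d -> 'M[R]_d) (F : 'rV[R]_n -> 'rV[R]_d) (x : 'rV[R]_n).
Hypothesis Fx : isometric_at G Gt F x.
Implicit Types u v w z : 'rV[R]_n.

Let sF : smooth_at F x. Proof. by case: Fx. Qed.
Let Gx : metric_at G x. Proof. by case: Fx. Qed.
Let Tx : metric_at Gt (F x). Proof. by case: Fx. Qed.

Let dF : differentiable F x. Proof. exact: smooth_at_differentiable. Qed.

Let dDF v : differentiable ('D_v F) x.
Proof. by apply: smooth_at_differentiable; exact: smooth_at_derive. Qed.

Let dDDF u v : differentiable ('D_u ('D_v F)) x.
Proof. by apply: smooth_at_differentiable; do 2!apply: smooth_at_derive. Qed.

Lemma hess3C a u v : hess3 F x a u v = hess3 F x u a v.
Proof.
by rewrite hess3.unlock; apply: smooth_at_derive2; exact: smooth_at_derive.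
Qed.

Lemma derive_koszul_pullback a u v w : 'D_a (fun y => koszul G y u v w) x =
  'D_(push F x a) (fun c => koszul Gt c (push F x u) (push F x v) (push F x w)) (F x)
  + koszul Gt (F x) (hess F x a u) (push F x v) (push F x w)
  + koszul Gt (F x) (push F x u) (hess F x a v) (push F x w)
  + koszul Gt (F x) (push F x u) (push F x v) (hess F x a w)
  + dmetric Gt (F x) (push F x a) (hess F x u v) (push F x w)
  + form (Gt (F x)) (hess3 F x a u v) (push F x w)
  + form (Gt (F x)) (hess F x u v) (hess F x a w).
Proof.
have [dk ek] := derive_koszul_along Fx a (dDF u) (dDF v) (dDF w).
have ef := derive_form_along Fx a (dDDF u v) (dDF w).
have df : differentiable
    (fun y => form (Gt (F y)) ('D_u ('D_v F) y) ('D_w F y)) x.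
  apply: differentiable_form => //.
  exact: (@differentiable_comp _ _ _ _ F Gt x dF (metric_at_differentiable Tx)).
transitivity ('D_a ((fun y => koszul Gt (F y) ('D_u F y) ('D_v F y) ('D_w F y))
    + (fun y => form (Gt (F y)) ('D_u ('D_v F) y) ('D_w F y))) x).
  apply: near_eq_derive; apply: filterS (isometric_at_near Fx) => y Fy.
  by rewrite (koszul_pullback Fy) hess.unlock push.unlock.
rewrite (deriveD (diff_derivable dk) (diff_derivable df)) ek ef.
by rewrite hess3.unlock hess.unlock push.unlock !addrA.
Qed.

(** Differentiate koszul_pullback: the third derivatives of F are symmetric in
    u and v and cancel, and so do the terms in which the ambient connection
    meets a second derivative of F. *)
Lemma gauss_second_order u v w z : curv4 G x u v w z =
  curv4 Gt (F x) (push F x u) (push F x v) (push F x w) (push F x z)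
  + form (Gt (F x)) (hess F x v w + levi_civita Gt (F x) (push F x v) (push F x w))
                    (hess F x u z + levi_civita Gt (F x) (push F x u) (push F x z))
  - form (Gt (F x)) (hess F x u w + levi_civita Gt (F x) (push F x u) (push F x w))
                    (hess F x v z + levi_civita Gt (F x) (push F x v) (push F x z))
  - form (G x) (levi_civita G x v w) (levi_civita G x u z)
  + form (G x) (levi_civita G x u w) (levi_civita G x v z).
Proof.
rewrite (curv4_koszul Gx) (curv4_koszul Tx) !derive_koszul_pullback.
rewrite (hess3C v u) (hessC Fx v u) !(derive_metric Tx).
rewrite -!(form_levi_civita Tx) !formDl !formDr.
by ring.
Qed.

Lemma second_ffE u v : second_ff G Gt F x u v =
  hess F x u v + levi_civita Gt (F x) (push F x u) (push F x v)
  - push F x (levi_civita G x u v).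
Proof.
rewrite /second_ff hess.unlock push.unlock levi_civita.unlock.
congr (_ - 'D__ F x).
have D0 (a b : 'rV[R]_n) y : 'D_a (fun=> b) y = 0 by exact: derive_cst.
by rewrite /nabla D0 add0r.
Qed.

Lemma form_push u v : form (Gt (F x)) (push F x u) (push F x v) = form (G x) u v.
Proof. by rewrite push.unlock; case: Fx => _ _ _ /nbhs_singleton. Qed.

(** By koszul_pullback, the ambient derivative of an image field has the image
    of the Levi-Civita derivative as its tangential part. *)
Lemma second_ff_normal u v w :
  form (Gt (F x)) (second_ff G Gt F x u v) (push F x w) = 0.
Proof.
rewrite second_ffE formDl formNl formDl form_push (form_levi_civita Gx).
by rewrite (koszul_pullback Fx) (form_levi_civita Tx); ring.
Qed.

Lemma second_ffC u v : second_ff G Gt F x u v = second_ff G Gt F x v u.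
Proof. by rewrite !second_ffE (hessC Fx) (levi_civitaC Tx) (levi_civitaC Gx). Qed.

Lemma second_ffP a u v v' : second_ff G Gt F x u (a *: v + v')
  = a *: second_ff G Gt F x u v + second_ff G Gt F x u v'.
Proof.
have pushP b c c' : push F x (b *: c + c') = b *: push F x c + push F x c'.
  by rewrite push.unlock; exact: derive_linear_dir.
have hessP c c' : hess F x u (a *: c + c') = a *: hess F x u c + hess F x u c'.
  rewrite !(hessC Fx u) hess.unlock; apply: derive_linear_dir; exact: dDF.
rewrite !second_ffE hessP pushP (levi_civitaP Tx) (levi_civitaP Gx) pushP.
by apply/rowP => k; rewrite !mxE; ring.
Qed.

(** In gauss_second_order, split each ambient derivative into its tangential
    part and the second fundamental form; the tangential parts cancel. *)
Theorem gauss_equation u v w z : curv4 G x u v w z =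
  curv4 Gt (F x) (push F x u) (push F x v) (push F x w) (push F x z)
  + form (Gt (F x)) (second_ff G Gt F x v w) (second_ff G Gt F x u z)
  - form (Gt (F x)) (second_ff G Gt F x u w) (second_ff G Gt F x v z).
Proof.
have e a b : hess F x a b + levi_civita Gt (F x) (push F x a) (push F x b)
    = second_ff G Gt F x a b + push F x (levi_civita G x a b).
  by rewrite second_ffE subrK.
have normal := second_ff_normal.
have normal' a b c : form (Gt (F x)) (push F x c) (second_ff G Gt F x a b) = 0.
  by rewrite (form_metricC Tx) normal.
move: (second_ff G Gt F x) e normal normal' => h e hn hn'.
rewrite gauss_second_order !e !formDl !formDr !hn !hn' !form_push.
by ring.
Qed.

End GaussEquation.

(** * Constant sectional curvature *)

(** Polarisation of D u v v u = 0 in v and then in u makes D alternating in its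
    first three arguments, so that the Bianchi sum is 3 D u v w z. *)
Lemma sectional_curvature_determines (R : realFieldType) (V : lmodType R)
    (D : V -> V -> V -> V -> R) :
  (forall u v w z, D u v w z = - D v u w z) ->
  (forall u v w z, D u v w z = - D u v z w) ->
  (forall u v w z, D u v w z = D w z u v) ->
  (forall u v w z, D u v w z + D v w u z + D w u v z = 0) ->
  (forall u v w z z', D u v w (z + z') = D u v w z + D u v w z') ->
  (forall u v, D u v v u = 0) ->
  forall u v w z, D u v w z = 0.
Proof.
move=> sk12 sk34 pair bianchi add4 sec.
have add3 u v w w' z : D u v (w + w') z = D u v w z + D u v w' z.
  by rewrite sk34 add4 opprD -!sk34.
have add2 u v v' w z : D u (v + v') w z = D u v w z + D u v' w z.
  by rewrite pair add4 !(pair w).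
have add1 u u' v w z : D (u + u') v w z = D u v w z + D u' v w z.
  by rewrite pair add3 !(pair w).
have polar u v w : D u v w u = 0.
  have := sec u (v + w); rewrite add2 !add3 !sec add0r addr0.
  have -> : D u w v u = D u v w u by rewrite pair sk12 sk34 opprK.
  by lra.
have polar2 u v w z : D u v w z = - D z v w u.
  by have := polar (u + z) v w; rewrite add1 !add4 !polar; lra.
have skew23 u v w z : D u v w z = - D u w v z.
  rewrite polar2; congr (- _); rewrite pair sk12 sk34 opprK; by [].
move=> u v w z; have := bianchi u v w z.
have -> : D v w u z = D u v w z by rewrite (skew23 v) -sk12.
have -> : D w u v z = D u v w z by rewrite (sk12 w) -skew23.
by lra.
Qed.

(** The hypothesis does not cover the pairs with a vanishing Gram determinant;
    these are linearly dependent, and curv4 G x u v v u vanishes on them by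
    antisymmetry. *)
Lemma constant_curvature_tensor (R : realType) n (G : 'rV[R]_n -> 'M[R]_n) x k :
  metric_at G x ->
  (forall u v,
    form (G x) u u * form (G x) v v - form (G x) u v ^+ 2 != 0 ->
    curv4 G x u v v u
      / (form (G x) u u * form (G x) v v - form (G x) u v ^+ 2) = k) ->
  forall u v w z, curv4 G x u v w z =
    k * (form (G x) v w * form (G x) u z - form (G x) u w * form (G x) v z).
Proof.
move=> Gx sec u v w z.
have gC := form_metricC Gx.
have lin4 a b c d e t : curv4 G x a b c (t *: d + e) = t * curv4 G x a b c d + curv4 G x a b c e.
  by rewrite /curv4 formDr formZr.
have sk12 := curv4_skew12 Gx; have sk34 := curv4_skew34 Gx.
have pair := curv4_pair Gx; have bianchi := curv4_bianchi Gx.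
have posG := metric_at_posdef Gx.
move: (curv4 G x) sec lin4 sk12 sk34 pair bianchi => K sec lin4 sk12 sk34 pair bianchi.
apply/eqP; rewrite -subr_eq0; apply/eqP.
move: u v w z; apply: (@sectional_curvature_determines _ _ (fun u v w z => K u v w z -
  k * (form (G x) v w * form (G x) u z - form (G x) u w * form (G x) v z))).
- by move=> u v w z /=; rewrite sk12; ring.
- by move=> u v w z /=; rewrite sk34; ring.
- move=> u v w z /=; rewrite pair (gC w v) (gC z u) (gC w u) (gC z v).
  by rewrite (mulrC (form (G x) u z)).
- move=> u v w z /=; rewrite (gC w v) (gC u w) (gC v u) -[RHS](bianchi u v w z).
  by ring.
- move=> u v w z z' /=; rewrite !formDr -[K u v w (z + z')]/(K u v w (z + z')).
  have := lin4 u v w z z' 1; rewrite scale1r mul1r => ->.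
  by ring.
move=> u v /=.
have [/eqP det0|det] := boolP (form (G x) u u * form (G x) v v - form (G x) u v ^+ 2 == 0).
  have [->|v0] := eqVneq v 0.
    rewrite !form0l !form0r; have := lin4 u 0 u 0 0 1.
    by rewrite scaler0 addr0 mul1r => h; rewrite sk34; lra.
  have vv : 0 < form (G x) v v by case: posG => _; exact.
  (* equality in the Cauchy-Schwarz inequality: u is a multiple of v *)
  pose t := form (G x) u v / form (G x) v v.
  have ut : u = t *: v.
    apply/eqP; rewrite -subr_eq0; apply/negPn/negP => h.
    have [_ /(_ _ h)] := posG; rewrite !(formDl, formDr, formNl, formNr, formZl, formZr).
    have uuE : form (G x) u u = form (G x) u v ^+ 2 / form (G x) v v.
      by apply: (mulIf (lt0r_neq0 vv)); rewrite divfK ?gt_eqF //; lra.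
    rewrite (gC v u) /t; set e := (X in 0 < X -> _).
    have -> : e = 0 by rewrite /e uuE; field; rewrite gt_eqF.
    by rewrite ltxx.
  have -> : K u v v u = 0.
    rewrite {2}ut.
    have := lin4 u v v v 0 t; rewrite addr0 => ->.
    have v3 : K u v v v = 0 by have := sk34 u v v v; lra.
    have z0 : K u v v 0 = 0.
      by have := lin4 u v v 0 0 1; rewrite scaler0 addr0 mul1r => h; lra.
    by rewrite v3 z0 mulr0 addr0.
  rewrite sub0r (gC v u) -[form (G x) u v * form (G x) u v]expr2.
  by rewrite [form (G x) v v * _]mulrC det0 mulr0 oppr0.
have := sec u v det => /(canRL (divfK det)) ->.
by rewrite (gC v u) [form (G x) v v * _]mulrC expr2 subrr.
Qed.

(** * Curvature tensors determined by a plane *)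

Definition frame_mx (R : realType) n k (E : 'I_k -> 'rV[R]_n) : 'M[R]_(k, n) :=
  \matrix_(i, j) E i 0 j.

Lemma row_frame_mx (R : realType) n k (E : 'I_k -> 'rV[R]_n) i : row i (frame_mx E) = E i.
Proof. by apply/rowP => j; rewrite !mxE. Qed.

Lemma orthonormal_frame_mx (R : realType) n k (G : 'M[R]_n) (E : 'I_k -> 'rV[R]_n) :
  orthonormal G E <-> frame_mx E *m G *m (frame_mx E)^T = 1%:M.
Proof.
have e i j : form G (E i) (E j) = (frame_mx E *m G *m (frame_mx E)^T) i j.
  rewrite /form -!row_frame_mx -row_mul tr_row mxE [RHS]mxE; apply: eq_bigr => k' _.
  by rewrite [row _ _ _ _]mxE [col _ _ _ _]mxE.
split=> [h|h i j]; last by rewrite e h mxE.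
by apply/matrixP => i j; rewrite -e h mxE.
Qed.

Lemma orthonormal_expansion (R : realType) n (G : 'M[R]_n) (E : 'I_n -> 'rV[R]_n) u :
  orthonormal G E -> u = \sum_i form G u (E i) *: E i.
Proof.
move=> /orthonormal_frame_mx; rewrite -mulmxA => /mulmx1C e.
rewrite -[LHS]mulmx1 -e mulmxA mulmx_sum_row; apply: eq_bigr => i _.
rewrite row_frame_mx; congr (_ *: _).
rewrite mulmxA /form mxE [RHS]mxE; apply: eq_bigr => k _; congr (_ * _).
by rewrite !mxE.
Qed.

Lemma mul_lin1_mx (R : realType) n d (f : 'rV[R]_n -> 'rV[R]_d) u :
  (forall a u v, f (a *: u + v) = a *: f u + f v) -> f u = u *m lin1_mx f.
Proof.
move=> fL; have f0 : f 0 = 0.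
  have := fL (-1) 0 0; rewrite scaler0 addr0 scaleN1r.
  by rewrite addNr.
have fD v w : f (v + w) = f v + f w by rewrite -{1}[v]scale1r fL scale1r.
rewrite {1}[u]row_sum_delta (big_morph f fD f0) mulmx_sum_row.
apply: eq_bigr => i _; rewrite -{1}[_ *: _]addr0 fL f0 addr0; congr (_ *: _).
by apply/rowP => j; rewrite !mxE.
Qed.

Lemma trace_orthonormal (R : realType) n (G : 'M[R]_n) (E : 'I_n -> 'rV[R]_n)
    (f : 'rV[R]_n -> 'rV[R]_n) :
  orthonormal G E -> (forall a u v, f (a *: u + v) = a *: f u + f v) ->
  \tr (lin1_mx f) = \sum_i form G (f (E i)) (E i).
Proof.
move=> oE fL; set M := lin1_mx f.
have fE u : f u = u *m M by exact: mul_lin1_mx.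
have := oE; move/orthonormal_frame_mx; rewrite -mulmxA => /mulmx1C e.
rewrite -[M in LHS]mulmx1 -e mulmxA mxtrace_mulC !mulmxA.
apply: eq_bigr => i _; rewrite fE.
rewrite /form -(row_frame_mx E i) -!row_mul tr_row mxE [RHS]mxE [RHS]mxE.
by apply: eq_bigr => k _; rewrite [col _ _ _ _]mxE.
Qed.

(** Curvature tensors K g^g + g^T + c P^P, where T is symmetric and trace-free
    and P is the orthogonal projection onto a plane. The Wintgen equality leads
    to tensors of this form. *)
Section ModelCurvature.
Variables (R : realType) (n : nat) (G : 'rV[R]_n -> 'M[R]_n) (x : 'rV[R]_n).
Hypotheses (n4 : (4 <= n)%N) (Gx : posdef (G x)).
Variables (E : 'I_n -> 'rV[R]_n) (T P : 'M[R]_n) (K c : R).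
Hypothesis oE : orthonormal (G x) E.

Local Notation g := (form (G x)).

Hypotheses (Tsym : forall u v, g (u *m T) v = g u (v *m T))
  (Psym : forall u v, g (u *m P) v = g u (v *m P))
  (PP : P *m P = P)
  (trT : \sum_i g (E i *m T) (E i) = 0) (trP : \sum_i g (E i *m P) (E i) = 2).

Hypothesis curvM : forall u v w, curv G x u v w =
  K *: wedge g u v w + (wedge g u (v *m T) w + wedge g (u *m T) v w)
  + c *: wedge g (u *m P) (v *m P) w.

Let gC u v : g u v = g v u.
Proof. by apply: formC; case: Gx. Qed.

Let sumE u v : \sum_i g u (E i) * g (E i) v = g u v.
Proof.
rewrite [in RHS](orthonormal_expansion u oE) form_suml.
by apply: eq_bigr => i _; rewrite formZl.
Qed.

Let sumEE : \sum_i g (E i) (E i) = n%:R.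
Proof.
rewrite (eq_bigr (fun=> 1)) ?sumr_const ?card_ord // => i _.
by rewrite oE eqxx.
Qed.

Let wedgeP u v w a u' : wedge g (a *: u + u') v w = a *: wedge g u v w + wedge g u' v w.
Proof.
rewrite /wedge formDl formZl; apply/rowP => k; rewrite !mxE; ring.
Qed.

Lemma model_ricci u v : ricci G x u v =
  g ((n%:R - 1) * K *: u + (n%:R - 2) *: (u *m T) + c *: (u *m P)) v.
Proof.
rewrite /ricci (trace_orthonormal oE); last first.
  move=> a z z'; rewrite !curvM !mulmxDl -!scalemxAl !wedgeP.
  by apply/rowP => k; rewrite !mxE; ring.
have expand i : g (curv G x (E i) u v) (E i) =
    K * g u v * g (E i) (E i) - K * (g u (E i) * g (E i) v)
    + g (u *m T) v * g (E i) (E i) - g (u *m T) (E i) * g (E i) v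
    + g u v * g (E i *m T) (E i) - g u (E i) * g (E i) (v *m T)
    + c * g (u *m P) v * g (E i *m P) (E i)
    - c * (g (u *m P) (E i) * g (E i) (v *m P)).
  rewrite curvM /wedge !(formDl, formZl, formNl).
  rewrite [g (E i *m T) v]Tsym [g (E i *m P) v]Psym.
  by ring.
rewrite (eq_bigr _ (fun i _ => expand i)) !(big_split, sumrN) /= -!mulr_sumr.
rewrite !sumE sumEE trT trP !formDl !formZl -(Tsym u v).
by rewrite -(Psym (u *m P) v) -mulmxA PP; ring.
Qed.

Lemma model_ricci_op u : ricci_op G x u =
  (n%:R - 1) * K *: u + (n%:R - 2) *: (u *m T) + c *: (u *m P).
Proof.
apply: (form_inj Gx) => w; rewrite /ricci_op form_sharp // ?model_ricci //.
by move=> a z z'; rewrite !model_ricci formDr formZr.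
Qed.

Lemma model_scalar : scalar_curv G x = n%:R * (n%:R - 1) * K + 2 * c.
Proof.
rewrite /scalar_curv (trace_orthonormal oE); last first.
  move=> a z z'; rewrite !model_ricci_op !mulmxDl -!scalemxAl.
  by apply/rowP => k; rewrite !mxE; ring.
under eq_bigr do rewrite model_ricci_op !formDl !formZl.
by rewrite !big_split /= -!mulr_sumr sumEE trT trP; ring.
Qed.

(** The Weyl tensor is blind to the summands K g^g and g^T, and the trace part of
    P^P is what the correction terms remove. *)
Lemma model_weyl u v w : weyl G x u v w = c *:
  (wedge g (u *m P) (v *m P) w
   - (n%:R - 2)^-1 *: (wedge g u (v *m P) w + wedge g (u *m P) v w)
   + (2 / ((n%:R - 2) * (n%:R - 1))) *: wedge g u v w).
Proof.
have n2 : n%:R - 2 != 0 :> R.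
  by rewrite subr_eq0 eqr_nat; apply: contraTneq n4 => ->.
have n1 : n%:R - 1 != 0 :> R.
  by rewrite subr_eq0 -[1]/(1%:R) eqr_nat; apply: contraTneq n4 => ->.
rewrite /weyl curvM !model_ricci_op model_scalar /wedge !(formDl, formZl).
by apply/rowP => k; rewrite !mxE; field; rewrite n2 n1.
Qed.


Let ev := (@formDl R n, @formZl R n, @formNl R n, @formDr R n, @formZr R n,
  @formNr R n, @form0l R n, @form0r R n).

Section Components.
Variables (i i' j l : 'I_n) (t s : R).
Hypotheses (ii' : i != i') (ij : i != j) (il : i != l) (i'j : i' != j)
  (i'l : i' != l) (jl : j != l).
Hypotheses (iT : E i *m T = t *: E i + s *: E i') (iP : E i *m P = E i).
Hypotheses (jT : E j *m T = 0) (jP : E j *m P = 0).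
Hypotheses (lT : E l *m T = 0) (lP : E l *m P = 0).

Let oo : (g (E i) (E i) = 1) * (g (E j) (E j) = 1) * (g (E l) (E l) = 1)
  * (g (E i) (E j) = 0) * (g (E j) (E i) = 0) * (g (E i) (E l) = 0)
  * (g (E l) (E i) = 0) * (g (E j) (E l) = 0) * (g (E l) (E j) = 0)
  * (g (E i') (E j) = 0) * (g (E i') (E l) = 0) * (g (E i') (E i) = 0)
  * (g (E i) (E i') = 0).
Proof.
rewrite !oE !eqxx (eq_sym j i) (eq_sym l i) (eq_sym l j) (eq_sym i' i).
by rewrite (negPf ii') (negPf ij) (negPf il) (negPf i'j) (negPf i'l) (negPf jl).
Qed.

Let w0 := c * (2 / ((n%:R - 2) * (n%:R - 1))).
Let w1 := c * (2 / ((n%:R - 2) * (n%:R - 1)) - (n%:R - 2)^-1).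

Let wedge_frame : (wedge g (E i) (E j) (E i) = - E j)
  * (wedge g (E i) (E j) (E j) = E i) * (wedge g (E i) (E j) (E l) = 0).
Proof. by rewrite /wedge !oo !scale0r !scale1r !subr0 !sub0r. Qed.

Let curv_frame : (curv G x (E i) (E j) (E i) = - (K + t) *: E j)
  * (curv G x (E i) (E j) (E j) = (K + t) *: E i + s *: E i')
  * (curv G x (E i) (E j) (E l) = 0) * (curv G x (E j) (E l) (E l) = K *: E j)
  * (curv G x (E i) (E l) (E l) = (K + t) *: E i + s *: E i').
Proof.
rewrite !curvM !(iT, iP, jT, jP, lT, lP) /wedge !ev !oo.
by do ![split]; apply/rowP => k; rewrite !mxE; ring.
Qed.

Let weyl_frame : (weyl G x (E i) (E j) (E i) = - w1 *: E j)
  * (weyl G x (E i) (E j) (E j) = w1 *: E i) * (weyl G x (E i) (E j) (E l) = 0)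
  * (weyl G x (E j) (E l) (E l) = w0 *: E j) * (weyl G x (E i) (E l) (E l) = w1 *: E i).
Proof.
rewrite !model_weyl !(iP, jP, lP) /wedge !ev !oo /w1 /w0.
by do ![split]; apply/rowP => k; rewrite !mxE; ring.
Qed.

Let curvP1 a u u' v w : curv G x (a *: u + u') v w = a *: curv G x u v w + curv G x u' v w.
Proof.
rewrite !curvM !mulmxDl -!scalemxAl !wedgeP.
by apply/rowP => k; rewrite !mxE; ring.
Qed.

Let weylP1 a u u' v w : weyl G x (a *: u + u') v w = a *: weyl G x u v w + weyl G x u' v w.
Proof.
rewrite !model_weyl !mulmxDl -!scalemxAl !wedgeP.
by apply/rowP => k; rewrite !mxE; ring.
Qed.

Let curv4Z1 a u v w z : curv4 G x (a *: u) v w z = a * curv4 G x u v w z.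
Proof.
rewrite /curv4 -[a *: u]addr0 curvP1 formDl formZl.
suff -> : curv G x 0 v w = 0 by rewrite form0l addr0.
have := curvP1 (-1) 0 0 v w; rewrite scaler0 addr0 scaleN1r.
by rewrite addNr.
Qed.

Let weyl4Z1 a u v w z : weyl4 G x (a *: u) v w z = a * weyl4 G x u v w z.
Proof.
rewrite /weyl4 -[a *: u]addr0 weylP1 formDl formZl.
suff -> : weyl G x 0 v w = 0 by rewrite form0l addr0.
have := weylP1 (-1) 0 0 v w; rewrite scaler0 addr0 scaleN1r.
by rewrite addNr.
Qed.

Let curv4_mid : (curv4 G x (E i) 0 (E l) (E j) = 0) * (curv4 G x (E i) (E l) 0 (E j) = 0).
Proof.
by rewrite /curv4 !curvM !(iT, iP, lT, lP, mul0mx) /wedge !ev !oo;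
  split; ring.
Qed.

Let weyl4_mid : (weyl4 G x (E i) 0 (E l) (E j) = 0) * (weyl4 G x (E i) (E l) 0 (E j) = 0).
Proof.
by rewrite /weyl4 !model_weyl !(iP, lP, mul0mx) /wedge !ev !oo; split; ring.
Qed.

(** Here E i belongs to the plane and E j, E l are orthogonal to it; T enters
    through its diagonal entry t at E i alone. *)
Lemma component_RC_CR :
  act4 (curv G x) (weyl4 G x) (E i) (E l) (E l) (E j) (E i) (E j)
  - act4 (weyl G x) (curv4 G x) (E i) (E l) (E l) (E j) (E i) (E j)
  = (K + t) * (w0 - w1) - w1 * - t.
Proof.
rewrite /act4 !(curv_frame, weyl_frame) !(curv4_mid, weyl4_mid) curv4Z1 weyl4Z1.
rewrite /curv4 /weyl4 !(curv_frame, weyl_frame) !ev !oo.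
by ring.
Qed.

Lemma component_QgR :
  act4 (wedge g) (curv4 G x) (E i) (E l) (E l) (E j) (E i) (E j) = - t.
Proof.
rewrite /act4 !wedge_frame !curv4_mid -[- E j]scaleN1r curv4Z1.
rewrite /curv4 !curv_frame !ev !oo.
by ring.
Qed.

End Components.

(** Here E i and E i' span the plane. *)
Lemma component_QgR_plane (i i' j : 'I_n) (t t' s : R) :
  i != i' -> i != j -> i' != j ->
  E i *m T = t *: E i + s *: E i' -> E i *m P = E i ->
  E i' *m T = t' *: E i' + s *: E i -> E i' *m P = E i' ->
  E j *m T = 0 -> E j *m P = 0 ->
  act4 (wedge g) (curv4 G x) (E i) (E i') (E i') (E j) (E i) (E j) = - t - c.
Proof.
move=> ii' ij i'j iT iP i'T i'P jT jP.
have oo : (g (E i) (E i) = 1) * (g (E j) (E j) = 1) * (g (E i') (E i') = 1)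
  * (g (E i) (E j) = 0) * (g (E j) (E i) = 0) * (g (E i') (E j) = 0)
  * (g (E j) (E i') = 0) * (g (E i') (E i) = 0) * (g (E i) (E i') = 0).
  rewrite !oE !eqxx (eq_sym j i) (eq_sym j i') (eq_sym i' i).
  by rewrite (negPf ii') (negPf ij) (negPf i'j).
have wf : (wedge g (E i) (E j) (E i) = - E j)
  * (wedge g (E i) (E j) (E j) = E i) * (wedge g (E i) (E j) (E i') = 0).
  by rewrite /wedge !oo !scale0r !scale1r !subr0 !sub0r.
rewrite /act4 !wf /curv4 !curvM !(mulNmx, mul0mx, iT, iP, i'T, i'P, jT, jP).
by rewrite /wedge !ev !oo; ring.
Qed.

(** The components of component_RC_CR for E p and E q have opposite entries of T
    and add up to 2 K c / (n - 2). If the coefficient of R.C - C.R is zero, then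
    Q(g, R) = 0, and the two components of component_QgR_plane add up to
    -2 c. *)
Lemma model_dependence (p q j l : 'I_n) (t s : R) : 0 < K ->
  p != q -> p != j -> p != l -> q != j -> q != l -> j != l ->
  E p *m T = t *: E p + s *: E q -> E q *m T = - t *: E q + s *: E p ->
  E p *m P = E p -> E q *m P = E q ->
  E j *m T = 0 -> E j *m P = 0 -> E l *m T = 0 -> E l *m P = 0 ->
  lin_dep6
    (fun X1 X2 X3 X4 X Y =>
       act4 (curv G x) (weyl4 G x) X1 X2 X3 X4 X Y
       - act4 (weyl G x) (curv4 G x) X1 X2 X3 X4 X Y)
    (act4 (wedge g) (curv4 G x)) -> c = 0.
Proof.
move=> K0 pq pj pl qj ql jl pT qT pP qP jT jP lT lP [a [b [ab dep]]].
have qp : q != p by rewrite eq_sym.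
have d1 := dep (E p) (E l) (E l) (E j) (E p) (E j).
rewrite (component_RC_CR pq pj pl qj ql jl pT pP jT jP lT lP) in d1.
rewrite (component_QgR pq pj pl qj ql jl pT pP jT jP lT lP) in d1.
have d2 := dep (E q) (E l) (E l) (E j) (E q) (E j).
rewrite (component_RC_CR qp qj ql pj pl jl qT qP jT jP lT lP) in d2.
rewrite (component_QgR qp qj ql pj pl jl qT qP jT jP lT lP) in d2.
have [a0|a0] := eqVneq a 0.
  have b0 : b != 0 by move: ab; rewrite a0; apply: contraNneq => ->.
  have e1 := dep (E p) (E q) (E q) (E j) (E p) (E j).
  rewrite a0 mul0r add0r (component_QgR_plane pq pj qj pT pP qT qP jT jP) in e1.
  have e2 := dep (E q) (E p) (E p) (E j) (E q) (E j).
  rewrite a0 mul0r add0r (component_QgR_plane qp qj pj qT qP pT pP jT jP) in e2.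
  have /eqP : b * (c * 2) = 0 by lra.
  by rewrite !mulf_eq0 (negPf b0) pnatr_eq0 orbF => /eqP.
have n2 : n%:R - 2 != 0 :> R.
  by rewrite subr_eq0 eqr_nat; apply: contraTneq n4 => ->.
have /eqP : a * (K * 2 * (c / (n%:R - 2))) = 0.
  rewrite -[RHS](addr0 0) -{1}d1 -d2; ring.
by rewrite !mulf_eq0 (negPf a0) (gt_eqF K0) pnatr_eq0 invr_eq0 (negPf n2) !orbF => /eqP.
Qed.

End ModelCurvature.

(** * Frames and shape operators *)

Lemma frame_mx_row (R : realType) k n (M : 'M[R]_(k, n)) :
  frame_mx (fun i => row i M) = M.
Proof. by apply/matrixP => i j; rewrite !mxE. Qed.

Lemma tangent_frame_exists (R : realType) n (G : 'M[R]_n) : posdef G ->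
  exists E : 'I_n -> 'rV[R]_n, orthonormal G E.
Proof.
move=> [Gs Gp]; have [M MM] := posdef_orthonormal_basis Gs Gp.
by exists (fun i => row i M); apply/orthonormal_frame_mx; rewrite frame_mx_row.
Qed.

Lemma normal_frame_exists (R : realType) n m (G : 'M[R]_(n + m))
    (f : 'rV[R]_n -> 'rV[R]_(n + m)) : posdef G ->
  (forall a u v, f (a *: u + v) = a *: f u + f v) ->
  exists xi : 'I_m -> 'rV[R]_(n + m), orthonormal G xi /\
    forall a u, form G (xi a) (f u) = 0.
Proof.
move=> [Gs Gp] fL; pose J : 'M[R]_(n, n + m) := lin1_mx f.
have fE u : f u = u *m J by exact: mul_lin1_mx.
have [X [XX XJ]] := @orthonormal_complement R n m G J Gs Gp.
exists (fun a => row a X); split.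
  by apply/orthonormal_frame_mx; rewrite frame_mx_row.
move=> a u; rewrite fE /form trmx_mul mulmxA -!row_mul XJ.
by rewrite mul0mx !mxE.
Qed.

(** The two orthonormal families together are an orthonormal basis of the
    ambient space. *)
Lemma normal_expansion (R : realType) n m (G : 'M[R]_(n + m))
    (e : 'I_n -> 'rV[R]_(n + m)) (xi : 'I_m -> 'rV[R]_(n + m)) nu :
  orthonormal G e -> orthonormal G xi ->
  (forall a i, form G (xi a) (e i) = 0) -> (forall a i, form G (e i) (xi a) = 0) ->
  (forall i, form G nu (e i) = 0) ->
  nu = \sum_a form G nu (xi a) *: xi a.
Proof.
move=> oe oxi xe ex nue.
pose E (k : 'I_(n + m)) := match fintype.split k with inl i => e i | inr a => xi a end.
have oE : orthonormal G E.
  move=> k k'; rewrite /E; case: (splitP k) => i ki; case: (splitP k') => i' k'i'.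
  - by rewrite oe; congr (nat_of_bool _)%:R; rewrite -!val_eqE /= ki k'i'.
  - rewrite ex -val_eqE /= ki k'i' ltn_eqF //.
    by apply: leq_trans (ltn_ord i) _; exact: leq_addr.
  - rewrite xe -val_eqE /= ki k'i' gtn_eqF //.
    by apply: leq_trans (ltn_ord i') _; exact: leq_addr.
  - by rewrite oxi; congr (nat_of_bool _)%:R; rewrite -!val_eqE /= ki k'i' eqn_add2l.
rewrite [LHS](orthonormal_expansion nu oE) big_split_ord /= big1 ?add0r => [|i _].
  by apply: eq_bigr => a _; rewrite /E (unsplitK (inr a)).
by rewrite /E (unsplitK (inl i)) nue scale0r.
Qed.

Lemma sum_sym_lt (R : realType) n (f : 'I_n -> 'I_n -> R) :
  (forall i j, f i j = f j i) -> (forall i, f i i = 0) ->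
  \sum_i \sum_j f i j = 2 * \sum_(i < n) \sum_(j < n | (i < j)%N) f i j.
Proof.
move=> fC f0.
have -> : \sum_i \sum_j f i j = \sum_(i < n) \sum_(j < n | (i < j)%N) f i j
    + \sum_(i < n) \sum_(j < n | (j < i)%N) f i j.
  rewrite -big_split; apply: eq_bigr => i _ /=.
  rewrite (bigID (fun j : 'I_n => (i < j)%N)) /=; congr (_ + _).
  rewrite (bigD1 i) ?ltnn //= f0 add0r; apply: eq_bigl => j.
  by rewrite -leqNgt [RHS]ltn_neqAle andbC.
rewrite mulr_natl mulr2n; congr (_ + _).
rewrite (exchange_big_dep xpredT) //=; apply: eq_bigr => i _.
by apply: eq_bigr => j _; exact: fC.
Qed.

(** The second fundamental form in the direction nu, that is, the bilinear form
    of the shape operator of nu. *)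
HB.lock Definition shape_form (R : realType) n d (G : 'rV[R]_n -> 'M[R]_n)
    (Gt : 'rV[R]_d -> 'M[R]_d) (F : 'rV[R]_n -> 'rV[R]_d) x (nu : 'rV[R]_d)
    (u v : 'rV[R]_n) : R :=
  form (Gt (F x)) (second_ff G Gt F x u v) nu.

Section ShapeForms.
Variables (R : realType) (n m : nat) (G : 'rV[R]_n -> 'M[R]_n)
  (Gt : 'rV[R]_(n + m) -> 'M[R]_(n + m)) (F : 'rV[R]_n -> 'rV[R]_(n + m))
  (x : 'rV[R]_n).
Hypothesis Fx : isometric_at G Gt F x.
Variables (E : 'I_n -> 'rV[R]_n) (xi : 'I_m -> 'rV[R]_(n + m)).
Hypotheses (oE : tangent_frame G x E) (oxi : normal_frame Gt F x xi).

Let Gx : metric_at G x. Proof. by case: Fx. Qed.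
Let Tx : metric_at Gt (F x). Proof. by case: Fx. Qed.
Local Notation g := (form (G x)).
Local Notation gt := (form (Gt (F x))).
Local Notation A a := (shape_form G Gt F x (xi a)).

Lemma second_ff_expansion u v : second_ff G Gt F x u v = \sum_a A a u v *: xi a.
Proof.
have nE := second_ff_normal Fx u v.
rewrite shape_form.unlock; move: (second_ff G Gt F x u v) nE => nu nE.
have [xi1 xi2] := oxi.
have pushE i : push F x (E i) = 'D_(E i) F x by rewrite push.unlock.
apply: (@normal_expansion _ n m (Gt (F x)) (fun i => push F x (E i)) xi) => //.
- by move=> i j; rewrite (form_push Fx) oE.
- by move=> a i; rewrite pushE.
- by move=> a i; rewrite (form_metricC Tx) pushE.
Qed.

Lemma form_second_ff u v w z :
  gt (second_ff G Gt F x u v) (second_ff G Gt F x w z) = \sum_a A a u v * A a w z.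
Proof.
rewrite (second_ff_expansion u v) form_suml; apply: eq_bigr => a _.
by rewrite formZl (form_metricC Tx) shape_form.unlock.
Qed.

Lemma shape_formC nu u v :
  shape_form G Gt F x nu u v = shape_form G Gt F x nu v u.
Proof. by rewrite shape_form.unlock (second_ffC Fx). Qed.

Lemma shape_formPr nu a u v v' : shape_form G Gt F x nu u (a *: v + v') =
  a * shape_form G Gt F x nu u v + shape_form G Gt F x nu u v'.
Proof. by rewrite shape_form.unlock (second_ffP Fx) formDl formZl. Qed.

Lemma shape_form_sumr nu (I : finType) u (c : I -> R) (v : I -> 'rV[R]_n) :
  shape_form G Gt F x nu u (\sum_i c i *: v i)
  = \sum_i c i * shape_form G Gt F x nu u (v i).
Proof.
have s0 : shape_form G Gt F x nu u 0 = 0.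
  have := shape_formPr nu (-1) u 0 0; rewrite scaler0 addr0 mulN1r.
  by rewrite addNr.
have sD v1 v2 : shape_form G Gt F x nu u (v1 + v2)
    = shape_form G Gt F x nu u v1 + shape_form G Gt F x nu u v2.
  by rewrite -{1}[v1]scale1r shape_formPr mul1r.
rewrite (big_morph _ sD s0); apply: eq_bigr => i _.
by rewrite -[_ *: _]addr0 shape_formPr s0 addr0.
Qed.

Lemma shape_form_coord nu u v : shape_form G Gt F x nu u v
  = \sum_i \sum_j g u (E i) * g v (E j) * shape_form G Gt F x nu (E i) (E j).
Proof.
rewrite {1}(orthonormal_expansion u oE) {1}(orthonormal_expansion v oE).
rewrite shape_formC shape_form_sumr; apply: eq_bigr => i _.
rewrite shape_formC shape_form_sumr mulr_sumr; apply: eq_bigr => j _.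
by rewrite mulrA.
Qed.

Lemma form_shape_op nu u w :
  g (shape_op G Gt F x nu u) w = shape_form G Gt F x nu u w.
Proof.
have e : (fun v => gt nu (second_ff G Gt F x u v)) = shape_form G Gt F x nu u.
  by apply/funext => v; rewrite shape_form.unlock (form_metricC Tx).
rewrite /shape_op e (form_sharp _ (metric_at_posdef Gx)) // => a v v'.
exact: shape_formPr.
Qed.

Definition shape_mx a : 'M[R]_n := \matrix_(i, j) A a (E i) (E j).

Lemma shape_mx_sym a : (shape_mx a)^T = shape_mx a.
Proof. by apply/matrixP => i j; rewrite !mxE shape_formC. Qed.

Lemma normal_curv_shape_mx i j a b :
  normal_curv G Gt F x (E i) (E j) (xi a) (xi b)
  = commmx (shape_mx b) (shape_mx a) i j.
Proof.
have half c e : g (shape_op G Gt F x (xi c) (shape_op G Gt F x (xi e) (E i))) (E j)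
    = (shape_mx e *m shape_mx c) i j.
  rewrite form_shape_op shape_formC.
  rewrite {1}(orthonormal_expansion (shape_op G Gt F x (xi e) (E i)) oE).
  rewrite shape_form_sumr mxE; apply: eq_bigr => l _.
  rewrite form_shape_op [shape_mx e i l]mxE [shape_mx c l j]mxE; congr (_ * _).
  exact: shape_formC.
rewrite /normal_curv; move: (shape_op G Gt F x) half => S half /=.
by rewrite formDl formNl !half /commmx [RHS]mxE [X in _ = _ + X]mxE.
Qed.

Lemma mean_curv_shape_mx : mean_curv G Gt F x E ^+ 2 = \sum_a (\tr (shape_mx a) / n%:R) ^+ 2.
Proof.
have trE a : \tr (shape_mx a) = \sum_i A a (E i) (E i).
  by apply: eq_bigr => i _; rewrite mxE.
have posT := metric_at_posdef Tx.
have form_ge0 v : 0 <= gt v v.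
  have [->|v0] := eqVneq v 0; first by rewrite form0l.
  by case: posT => _ /(_ _ v0)/ltW.
rewrite /mean_curv sqr_sqrtr // /mean_curv_vec formZl formZr form_suml.
under eq_bigr do rewrite form_sumr.
under eq_bigr => i _ do under eq_bigr => j _ do rewrite form_second_ff.
under [RHS]eq_bigr do rewrite trE.
transitivity (\sum_a n%:R^-1 * (n%:R^-1 * (\sum_i \sum_j A a (E i) (E i) * A a (E j) (E j)))).
  rewrite -!mulr_sumr; congr (_ * (_ * _)).
  rewrite exchange_big /=; under eq_bigr do rewrite exchange_big /=.
  by rewrite exchange_big /=; apply: eq_bigr => a _; rewrite exchange_big.
apply: eq_bigr => a _.
under eq_bigr do rewrite -mulr_sumr.
by rewrite -mulr_suml; ring.
Qed.

Lemma commmx_scalar_shift (S S' : 'M[R]_n) s s' :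
  commmx (S - s%:M) (S' - s'%:M) = commmx S S'.
Proof.
rewrite /commmx !mulmxBl !mulmxBr !mul_scalar_mx !mul_mx_scalar.
by apply/matrixP => i j; rewrite !mxE; ring.
Qed.

Lemma sum_normal_curv : 4 * (\sum_(i < n) \sum_(j < n | (i < j)%N)
    \sum_(a < m) \sum_(b < m | (a < b)%N)
      normal_curv G Gt F x (E i) (E j) (xi a) (xi b) ^+ 2)
  = \sum_a \sum_b frob (commmx (shape_mx a) (shape_mx b))
                       (commmx (shape_mx a) (shape_mx b)).
Proof.
pose f i j a b := commmx (shape_mx b) (shape_mx a) i j ^+ 2.
have fab i j a b : f i j a b = f i j b a.
  by rewrite /f /commmx -[_ - _ in LHS]opprB mxE sqrrN.
have faa i j a : f i j a a = 0 by rewrite /f /commmx subrr mxE expr0n.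
have fij i j a b : f i j a b = f j i a b.
  rewrite fab /f; congr (_ ^+ 2).
  have -> : commmx (shape_mx b) (shape_mx a) = (commmx (shape_mx a) (shape_mx b))^T.
    by rewrite /commmx linearB /= !trmx_mul !shape_mx_sym.
  by rewrite [RHS]mxE.
have fii i a b : f i i a b = 0.
  apply/eqP; rewrite /f sqrf_eq0.
  have e : commmx (shape_mx b) (shape_mx a) i i = - commmx (shape_mx b) (shape_mx a) i i.
    have {2}-> : commmx (shape_mx b) (shape_mx a) = - (commmx (shape_mx b) (shape_mx a))^T.
      by rewrite /commmx linearB /= !trmx_mul !shape_mx_sym opprB.
    by rewrite !mxE opprK.
  by apply/eqP; lra.
transitivity (\sum_i \sum_j \sum_a \sum_b f i j a b); last first.
  under [RHS]eq_bigr do under eq_bigr do rewrite frobE.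
  rewrite [LHS](eq_bigr (fun i => \sum_a \sum_j \sum_b f i j a b)); last first.
    by move=> i _; rewrite exchange_big.
  rewrite exchange_big; apply: eq_bigr => a _ /=.
  rewrite [LHS](eq_bigr (fun i => \sum_b \sum_j f i j a b)); last first.
    by move=> i _; rewrite exchange_big.
  rewrite exchange_big; apply: eq_bigr => b _ /=.
  by apply: eq_bigr => i _; apply: eq_bigr => j _; rewrite fab /f expr2.
rewrite sum_sym_lt => [|i j|i]; last 2 first.
- by apply: eq_bigr => a _; apply: eq_bigr => b _.
- by rewrite big1 // => a _; rewrite big1.
have -> : 4 = 2 * 2 :> R by rewrite -natrM.
rewrite -mulrA; congr (_ * _).
rewrite mulr_sumr; apply: eq_bigr => i _; rewrite mulr_sumr; apply: eq_bigr => j _.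
rewrite (sum_sym_lt (fab i j) (faa i j)); congr (_ * _).
by apply: eq_bigr => a _; apply: eq_bigr => b _; rewrite normal_curv_shape_mx.
Qed.

Variable k : R.
Hypothesis n4 : (4 <= n)%N.
Hypothesis ambient : forall u v w z, curv4 Gt (F x) u v w z =
  k * (gt v w * gt u z - gt u w * gt v z).

Lemma curv4_shape_form u v w z : curv4 G x u v w z =
  k * (g v w * g u z - g u w * g v z)
  + \sum_a (A a v w * A a u z - A a u w * A a v z).
Proof.
have := gauss_equation Fx u v w z; rewrite ambient.
move: (form_second_ff v w u z) (form_second_ff u w v z).
move: (second_ff G Gt F x) => h e1 e2 ->.
by rewrite e1 e2 !(form_push Fx) sumrB; ring.
Qed.

(** The component of the mean curvature vector along xi a. *)
Definition principal_mean a : R := \tr (shape_mx a) / n%:R.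
Definition traceless_shape_mx a : 'M[R]_n := shape_mx a - (principal_mean a)%:M.

Let n0 : n%:R != 0 :> R.
Proof. by rewrite pnatr_eq0; apply: contraTneq n4 => ->. Qed.

Let n1 : n%:R - 1 != 0 :> R.
Proof. by rewrite subr_eq0 -[1]/(1%:R) eqr_nat; apply: contraTneq n4 => ->. Qed.

Lemma frob_traceless a : frob (traceless_shape_mx a) (traceless_shape_mx a)
  = frob (shape_mx a) (shape_mx a) - n%:R * principal_mean a ^+ 2.
Proof.
rewrite /traceless_shape_mx; set S := shape_mx a; set s := principal_mean a.
have trS : \tr S = n%:R * s by rewrite /s /principal_mean mulrC divfK.
have fs X : frob s%:M X = s * \tr X.
  by rewrite /frob mul_scalar_mx linearZ /= mxtrace_tr.
rewrite frobBl [frob S _]frobC frobBl !fs linearB /= mxtrace_scalar trS -(mulr_natl s).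
by ring.
Qed.

Lemma norm_scalar_curv_shape : norm_scalar_curv G x E =
  k + \sum_a principal_mean a ^+ 2
  - (\sum_a frob (traceless_shape_mx a) (traceless_shape_mx a)) / (n%:R * (n%:R - 1)).
Proof.
pose f i j := curv4 G x (E i) (E j) (E j) (E i).
have fC i j : f i j = f j i by rewrite /f (curv4_pair Gx).
have f0 i : f i i = 0 by have := curv4_skew12 Gx (E i) (E i) (E i) (E i); rewrite /f; lra.
have tot : \sum_i \sum_j f i j = k * (n%:R * (n%:R - 1))
    + \sum_a ((n%:R * principal_mean a) ^+ 2 - frob (shape_mx a) (shape_mx a)).
  have fE i j : f i j = k - k * (i == j)%:R
      + \sum_a (shape_mx a i i * shape_mx a j j - shape_mx a i j * shape_mx a i j).
    rewrite /f curv4_shape_form !oE !eqxx (eq_sym j i); congr (_ + _).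
      by case: (i == j); rewrite ?mulr1n ?mulr0n; ring.
    apply: eq_bigr => a _; rewrite !mxE [X in _ - _ * X](shape_formC (xi a)).
    by rewrite [X in X - _]mulrC.
  under eq_bigr do under eq_bigr do rewrite fE.
  under eq_bigr do rewrite big_split /= sumrB sumr_const card_ord -mulr_sumr.
  rewrite big_split /= sumrB sumr_const card_ord -mulr_sumr; congr (_ + _).
    rewrite (eq_bigr (fun=> 1)) => [|i _].
      by rewrite sumr_const card_ord -mulrnA -(mulr_natr k) natrM; ring.
    by rewrite (bigD1 i) //= eqxx big1 ?addr0 // => j /negPf; rewrite eq_sym => ->.
  under eq_bigr do rewrite exchange_big /=.
  rewrite exchange_big /=; apply: eq_bigr => a _.
  under eq_bigr do rewrite sumrB.
  rewrite sumrB frobE; congr (_ - _).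
  under eq_bigr do rewrite -mulr_sumr.
  have -> : n%:R * principal_mean a = \tr (shape_mx a).
    by rewrite /principal_mean mulrC divfK.
  by rewrite -mulr_suml expr2.
have -> : norm_scalar_curv G x E = (\sum_i \sum_j f i j) / (n%:R * (n%:R - 1)).
  by rewrite (sum_sym_lt fC f0) /norm_scalar_curv mulrAC.
have e1 : \sum_a frob (traceless_shape_mx a) (traceless_shape_mx a)
    = \sum_a frob (shape_mx a) (shape_mx a) - n%:R * \sum_a principal_mean a ^+ 2.
  by rewrite (eq_bigr _ (fun a _ => frob_traceless a)) sumrB mulr_sumr.
have e2 : \sum_a ((n%:R * principal_mean a) ^+ 2 - frob (shape_mx a) (shape_mx a))
    = n%:R ^+ 2 * (\sum_a principal_mean a ^+ 2) - \sum_a frob (shape_mx a) (shape_mx a).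
  by rewrite sumrB mulr_sumr; congr (_ - _); apply: eq_bigr => a _; rewrite exprMn.
by rewrite tot e1 e2; field; rewrite n0 n1.
Qed.

Hypothesis wintgen : norm_scalar_curv G x E
  = mean_curv G Gt F x E ^+ 2 - norm_normal_curv G Gt F x E xi + k.

(** The Gauss equation gives rho = k + H^2 - sum_a |B_a|^2 / (n (n - 1)). The
    Wintgen equality thus reads sum_a |B_a|^2 = 2 sqrt S, where 4 S is the sum
    of all |[B_a, B_b]|^2. *)
Lemma wintgen_ddvv_equality :
  \sum_a \sum_b frob (commmx (traceless_shape_mx a) (traceless_shape_mx b))
                     (commmx (traceless_shape_mx a) (traceless_shape_mx b))
  = (\sum_a frob (traceless_shape_mx a) (traceless_shape_mx a)) ^+ 2.
Proof.
under eq_bigr do under eq_bigr do rewrite /traceless_shape_mx commmx_scalar_shift.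
rewrite -sum_normal_curv.
have := wintgen; rewrite norm_scalar_curv_shape mean_curv_shape_mx /norm_normal_curv.
set S := \sum_(i < n) _; set Q := \sum_a frob (traceless_shape_mx a) _; set L := \sum_a _ => e.
have S0 : 0 <= S.
  apply: sumr_ge0 => i _; apply: sumr_ge0 => j _; apply: sumr_ge0 => a _.
  by apply: sumr_ge0 => b _; exact: sqr_ge0.
have -> : Q = 2 * Num.sqrt S.
  have N0 : n%:R * (n%:R - 1) != 0 :> R by rewrite mulf_neq0.
  have : Q / (n%:R * (n%:R - 1)) = 2 / (n%:R * (n%:R - 1)) * Num.sqrt S by lra.
  by rewrite mulrAC => /(mulIf (invr_neq0 N0)).
by rewrite exprMn sqr_sqrtr // -natrX.
Qed.

End ShapeForms.

(** * Points of a Wintgen ideal submanifold *)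

(** The matrix of u |-> g(u, e) f. *)
Definition rank1mx (R : realType) n (G : 'M[R]_n) (e f : 'rV[R]_n) : 'M[R]_n :=
  G *m e^T *m f.

Lemma mul_rank1mx (R : realType) n (G : 'M[R]_n) (e f u : 'rV[R]_n) :
  u *m rank1mx G e f = form G u e *: f.
Proof.
by rewrite /rank1mx !mulmxA [u *m G *m e^T]mx11_scalar mul_scalar_mx.
Qed.

Lemma sum_two_points (R : nmodType) (I : finType) (p q : I) (F : I -> R) : p != q ->
  (forall i, i != p -> i != q -> F i = 0) -> \sum_i F i = F p + F q.
Proof.
move=> pq F0; rewrite (bigD1 p) //= (bigD1 q) 1?eq_sym //= big1 ?addr0 // => i.
by move=> /andP[ip iq]; exact: F0.
Qed.

Section PlanarShape.
Variables (R : realType) (n m : nat) (G : 'rV[R]_n -> 'M[R]_n)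
  (Gt : 'rV[R]_(n + m) -> 'M[R]_(n + m)) (F : 'rV[R]_n -> 'rV[R]_(n + m))
  (x : 'rV[R]_n).
Hypothesis Fx : isometric_at G Gt F x.
Variables (xi : 'I_m -> 'rV[R]_(n + m)).

Let Gx : metric_at G x. Proof. by case: Fx. Qed.
Local Notation g := (form (G x)).
Local Notation A a := (shape_form G Gt F x (xi a)).

Lemma rotate_frame (E : 'I_n -> 'rV[R]_n) (Q : 'M[R]_n) :
  orthonormal (G x) E -> Q *m Q^T = 1%:M ->
  exists E' : 'I_n -> 'rV[R]_n, orthonormal (G x) E' /\
    forall a, shape_mx G Gt F x E' xi a = Q *m shape_mx G Gt F x E xi a *m Q^T.
Proof.
move=> oE QQ; exists (fun i => \sum_j Q i j *: E j); split.
  apply/orthonormal_frame_mx.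
  have -> : frame_mx (fun i => \sum_j Q i j *: E j) = Q *m frame_mx E.
    apply/matrixP => i j; rewrite !mxE summxE; apply: eq_bigr => k _.
    by rewrite !mxE.
  move/orthonormal_frame_mx: oE => oE.
  transitivity (Q *m (frame_mx E *m G x *m (frame_mx E)^T) *m Q^T).
    by rewrite trmx_mul !mulmxA.
  by rewrite oE mulmx1.
move=> a; apply/matrixP => i j; rewrite mxE.
rewrite (shape_form_sumr Fx) mxE; apply: eq_bigr => l _.
rewrite (shape_formC Fx) (shape_form_sumr Fx) mxE [Q^T _ _]mxE mulrC; congr (_ * _).
by apply: eq_bigr => k _; rewrite mxE (shape_formC Fx).
Qed.

Variable E : 'I_n -> 'rV[R]_n.
Hypothesis oE : orthonormal (G x) E.
Variables (p q : 'I_n) (lam b s : 'I_m -> R).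
Hypothesis pq : p != q.
Hypothesis shapeE : forall a u v, A a u v = lam a * g u v
  + b a * (g u (E p) * g v (E p) - g u (E q) * g v (E q))
  + s a * (g u (E p) * g v (E q) + g u (E q) * g v (E p)).
Variable k : R.
Hypothesis ambient : forall u v w z, curv4 Gt (F x) u v w z =
  k * (form (Gt (F x)) v w * form (Gt (F x)) u z
       - form (Gt (F x)) u w * form (Gt (F x)) v z).
Variable oxi : normal_frame Gt F x xi.

Let op i j := rank1mx (G x) (E i) (E j).
Let t := \sum_a lam a * b a.
Let r := \sum_a lam a * s a.
Let T := t *: (op p p - op q q) + r *: (op p q + op q p).
Let P := op p p + op q q.
Let K := k + \sum_a lam a ^+ 2.
Let c := - \sum_a (b a ^+ 2 + s a ^+ 2).

Let mulT u : u *m T = t *: (g u (E p) *: E p - g u (E q) *: E q)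
  + r *: (g u (E p) *: E q + g u (E q) *: E p).
Proof. by rewrite /T /op mulmxDr -!scalemxAr mulmxBr mulmxDr !mul_rank1mx. Qed.

Let mulP u : u *m P = g u (E p) *: E p + g u (E q) *: E q.
Proof. by rewrite /P /op mulmxDr !mul_rank1mx. Qed.

Let gC u v : g u v = g v u. Proof. exact: (form_metricC Gx). Qed.

Let ev := (@formDl R n, @formZl R n, @formNl R n, @formDr R n, @formZr R n,
  @formNr R n, @form0l R n, @form0r R n).

Let oo : (g (E p) (E p) = 1) * (g (E q) (E q) = 1) * (g (E p) (E q) = 0)
  * (g (E q) (E p) = 0).
Proof. by rewrite !oE !eqxx [q == p]eq_sym (negPf pq). Qed.

(** In the Gauss equation, the products of means give K, the products of a mean
    and a traceless part give T. The products of traceless parts are 2 x 2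
    minors of symmetric forms on a plane, hence multiples of the minors of the
    scalar product of the plane, the factor being the determinant
    - (b^2 + s^2). *)
Lemma planar_curvature u v w : curv G x u v w =
  K *: wedge g u v w + (wedge g u (v *m T) w + wedge g (u *m T) v w)
  + c *: wedge g (u *m P) (v *m P) w.
Proof.
apply: (form_inj (metric_at_posdef Gx)) => z.
rewrite -/(curv4 G x u v w z) (curv4_shape_form Fx oE oxi ambient).
rewrite !mulT !mulP /wedge !ev.
rewrite !(gC (E p)) !(gC (E q)).
have -> : \sum_a (A a v w * A a u z - A a u w * A a v z)
  = (\sum_a lam a ^+ 2) * (g v w * g u z - g u w * g v z)
    + t * (g v w * (g u (E p) * g z (E p) - g u (E q) * g z (E q))
         + g u z * (g v (E p) * g w (E p) - g v (E q) * g w (E q))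
         - g u w * (g v (E p) * g z (E p) - g v (E q) * g z (E q))
         - g v z * (g u (E p) * g w (E p) - g u (E q) * g w (E q)))
    + r * (g v w * (g u (E p) * g z (E q) + g u (E q) * g z (E p))
         + g u z * (g v (E p) * g w (E q) + g v (E q) * g w (E p))
         - g u w * (g v (E p) * g z (E q) + g v (E q) * g z (E p))
         - g v z * (g u (E p) * g w (E q) + g u (E q) * g w (E p)))
    + c * ((g v (E p) * g w (E p) + g v (E q) * g w (E q))
             * (g u (E p) * g z (E p) + g u (E q) * g z (E q))
         - (g u (E p) * g w (E p) + g u (E q) * g w (E q))
             * (g v (E p) * g z (E p) + g v (E q) * g z (E q))).
  rewrite /t /r /c mulNr !mulr_suml -sumrN -!big_split; apply: eq_bigr => a _ /=.
  by rewrite !shapeE; ring.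
rewrite /K; ring.
Qed.

Let Tsym u v : g (u *m T) v = g u (v *m T).
Proof. by rewrite !mulT !ev (gC (E p) v) (gC (E q) v); ring. Qed.

Let Psym u v : g (u *m P) v = g u (v *m P).
Proof. by rewrite !mulP !ev (gC (E p) v) (gC (E q) v); ring. Qed.

Let PP : P *m P = P.
Proof.
apply/row_matrixP => i; rewrite row_mul !rowE !mulP !ev !oo.
by apply/rowP => l; rewrite !mxE; ring.
Qed.

Let go i : (g (E i) (E p) = (i == p)%:R) * (g (E i) (E q) = (i == q)%:R).
Proof. by rewrite !oE. Qed.

Let frameT (i : 'I_n) : i != p -> i != q -> E i *m T = 0.
Proof.
move=> /negPf ip /negPf iq; rewrite mulT !oE ip iq.
by rewrite !scale0r subrr addr0 !scaler0 addr0.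
Qed.

Let frameP (i : 'I_n) : i != p -> i != q -> E i *m P = 0.
Proof.
by move=> /negPf ip /negPf iq; rewrite mulP !oE ip iq !scale0r addr0.
Qed.

Let pT : E p *m T = t *: E p + r *: E q.
Proof. by rewrite mulT !oo !scale0r !scale1r subr0 addr0. Qed.

Let qT : E q *m T = - t *: E q + r *: E p.
Proof. by rewrite mulT !oo !scale0r !scale1r sub0r add0r scalerN scaleNr. Qed.

Let pP : E p *m P = E p.
Proof. by rewrite mulP !oo scale0r scale1r addr0. Qed.

Let qP : E q *m P = E q.
Proof. by rewrite mulP !oo scale0r scale1r add0r. Qed.

Let trT : \sum_i g (E i *m T) (E i) = 0.
Proof.
rewrite (sum_two_points pq) => [|i ip iq]; last by rewrite frameT // form0l.
by rewrite pT qT !ev !oo; ring.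
Qed.

Let trP : \sum_i g (E i *m P) (E i) = 2.
Proof.
rewrite (sum_two_points pq) => [|i ip iq]; last by rewrite frameP // form0l.
by rewrite pP qP !oo; ring.
Qed.

Hypothesis n4 : (4 <= n)%N.

Lemma planar_weyl u v w : weyl G x u v w = c *:
  (wedge g (u *m P) (v *m P) w
   - (n%:R - 2)^-1 *: (wedge g u (v *m P) w + wedge g (u *m P) v w)
   + (2 / ((n%:R - 2) * (n%:R - 1))) *: wedge g u v w).
Proof.
exact: (model_weyl n4 (metric_at_posdef Gx) oE Tsym Psym PP trT trP planar_curvature).
Qed.

Lemma planar_dependence_flat : 0 < k ->
  lin_dep6
    (fun X1 X2 X3 X4 X Y =>
       act4 (curv G x) (weyl4 G x) X1 X2 X3 X4 X Y
       - act4 (weyl G x) (curv4 G x) X1 X2 X3 X4 X Y)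
    (act4 (wedge g) (curv4 G x)) ->
  forall a, b a = 0 /\ s a = 0.
Proof.
move=> k0 dep.
have K0 : 0 < K by rewrite ltr_pwDl // sumr_ge0 // => a _; exact: sqr_ge0.
have [j [l [pj pl qj ql jl]]] : exists j l, [/\ p != j, p != l, q != j, q != l & j != l].
  have : (1 < #|~: [set p; q]|)%N.
    by have := cardsC [set p; q]; rewrite cards2 pq card_ord => e; lia.
  case/card_gt1P => j [l [jS lS jl]]; exists j, l.
  move: jS lS; rewrite !inE !negb_or => /andP[jp jq] /andP[lp lq].
  by rewrite ![p == _]eq_sym ![q == _]eq_sym jp jq lp lq.
have c0 : c = 0.
  apply: (model_dependence n4 (metric_at_posdef Gx) oE Tsym Psym PP trT trP
    planar_curvature K0 pq pj pl qj ql jl pT qT pP qP _ _ _ _ dep).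
  - by rewrite frameT // eq_sym.
  - by rewrite frameP // eq_sym.
  - by rewrite frameT // eq_sym.
  - by rewrite frameP // eq_sym.
move=> a; have /eqP : \sum_a (b a ^+ 2 + s a ^+ 2) = 0.
  by rewrite -[LHS]opprK -/c c0 oppr0.
rewrite psumr_eq0 => [/allP/(_ a (mem_index_enum a))|i _]; last by rewrite addr_ge0 ?sqr_ge0.
by rewrite /= paddr_eq0 ?sqr_ge0 // !sqrf_eq0 => /andP[/eqP -> /eqP ->].
Qed.

End PlanarShape.

Section Pointwise.
Variables (R : realType) (n m : nat) (G : 'rV[R]_n -> 'M[R]_n)
  (Gt : 'rV[R]_(n + m) -> 'M[R]_(n + m)) (F : 'rV[R]_n -> 'rV[R]_(n + m))
  (x : 'rV[R]_n).
Hypotheses (n4 : (4 <= n)%N) (Fx : isometric_at G Gt F x).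
Variables (E : 'I_n -> 'rV[R]_n) (xi : 'I_m -> 'rV[R]_(n + m)) (k : R).
Hypotheses (oE : tangent_frame G x E) (oxi : normal_frame Gt F x xi).
Hypothesis ambient : forall u v w z, curv4 Gt (F x) u v w z =
  k * (form (Gt (F x)) v w * form (Gt (F x)) u z
       - form (Gt (F x)) u w * form (Gt (F x)) v z).
Local Notation g := (form (G x)).
Local Notation A a := (shape_form G Gt F x (xi a)).

Let dependent_at := lin_dep6
  (fun X1 X2 X3 X4 X Y =>
     act4 (curv G x) (weyl4 G x) X1 X2 X3 X4 X Y
     - act4 (weyl G x) (curv4 G x) X1 X2 X3 X4 X Y)
  (act4 (wedge g) (curv4 G x)).

(** A traceless symmetric matrix supported on {p, q} has only two degrees of
    freedom. *)
Lemma shape_form_planar (E' : 'I_n -> 'rV[R]_n) (p q : 'I_n) lam a : p != q ->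
  orthonormal (G x) E' -> \tr (shape_mx G Gt F x E' xi a) = n%:R * lam ->
  (forall i j, (shape_mx G Gt F x E' xi a - lam%:M) i j != 0 ->
     ((i == p) || (i == q)) && ((j == p) || (j == q))) ->
  let N := shape_mx G Gt F x E' xi a - lam%:M in
  forall u v, A a u v = lam * g u v
    + N p p * (g u (E' p) * g v (E' p) - g u (E' q) * g v (E' q))
    + N p q * (g u (E' p) * g v (E' q) + g u (E' q) * g v (E' p)).
Proof.
move=> pq oE' trS supp N u v.
have NE i j : A a (E' i) (E' j) = lam * (i == j)%:R + N i j.
  by rewrite /N !mxE mulr_natr; ring.
have N0 i j : ((i != p) && (i != q)) || ((j != p) && (j != q)) -> N i j = 0.
  move=> h; apply/eqP; apply: contraTT h => /supp /andP[h1 h2].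
  by rewrite -!negb_or h1 h2.
have Nqp : N q p = N p q.
  by rewrite /N !mxE (shape_formC Fx) [q == p]eq_sym.
have trN : N p p + N q q = 0.
  transitivity (\tr N).
    by rewrite /mxtrace (sum_two_points pq) // => i ip iq; apply: N0; rewrite ip iq.
  by rewrite /N linearB /= trS mxtrace_scalar mulr_natl subrr.
rewrite (shape_form_coord Fx oE').
transitivity (lam * (\sum_i g u (E' i) * g v (E' i))
    + \sum_i \sum_j g u (E' i) * g v (E' j) * N i j).
  rewrite mulr_sumr -big_split; apply: eq_bigr => i _ /=.
  have -> : lam * (g u (E' i) * g v (E' i))
      = \sum_j g u (E' i) * g v (E' j) * (lam * (i == j)%:R).
    rewrite (bigD1 i) //= eqxx big1 ?addr0 ?mulr1 => [|j /negPf ji]; first by ring.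
    by rewrite eq_sym ji !mulr0.
  by rewrite -big_split; apply: eq_bigr => j _ /=; rewrite NE mulrDr.
have -> : \sum_i g u (E' i) * g v (E' i) = g u v.
  rewrite [in RHS](orthonormal_expansion v oE') form_sumr.
  by apply: eq_bigr => i _; rewrite formZr mulrC.
have -> : \sum_i \sum_j g u (E' i) * g v (E' j) * N i j
   = g u (E' p) * g v (E' p) * N p p + g u (E' p) * g v (E' q) * N p q
     + (g u (E' q) * g v (E' p) * N q p + g u (E' q) * g v (E' q) * N q q).
  rewrite (sum_two_points pq) => [|i ip iq]; last first.
    by rewrite big1 // => j _; rewrite N0 ?ip ?iq // mulr0.
  by congr (_ + _); rewrite (sum_two_points pq) // => j jp jq;
    rewrite N0 ?jp ?jq ?orbT // mulr0.
have -> : N q q = - N p p by apply/eqP; rewrite -addr_eq0 addrC trN.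
by rewrite Nqp; ring.
Qed.

(** In a frame adapted to the plane of ddvv_equality, planar_dependence_flat
    shows that the traceless parts are zero. *)
Lemma wintgen_dependent_umbilical : 0 < k ->
  norm_scalar_curv G x E
    = mean_curv G Gt F x E ^+ 2 - norm_normal_curv G Gt F x E xi + k ->
  dependent_at ->
  forall u v, second_ff G Gt F x u v
    = g u v *: \sum_a principal_mean G Gt F x E xi a *: xi a.
Proof.
move=> k0 wintgen dep u v.
have eqDDVV := wintgen_ddvv_equality Fx oE oxi n4 ambient wintgen.
pose lam a := principal_mean G Gt F x E xi a.
have Bs a : (traceless_shape_mx G Gt F x E xi a)^T = traceless_shape_mx G Gt F x E xi a.
  by rewrite /traceless_shape_mx linearB /= tr_scalar_mx (shape_mx_sym Fx).
have n1 : (1 < n)%N by exact: leq_trans n4.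
have [Q [p [q [QQ pq supp]]]] := ddvv_equality n1 Bs eqDDVV.
have [E' [oE' shapeE']] := rotate_frame Fx xi oE QQ.
have NE a : shape_mx G Gt F x E' xi a - (lam a)%:M
    = Q *m traceless_shape_mx G Gt F x E xi a *m Q^T.
  rewrite shapeE' /traceless_shape_mx mulmxBr mulmxBl mul_mx_scalar -scalemxAl QQ.
  by rewrite scalemx1.
have trE a : \tr (shape_mx G Gt F x E' xi a) = n%:R * lam a.
  rewrite shapeE' mxtrace_mulC mulmxA (mulmx1C QQ) mul1mx.
  by rewrite /lam /principal_mean mulrC divfK // pnatr_eq0 -lt0n ltnW.
pose N a := shape_mx G Gt F x E' xi a - (lam a)%:M.
have sE a := @shape_form_planar E' p q (lam a) a pq oE' (trE a).
have {}sE a u' v' : A a u' v' = lam a * g u' v'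
    + N a p p * (g u' (E' p) * g v' (E' p) - g u' (E' q) * g v' (E' q))
    + N a p q * (g u' (E' p) * g v' (E' q) + g u' (E' q) * g v' (E' p)).
  by apply: sE => i j; rewrite NE; exact: supp.
have flat := planar_dependence_flat Fx oE' pq sE ambient oxi n4 k0 dep.
rewrite (second_ff_expansion Fx oE oxi) scaler_sumr; apply: eq_bigr => a _.
rewrite sE; have [-> ->] := flat a.
by rewrite !mul0r !addr0 scalerA mulrC.
Qed.

Hypothesis umbilical : exists H, forall u v, second_ff G Gt F x u v = g u v *: H.

Lemma umbilical_curv4 : exists K, forall u v w z,
  curv4 G x u v w z = K * (g v w * g u z - g u w * g v z).
Proof.
have [H umb] := umbilical; exists (k + \sum_a (form (Gt (F x)) H (xi a)) ^+ 2) => u v w z.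
rewrite (curv4_shape_form Fx oE oxi ambient) mulrDl; congr (_ + _).
rewrite mulr_suml; apply: eq_bigr => a _.
by rewrite shape_form.unlock !umb !formZl; ring.
Qed.

(** Umbilicity is the planar case with zero traceless parts; the choice of the
    plane is then arbitrary. *)
Lemma umbilical_weyl u v w : weyl G x u v w = 0.
Proof.
have [H umb] := umbilical; have n0 : (0 < n)%N by exact: leq_trans n4.
have n1 : (1 < n)%N by exact: leq_trans n4.
pose p := Ordinal n0; pose q := Ordinal n1; have pq : p != q by [].
have sE a u' v' : A a u' v' = form (Gt (F x)) H (xi a) * g u' v'
    + 0 * (g u' (E p) * g v' (E p) - g u' (E q) * g v' (E q))
    + 0 * (g u' (E p) * g v' (E q) + g u' (E q) * g v' (E p)).
  by rewrite !mul0r !addr0 shape_form.unlock umb formZl mulrC.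
rewrite (planar_weyl Fx oE pq sE ambient oxi n4).
rewrite [X in X *: _](_ : _ = 0) ?scale0r //.
by rewrite big1 ?oppr0 // => a _; rewrite expr0n addr0.
Qed.

Lemma umbilical_dependent : dependent_at.
Proof.
have [K KE] := umbilical_curv4.
have w0 : weyl G x = fun _ _ _ => 0.
  by apply/funext => u; apply/funext => v; apply/funext => w; exact: umbilical_weyl.
exists 1, 0; split.
  by apply/eqP => -[] /eqP; rewrite oner_eq0.
move=> X1 X2 X3 X4 X Y; rewrite mul0r addr0 mul1r /act4 /weyl4 w0 !form0l !KE.
by rewrite !(form0l, form0r); ring.
Qed.

End Pointwise.

(** * From charts to points *)

Lemma open_chart_image (R : realType) n (M : topologicalType) (c : chart R n M)
    (W : set M) :
  open W -> open (chart_map c @` (chart_dom c `&` W)).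
Proof.
move=> oW; rewrite openE => _ [q [qc qW] <-].
have img : (chart_map c @` chart_dom c) (chart_map c q) by exists q.
have nimg : \forall y \near chart_map c q, (chart_map c @` chart_dom c) y.
  by apply: open_nbhs_nbhs; split=> //; exact: chart_img_open.
have ninv : \forall y \near chart_map c q, W (chart_inv c y).
  apply: (chart_inv_continuous img); rewrite chart_mapK //.
  by apply: open_nbhs_nbhs; split.
rewrite /interior; apply: filterS2 nimg ninv => _ [q' q'c <-].
by rewrite chart_mapK // => q'W; exists q'.
Qed.

Lemma metric_at_gram (R : realType) n (M : riemannian R n) (i : atlas_index M) (p : M) :
  chart_dom (atlas i) p -> metric_at (gram i) (chart_map (atlas i) p).
Proof.
move=> ip; have oU := @chart_img_open _ _ _ (atlas i).
have Up : (chart_map (atlas i) @` chart_dom (atlas i)) (chart_map (atlas i) p) by exists p.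
split; first by exists (chart_map (atlas i) @` chart_dom (atlas i)); split=> //; exact: gram_smooth.
have : \forall y \near chart_map (atlas i) p, (chart_map (atlas i) @` chart_dom (atlas i)) y.
  exact: open_nbhs_nbhs.
apply: filterS => _ [q qi <-]; split; first exact: gram_sym.
exact: gram_posdef.
Qed.

Lemma local_map_chart (R : realType) n d (M : manifold R n) (N : manifold R d)
    (f : M -> N) i j (p : M) : chart_dom (atlas i) p ->
  local_map f i j (chart_map (atlas i) p) = chart_map (atlas j) (f p).
Proof. by move=> ip; rewrite /local_map /= chart_mapK. Qed.

Lemma isometric_at_local_map (R : realType) n d (M : riemannian R n)
    (N : riemannian R d) (f : M -> N) (i : atlas_index M) (j : atlas_index N) (p : M) :
  isometric_immersion f -> chart_dom (atlas i) p -> chart_dom (atlas j) (f p) ->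
  isometric_at (gram i) (gram j) (local_map f i j) (chart_map (atlas i) p).
Proof.
move=> [cf sf iso] ip jfp.
have oW : open (f @^-1` chart_dom (atlas j)).
  by apply: open_comp => [x _|]; [exact: cf|exact: chart_dom_open].
pose U := chart_map (atlas i) @` (chart_dom (atlas i) `&` f @^-1` chart_dom (atlas j)).
have oU : open U by exact: open_chart_image.
have Up : U (chart_map (atlas i) p) by exists p.
split.
- by exists U; split=> //; exact: sf.
- exact: metric_at_gram.
- by rewrite local_map_chart //; exact: metric_at_gram.
have : \forall y \near chart_map (atlas i) p, U y by exact: open_nbhs_nbhs.
by apply: filterS => _ [q [qi qj] <-] u v; exact: iso.
Qed.

Lemma ambient_curvature (R : realType) n d k (M : manifold R n) (N : riemannian R d)
    (f : M -> N) (i : atlas_index M) (j : atlas_index N) (p : M) :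
  constant_curvature k N -> chart_dom (atlas i) p -> chart_dom (atlas j) (f p) ->
  let y := local_map f i j (chart_map (atlas i) p) in
  forall u v w z, curv4 (gram j) y u v w z =
    k * (form (gram j y) v w * form (gram j y) u z
         - form (gram j y) u w * form (gram j y) v z).
Proof.
move=> cc ip jfp /=; rewrite local_map_chart //.
by apply: constant_curvature_tensor; [exact: metric_at_gram|exact: cc].
Qed.

Lemma local_normal_frame (R : realType) n m (M : riemannian R n)
    (N : riemannian R (n + m)) (f : M -> N) (i : atlas_index M) (j : atlas_index N)
    (p : M) :
  isometric_immersion f -> chart_dom (atlas i) p -> chart_dom (atlas j) (f p) ->
  exists xi, normal_frame (gram j) (local_map f i j) (chart_map (atlas i) p) (xi : 'I_m -> _).
Proof.
move=> isof ip jfp; have Fx := isometric_at_local_map isof ip jfp.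
have [sF _ Tx _] := Fx.
have lin := derive_linear_dir (smooth_at_differentiable sF).
have [xi [oxi nxi]] := @normal_frame_exists R n m _
  (fun u => 'D_u (local_map f i j) (chart_map (atlas i) p)) (metric_at_posdef Tx) lin.
by exists xi; split.
Qed.

Lemma adapted_frames (R : realType) n m (M : riemannian R n)
    (N : riemannian R (n + m)) (f : M -> N) (i : atlas_index M) (p : M) :
  isometric_immersion f -> chart_dom (atlas i) p ->
  exists (j : atlas_index N) (E : 'I_n -> 'rV[R]_n) (xi : 'I_m -> 'rV[R]_(n + m)),
  [/\ chart_dom (atlas j) (f p), tangent_frame (gram i) (chart_map (atlas i) p) E &
      normal_frame (gram j) (local_map f i j) (chart_map (atlas i) p) xi].
Proof.
move=> isof ip; have [j jfp] := atlas_cover (f p).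
have [E oE] := tangent_frame_exists (metric_at_posdef (metric_at_gram ip)).
by have [xi oxi] := local_normal_frame isof ip jfp; exists j, E, xi.
Qed.

Unset Implicit Arguments.

Theorem theorem8 (R : realType) (n m : nat) (k : R)
    (N : riemannian R (n + m)) (M : riemannian R n) (f : M -> N) :
  (4 <= n)%N -> (2 <= m)%N ->
  constant_curvature k N ->
  isometric_immersion f ->
  wintgen_ideal k f ->
  0 < k ->
  (RC_sub_CR_dep_QgR M <-> totally_umbilical f) /\
  (totally_umbilical f -> conformally_flat M).
Proof.
move=> n4 _ cc isof wint k0.
have n0 : n%:R != 0 :> R by rewrite pnatr_eq0 -lt0n; exact: leq_trans n4.
have umbilicalP (i : atlas_index M) (j : atlas_index N) (p : M) E : totally_umbilical f ->
    chart_dom (atlas i) p -> chart_dom (atlas j) (f p) ->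
    tangent_frame (gram i) (chart_map (atlas i) p) E ->
    exists H, forall u v,
      second_ff (gram i) (gram j) (local_map f i j) (chart_map (atlas i) p) u v
      = form (gram i (chart_map (atlas i) p)) u v *: H.
  by move=> umb ip jfp oE; eexists => u v; exact: (umb i j p ip jfp E oE u v).
split; [split=> [dep i j p ip jfp /= E oE u v|umb i p ip]|move=> umb i p ip u v w z].
- have [xi oxi] := local_normal_frame isof ip jfp.
  have h := wintgen_dependent_umbilical n4 (isometric_at_local_map isof ip jfp) oE oxi
    (ambient_curvature cc ip jfp) k0 (wint i j p ip jfp E xi oE oxi) (dep i p ip).
  (* second_ff takes the value H on the unit vectors of the frame, so H is the mean *)
  rewrite /mean_curv_vec.
  move: (second_ff _ _ _ _) h => S; set H := \sum_a _; move: H => H h.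
  rewrite (eq_bigr _ (fun e _ => h (E e) (E e))).
  under eq_bigr do rewrite oE eqxx scale1r.
  rewrite sumr_const card_ord -(scaler_nat n H) [_ *: (_ *: H)]scalerA.
  by rewrite mulVf // scale1r h.
- have [j [E [xi [jfp oE oxi]]]] := adapted_frames isof ip.
  exact: (umbilical_dependent n4 (isometric_at_local_map isof ip jfp) oE oxi
    (ambient_curvature cc ip jfp) (umbilicalP i j p E umb ip jfp oE)).
- have [j [E [xi [jfp oE oxi]]]] := adapted_frames isof ip.
  rewrite /weyl4 (umbilical_weyl n4 (isometric_at_local_map isof ip jfp) oE oxi
    (ambient_curvature cc ip jfp) (umbilicalP i j p E umb ip jfp oE)).
  exact: form0l.
Qed.
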